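(* Let $(M,h)$ be a semi-Riemannian Einstein Spin-manifold of dimension $n$, normalized by $Ric(h)=\frac{2(n-1)J}{n}h$ for constant normalized scalar curvature $J\in\mathbb{R}$. Let $D$ be the Dirac operator of $(M,h)$, and for $N\in\mathbb{N}_0$ let $\mathcal{D}_{2N+1}$ be the $(2N+1)$-th conformal power of the Dirac operator on $(M,h)$. Then for every $N\in\mathbb{N}_0$ and all smooth spinor fields $\psi\in\Gamma(S(M,h))$, $$\mathcal{D}_{2N+1}\psi=\prod_{j=1}^{2N+1}\Big(D-(N-j+1)\sqrt{\tfrac{2J}{n}}\Big)\psi = D\prod_{j=1}^{N}\Big(D^2-j^2\,\tfrac{2J}{n}\Big)\psi ,$$ where the empty product is regarded as $1$ and $\sqrt{2J/n}$ denotes a fixed (possibly imaginary) square root of $2J/n$.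
   Context: $\mathbb{N}_0=\{0,1,2,\dots\}$. $(M,h)$ has signature $(p,q)$, $n=p+q\ge 3$; $J=\frac{\tau}{2(n-1)}$ with $\tau$ the scalar curvature. Clifford multiplication satisfies $x\cdot y+y\cdot x=-2\langle x,y\rangle$. $S(M,h)$ is the complex spinor bundle associated with a chosen spin structure and a complex irreducible Clifford representation on $\mathbb{C}^{2^{\lfloor n/2\rfloor}}$, $\nabla^{h,S}$ is the lift of the Levi-Civita connection, and $D\psi=\sum_i\varepsilon_i s_i\cdot\nabla^{h,S}_{s_i}\psi$ for an $h$-orthonormal frame $\{s_i\}$, $\varepsilon_i=h(s_i,s_i)=\pm1$. LOT means terms of lower differential order. Construction of $\mathcal{D}_{2N+1}$ (via the Poincaré-Einstein metric). For the Einstein metric $h$ the Poincaré-Einstein metric on $X=M\times(0,\varepsilon)$ is $g_+=r^{-2}(dr^2+h_r)$ with $h_r=(1-\frac{J}{2n}r^2)^2h$; put $\bar g=r^2g_+=dr^2+h_r$ on $M\times[0,\varepsilon)$, with spinor bundle $S(X,\bar g)$ and spin connection $\nabla^{\bar g,S}$. The leaf-wise Dirac operator on $S(X,\bar g)$ is $\widetilde D^{h_r}=\partial_r\cdot\sum_{i=1}^n\varepsilon_i s_i\cdot\widetilde\nabla^{h_r,S}_{s_i}$, where $\{s_i\}$ is an $h_r$-orthonormal frame tangent to $M$ and $\widetilde\nabla^{h_r,S}_Y\theta=Y(\theta)+\frac12\sum_{j<k}\varepsilon_j\varepsilon_k h_r(\nabla^{h_r}_Ys_j,s_k)\,s_j\cdot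 s_k\cdot\theta$ in the local trivialization given by $(s_1,\dots,s_n,\partial_r)$. Let $H_r=\frac1n\mathrm{tr}_{h_r}(W_r)$, where $W_r(Y)=-\nabla^{\bar g}_Y\partial_r$ is the Weingarten map of the leaf $M\times\{r\}$. Define $$D(\bar g)\theta=-r\,\partial_r\cdot\widetilde D^{h_r}\theta-\tfrac n2 rH_r\,\partial_r\cdot\theta+r\,\partial_r\cdot\nabla^{\bar g,S}_{\partial_r}\theta-\tfrac n2\,\partial_r\cdot\theta .$$ (This operator corresponds to the Dirac operator of $g_+$ under the isomorphism $S(X,g_+)\cong S(X,\bar g)$ coming from the conformal equivalence of $g_+$ and $\bar g$.) Let $S^{\pm\partial_r}(X,\bar g)$ be the $\pm i$-eigenbundles of Clifford multiplication by $\partial_r$. Fix $N\in\mathbb{N}_0$ and $\lambda=-\frac{2N+1}{2}$. For $\psi^+\in\Gamma(S^{+\partial_r}(X,\bar g)|_{r=0})$ there are unique sections $\theta_0,\dots,\theta_{2N}$ of $S(X,\bar g)$, each satisfying $\nabla^{\bar g,S}_{\partial_r}\theta_j=0$ and with $\theta_0|_{r=0}=\psi^+$, such that $\bar\theta=\sum_{j=0}^{2N}r^{\frac n2+\lambda+j}\theta_j$ satisfies $(D(\bar g)-i\lambda)\bar\theta=O(r^{\frac n2+\lambda+2N+1})$ (as formal expansions in $r$ with $\nabla^{\bar g,S}_{\partial_r}$-parallel coefficients). The obstruction to extending this solution by a term of order $r^{\frac n2+\lambda+2N+1}$ is the $S^{-\partial_r}$-component at $r=0$ of the coefficient of $r^{\frac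 n2+\lambda+2N+1}$ in $(D(\bar g)-i\lambda)\bar\theta$; it depends on $\psi^+$ through a linear differential operator. The same is done with the equation $D(\bar g)\bar\theta=-i\lambda\bar\theta$, again $\bar\theta=\sum_j r^{\frac n2+\lambda+j}\theta_j$ with $\lambda=-\frac{2N+1}2$, and initial data $\psi^-\in\Gamma(S^{-\partial_r}(X,\bar g)|_{r=0})$, the obstruction now being the $S^{+\partial_r}$-component. Each of the two obstruction operators is multiplied by the nonzero constant that makes its leading part equal to $\widetilde D^{2N+1}$, where $\widetilde D:=\widetilde D^{h_0}$, and together they give an operator on $\Gamma(S(X,\bar g)|_{r=0})$. One identifies $S(X,\bar g)|_{r=0}\cong S(M,h)$ with $\widetilde D\simeq D$ if $n$ is even, and $S(X,\bar g)|_{r=0}\cong S(M,h)\oplus S(M,h)$ with $\widetilde D\simeq\begin{pmatrix}D&0\\0&-D\end{pmatrix}$ if $n$ is odd. The operator induced on $\Gamma(S(M,h))$ (for $n$ odd: the first diagonal component) is $\mathcal{D}_{2N+1}=D^{2N+1}+\mathrm{LOT}$, the $(2N+1)$-th conformal power of the Dirac operator. On Einstein manifolds, the explicit form of $h_r$ makes this construction work for all $N\in\mathbb{N}_0$, also for even $n$. *)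

(* Defs.v *)
From HB Require Import structures.
From mathcomp Require Import all_boot all_order all_algebra.
From mathcomp Require Import complex.
From mathcomp Require Import all_classical all_reals all_analysis.

Set Implicit Arguments.
Unset Strict Implicit.
Unset Printing Implicit Defensive.

Import Order.TTheory GRing.Theory Num.Theory numFieldNormedType.Exports.
Local Open Scope classical_set_scope.
Local Open Scope ring_scope.

(** * Calculus on open subsets of R^m

   R[i] is only used as a field: limits, derivatives and smoothness of complex
   valued functions are taken separately on real and imaginary parts, and those
   of vector valued functions entrywise. *)

Section Calculus.
Variables (R : realType) (m : nat).
Implicit Types (U : set 'rV[R]_m).

Definition toC (x : R) : R[i] := (x%:C)%C.

Fixpoint Ck_on (k : nat) U (f : 'rV[R]_m -> R) : Prop :=
  if k is k'.+1 then
    (forall y, U y -> differentiable f y) /\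
    (forall i : 'I_m, Ck_on k' U (fun y => 'D_(delta_mx 0 i) f y))
  else forall y, U y -> {for y, continuous f}.

Definition smooth_on U (f : 'rV[R]_m -> R) := forall k, Ck_on k U f.

Definition csmooth_on U (f : 'rV[R]_m -> R[i]) :=
  smooth_on U (fun y => complex.Re (f y)) /\
  smooth_on U (fun y => complex.Im (f y)).

Definition vsmooth_on d U (f : 'rV[R]_m -> 'cV[R[i]]_d) :=
  forall i, csmooth_on U (fun y => f y i 0).

(* Smoothness on a set that need not be open, such as V x [0, rad). *)
Definition vsmooth_on_closed d (A : set 'rV[R]_m) (f : 'rV[R]_m -> 'cV[R[i]]_d) :=
  exists O : set 'rV[R]_m, exists F : 'rV[R]_m -> 'cV[R[i]]_d,
    [/\ open O, A `<=` O, vsmooth_on O F & forall y, A y -> F y = f y].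

Definition vderive d (f : 'rV[R]_m -> 'cV[R[i]]_d) (y v : 'rV[R]_m) : 'cV[R[i]]_d :=
  \col_i (Complex ('D_v (fun z => complex.Re (f z i 0)) y)
                  ('D_v (fun z => complex.Im (f z i 0)) y)).

Definition partials d (w : seq 'I_m) (f : 'rV[R]_m -> 'cV[R[i]]_d) :
    'rV[R]_m -> 'cV[R[i]]_d :=
  foldr (fun i F y => vderive F y (delta_mx 0 i)) f w.

End Calculus.

Definition vcvg0_right (R : realType) d (f : R -> 'cV[R[i]]_d) : Prop :=
  forall i, complex.Re (f r i 0) @[r --> 0^'+] --> (0 : R) /\
            complex.Im (f r i 0) @[r --> 0^'+] --> (0 : R).

(** * Semi-Riemannian geometry in a coordinate patch

   A metric is given by its Gram matrix g, a vector by its row of coordinates,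
   a frame by the matrix whose rows are the frame vectors. *)

Section LocalGeometry.
Variables (R : realType) (m : nat) (g : 'rV[R]_m -> 'M[R]_m).
Implicit Types (y u v : 'rV[R]_m).

Definition inner y u v : R := (u *m g y *m v^T) 0 0.

(* christoffel y i j k is Gamma^k_(ij). *)
Definition christoffel y (i j k : 'I_m) : R :=
  2%:R^-1 * \sum_l invmx (g y) k l *
    ('D_(delta_mx 0 i) (fun z => g z j l) y
     + 'D_(delta_mx 0 j) (fun z => g z i l) y
     - 'D_(delta_mx 0 l) (fun z => g z i j) y).

(* nabla v Z y is (nabla_v Z)(y). *)
Definition nabla v (Z : 'rV[R]_m -> 'rV[R]_m) y : 'rV[R]_m :=
  \row_k ('D_v (fun z => Z z 0 k) y
          + \sum_i \sum_j v 0 i * Z y 0 j * christoffel y i j k).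

(* the d_l-component of R(d_i, d_j) d_k *)
Definition riemann y (i j k l : 'I_m) : R :=
  'D_(delta_mx 0 i) (fun z => christoffel z j k l) y
  - 'D_(delta_mx 0 j) (fun z => christoffel z i k l) y
  + \sum_s (christoffel y j k s * christoffel y i s l
            - christoffel y i k s * christoffel y j s l).

Definition ricci y : 'M[R]_m := \matrix_(j, k) \sum_i riemann y i j k i.

(* The lifted connection and the Dirac operator in the trivialization of the
   spinor bundle given by the orthonormal frame e, with signs eps; cl j is
   Clifford multiplication by the j-th frame vector. *)
Variables (d : nat) (e : 'rV[R]_m -> 'M[R]_m) (eps : 'I_m -> R).
Variable cl : 'I_m -> 'M[R[i]]_d.

Definition spin_nabla v (psi : 'rV[R]_m -> 'cV[R[i]]_d) y : 'cV[R[i]]_d :=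
  vderive psi y v
  + toC 2%:R^-1 *: \sum_(j < m) \sum_(k < m | (j < k)%N)
      toC (eps j * eps k
           * inner y (nabla v (fun z => row j (e z)) y) (row k (e y)))
      *: (cl j *m (cl k *m psi y)).

Definition local_dirac (psi : 'rV[R]_m -> 'cV[R[i]]_d) y : 'cV[R[i]]_d :=
  \sum_i toC (eps i) *: (cl i *m spin_nabla (row i (e y)) psi y).

End LocalGeometry.

(** * Clifford representations and the spin group *)

Section Clifford.
Variables (R : realType) (n : nat).

Definition sign_of (p : nat) (i : 'I_n) : R := if (i < p)%N then 1 else -1.

Definition is_irreducible_clifford_rep (m d : nat) (eps : 'I_m -> R)
    (cl : 'I_m -> 'M[R[i]]_d) : Prop :=
  (forall i j, cl i *m cl j + cl j *m cl i
               = (if i == j then - 2%:R * toC (eps i) else 0)%:M) /\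
  (* submodules are row spaces, hence the transposes *)
  (forall U : 'M[R[i]]_d, (forall i, stablemx U (cl i)^T) -> U = 0 \/ row_full U).

Variables (eps : 'I_n -> R) (d : nat) (cl : 'I_n -> 'M[R[i]]_d).

Definition clifford_mul (v : 'rV[R]_n) : 'M[R[i]]_d :=
  \sum_i toC (v 0 i) *: cl i.

(* Spin(p,q) consists of the products of an even number of vectors v with
   <v,v> = 1 or -1; its elements are presented by words of such vectors. Two
   words define the same element iff they act equally under an irreducible
   complex Clifford representation, since those are faithful on the even
   subalgebra. *)
Definition spin_word (w : seq 'rV[R]_n) : Prop :=
  ~~ odd (size w) /\
  (forall v, v \in w ->
     let q := \sum_i eps i * v 0 i ^+ 2 in q = 1 \/ q = -1).

Definition spin_action (w : seq 'rV[R]_n) : 'M[R[i]]_d :=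
  foldr (fun v A => clifford_mul v *m A) 1%:M w.

End Clifford.

(** * Semi-Riemannian spin manifolds

   An atlas together with, on every chart domain, an h-orthonormal frame and a
   section of the spin structure over that frame: the spin structure is then
   given by its Spin(p,q)-valued transition functions, which lift those of the
   frames. Every spin manifold has such an atlas (take contractible chart
   domains). *)

Record spin_manifold (R : realType) (n d : nat) (eps : 'I_n -> R)
    (gamma : 'I_n -> 'M[R[i]]_d) := SpinManifold {
  carrier :> topologicalType;
  hausdorffM : hausdorff_space carrier;
  countableM : @second_countable carrier;

  chart : Type;
  dom : chart -> set carrier;
  coord : chart -> carrier -> 'rV[R]_n;
  param : chart -> 'rV[R]_n -> carrier;
  dom_open : forall a, open (dom a);
  dom_cover : forall x, exists a, dom a x;
  image_open : forall a, open (coord a @` dom a);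
  coordK : forall a x, dom a x -> param a (coord a x) = x;
  coord_continuous : forall a x, dom a x -> {for x, continuous (coord a)};
  param_continuous : forall a x, dom a x -> {for coord a x, continuous (param a)};
  transition_smooth : forall a b (k : 'I_n),
    smooth_on (coord b @` (dom a `&` dom b)) (fun y => coord a (param b y) 0 k);

  metric : chart -> 'rV[R]_n -> 'M[R]_n;
  metric_smooth : forall a i j, smooth_on (coord a @` dom a) (fun y => metric a y i j);
  metric_sym : forall a x, dom a x -> (metric a (coord a x))^T = metric a (coord a x);
  metric_change : forall a b x, dom a x -> dom b x ->
    let jac := jacobian (coord a \o param b) (coord b x) in
    metric b (coord b x) = jac *m metric a (coord a x) *m jac^T;

  frame : chart -> 'rV[R]_n -> 'M[R]_n;
  frame_smooth : forall a i j, smooth_on (coord a @` dom a) (fun y => frame a y i j);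
  frame_orthonormal : forall a x, dom a x ->
    frame a (coord a x) *m metric a (coord a x) *m (frame a (coord a x))^T
    = diag_mx (\row_i eps i);

  spin_lift : chart -> chart -> carrier -> seq 'rV[R]_n;
  lift_spin : forall a b x, dom a x -> dom b x -> spin_word eps (spin_lift a b x);
  lift_smooth : forall a b i j,
    csmooth_on (coord a @` (dom a `&` dom b))
      (fun y => spin_action gamma (spin_lift a b (param a y)) i j);
  lift_cocycle : forall a b c x, dom a x -> dom b x -> dom c x ->
    spin_action gamma (spin_lift a b x) *m spin_action gamma (spin_lift b c x)
    = spin_action gamma (spin_lift a c x);
  (* The frame of patch b is obtained from that of patch a by the image of the
     lift in SO(p,q), i.e. by v |-> g v g^-1. Row j of [change] is the j-th
     vector of frame b expressed in frame a. *)
  lift_frame : forall a b x (j : 'I_n), dom a x -> dom b x ->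
    let jac := jacobian (coord a \o param b) (coord b x) in
    let change := frame b (coord b x) *m jac *m invmx (frame a (coord a x)) in
    spin_action gamma (spin_lift a b x) *m gamma j
    = clifford_mul gamma (row j change) *m spin_action gamma (spin_lift a b x)
}.

Arguments dom {R n d eps gamma} s _ _.
Arguments coord {R n d eps gamma} s _ _.
Arguments param {R n d eps gamma} s _ _.
Arguments metric {R n d eps gamma} s _ _.
Arguments frame {R n d eps gamma} s _ _.
Arguments spin_lift {R n d eps gamma} s _ _ _.

Definition is_einstein (R : realType) n d (eps : 'I_n -> R)
    (gamma : 'I_n -> 'M[R[i]]_d) (M : spin_manifold eps gamma) (J : R) : Prop :=
  forall a x, dom M a x ->
    ricci (metric M a) (coord M a x)
    = (2%:R * (n%:R - 1) * J / n%:R) *: metric M a (coord M a x).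

(** * Spinor fields

   A section of the bundle with fibre C^k associated with the spin structure is
   a family of C^k-valued functions, one in each patch; its values outside the
   patch are irrelevant. *)

Section SpinorFields.
Variables (R : realType) (n d : nat) (eps : 'I_n -> R).
Variables (gamma : 'I_n -> 'M[R[i]]_d) (M : spin_manifold eps gamma).

Definition spinor_family k := chart M -> M -> 'cV[R[i]]_k.

Definition is_smooth_spinor k (cl : 'I_n -> 'M[R[i]]_k) (psi : spinor_family k) : Prop :=
  (forall a b x, dom M a x -> dom M b x ->
     psi a x = spin_action cl (spin_lift M a b x) *m psi b x) /\
  (forall a, vsmooth_on (coord M a @` dom M a) (fun y => psi a (param M a y))).

Definition dirac_op (psi : spinor_family d) : spinor_family d := fun a x =>
  local_dirac (metric M a) (frame M a) eps gamma
    (fun y => psi a (param M a y)) (coord M a x).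

Definition diff_op_order_le k (S : spinor_family k -> Prop) (Q : spinor_family k -> spinor_family k)
    (ord : nat) : Prop :=
  forall a, exists A : seq 'I_n -> 'rV[R]_n -> 'M[R[i]]_k,
    (forall w i j, csmooth_on (coord M a @` dom M a) (fun y => A w y i j)) /\
    (forall psi, S psi -> forall x, dom M a x ->
       Q psi a x = \sum_(l < ord.+1) \sum_(w : l.-tuple 'I_n)
         A w (coord M a x)
           *m partials w (fun y => psi a (param M a y)) (coord M a x)).

End SpinorFields.

(** * The Poincare-Einstein metric and conformal powers of the Dirac operator

   X = M x (0, rad), g_+ = r^-2 gbar, gbar = dr^2 + h_r and
   h_r = conf_factor(r)^2 h, where conf_factor(r) = 1 - J r^2 / (2n). *)

Section PoincareEinstein.
Variables (R : realType) (n d D : nat) (eps : 'I_n -> R).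
Variables (gamma : 'I_n -> 'M[R[i]]_d) (M : spin_manifold eps gamma).
Variables (J rad : R).
(* Clifford representation for (X, gbar): Gamma (lshift 1 i) is multiplication
   by s_i, Gamma (rshift n 0) is multiplication by d/dr. *)
Variable Gamma : 'I_(n + 1) -> 'M[R[i]]_D.

Definition epsX (i : 'I_(n + 1)) : R :=
  match fintype.split i with inl j => eps j | inr _ => 1 end.

Definition GammaT (i : 'I_n) : 'M[R[i]]_D := Gamma (lshift 1 i).
Definition GammaR : 'M[R[i]]_D := Gamma (rshift n ord0).

Definition conf_factor (r : R) : R := 1 - J / (2%:R * n%:R) * r ^+ 2.

(* Coordinates on X: the point (x, r) has coordinates (coord a x, r). *)
Definition ptX (y : 'rV[R]_n) (r : R) : 'rV[R]_(n + 1) :=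
  row_mx y (const_mx r : 'rV[R]_1).
Definition yX (z : 'rV[R]_(n + 1)) : 'rV[R]_n := lsubmx z.
Definition rX (z : 'rV[R]_(n + 1)) : R := rsubmx z 0 0.
Definition dr : 'rV[R]_(n + 1) := ptX 0 1.

Definition leaf_metric a r (y : 'rV[R]_n) : 'M[R]_n := conf_factor r ^+ 2 *: metric M a y.
Definition leaf_frame a r (y : 'rV[R]_n) : 'M[R]_n := (conf_factor r)^-1 *: frame M a y.
Definition metricX a (z : 'rV[R]_(n + 1)) : 'M[R]_(n + 1) :=
  block_mx (leaf_metric a (rX z) (yX z)) 0 0 1%:M.
Definition frameX a (z : 'rV[R]_(n + 1)) : 'M[R]_(n + 1) :=
  block_mx (leaf_frame a (rX z) (yX z)) 0 0 1%:M.

(* Sections of S(X, gbar) over M x [0, rad), in the trivializations given by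
   frameX. The transition functions of these frames, hence their lifts, do not
   depend on r and are those of M, viewed in Spin of R^n + R (d/dr). *)
Definition spinor_familyX := chart M -> M -> R -> 'cV[R[i]]_D.

Definition inX (theta : spinor_familyX) a (z : 'rV[R]_(n + 1)) : 'cV[R[i]]_D :=
  theta a (param M a (yX z)) (rX z).

Definition is_smooth_spinorX (theta : spinor_familyX) : Prop :=
  (forall a b x r, dom M a x -> dom M b x -> 0 <= r -> r < rad ->
     theta a x r = spin_action GammaT (spin_lift M a b x) *m theta b x r) /\
  (forall a, vsmooth_on_closed
     [set z | (coord M a @` dom M a) (yX z) /\ 0 <= rX z /\ rX z < rad]
     (inX theta a)).

Definition nabla_dr (theta : spinor_familyX) : spinor_familyX := fun a x r =>
  spin_nabla (metricX a) (frameX a) epsX Gamma dr (inX theta a)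
    (ptX (coord M a x) r).

Definition is_parallel (theta : spinor_familyX) : Prop :=
  forall a x r, dom M a x -> 0 < r -> r < rad -> nabla_dr theta a x r = 0.

Definition leaf_dirac (r : R) (Psi : spinor_family M D) : spinor_family M D := fun a x =>
  GammaR *m local_dirac (leaf_metric a r) (leaf_frame a r) eps GammaT
    (fun y => Psi a (param M a y)) (coord M a x).

(* W_r(s_i) = - nabla_(s_i) d/dr and H_r = tr W_r / n *)
Definition weingarten a (z : 'rV[R]_(n + 1)) (i : 'I_n) : 'rV[R]_(n + 1) :=
  - nabla (metricX a) (row (lshift 1 i) (frameX a z)) (fun _ => dr) z.
Definition mean_curv a (z : 'rV[R]_(n + 1)) : R :=
  n%:R^-1 * \sum_(i < n) eps i *
    inner (metricX a) z (weingarten a z i) (row (lshift 1 i) (frameX a z)).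

(* The Dirac operator of g_+ = r^-2 gbar, transported to S(X, gbar) by the
   conformal equivalence of the two metrics. *)
Definition dirac_gbar (theta : spinor_familyX) : spinor_familyX := fun a x r =>
  - (toC r *: (GammaR *m leaf_dirac r (fun b x' => theta b x' r) a x))
  - toC (n%:R / 2%:R * r * mean_curv a (ptX (coord M a x) r))
      *: (GammaR *m theta a x r)
  + toC r *: (GammaR *m nabla_dr theta a x r)
  - toC (n%:R / 2%:R) *: (GammaR *m theta a x r).

(* sg = false stands for the sign +, sg = true for the sign -. *)
Definition signC (sg : bool) : R[i] := (-1) ^+ sg.

Definition in_eigenbundle (sg : bool) (v : 'cV[R[i]]_D) : Prop :=
  GammaR *m v = (signC sg * 'i%C) *: v.
Definition eigenproj (sg : bool) (v : 'cV[R[i]]_D) : 'cV[R[i]]_D :=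
  toC 2%:R^-1 *: (v - (signC sg * 'i%C) *: (GammaR *m v)).

Definition is_smooth_eigenspinor sg (Psi : spinor_family M D) : Prop :=
  is_smooth_spinor GammaT Psi /\
  (forall a x, dom M a x -> in_eigenbundle sg (Psi a x)).

Section Order.
Variable N : nat.

Definition lambda : R := - ((2 * N + 1)%:R / 2%:R).
Definition expo (j : nat) : R := n%:R / 2%:R + lambda + j%:R.

Definition theta_bar (theta : nat -> spinor_familyX) : spinor_familyX := fun a x r =>
  \sum_(j < (2 * N).+1) toC (r `^ expo j) *: theta j a x r.

(* Psi |-> Xi : for some theta_0, .., theta_2N as in the construction,
   (D(gbar) -+ i lambda) theta_bar = r^(n/2+lambda+2N+1) omega + higher order,
   and Xi is the S^(-sg)-component of omega at r = 0. *)
Definition obstruction sg (Psi Xi : spinor_family M D) : Prop :=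
  exists (theta : nat -> spinor_familyX) (omega : spinor_familyX),
    [/\ forall j, (j <= 2 * N)%N ->
          is_smooth_spinorX (theta j) /\ is_parallel (theta j),
        forall a x, dom M a x -> theta 0%N a x 0 = Psi a x,
        is_smooth_spinorX omega /\ is_parallel omega,
        forall a x, dom M a x ->
          vcvg0_right (fun r =>
            toC (r `^ (- expo (2 * N + 1)))
              *: (dirac_gbar (theta_bar theta) a x r
                  - (signC sg * 'i%C * toC lambda) *: theta_bar theta a x r)
            - omega a x r)
      & forall a x, dom M a x -> Xi a x = eigenproj (~~ sg) (omega a x 0)].

(* A : S(X, gbar)|_(r=0) -> S(M, h) and B in the other direction are, in the
   given trivializations, the identification for n even, and the projection
   onto and the inclusion of the first summand S(M, h) for n odd. The Clifford
   action of M on S(X, gbar)|_(r=0) is v |-> d/dr . v, so that the leaf-wise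
   Dirac operator corresponds to D, resp. to (D, -D). *)
Definition is_spinor_identification (A : 'M[R[i]]_(d, D)) (B : 'M[R[i]]_(D, d)) :
    Prop :=
  if odd n then
    exists (A' : 'M[R[i]]_(d, D)) (B' : 'M[R[i]]_(D, d)),
      [/\ A *m B = 1%:M /\ A' *m B' = 1%:M,
          A *m B' = 0 /\ A' *m B = 0,
          B *m A + B' *m A' = 1%:M,
          forall i, A *m (GammaR *m GammaT i) = gamma i *m A
        & forall i, A' *m (GammaR *m GammaT i) = - (gamma i *m A')]
  else
    [/\ A *m B = 1%:M, B *m A = 1%:M
      & forall i, A *m (GammaR *m GammaT i) = gamma i *m A].

Definition is_conformal_power (A : 'M[R[i]]_(d, D)) (B : 'M[R[i]]_(D, d))
    (P : spinor_family M d -> spinor_family M d) : Prop :=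
  exists (Obs : bool -> spinor_family M D -> spinor_family M D) (c : bool -> R[i]),
    (forall sg,
       [/\ c sg != 0,
           forall Psi, is_smooth_eigenspinor sg Psi -> obstruction sg Psi (Obs sg Psi)
         & diff_op_order_le (is_smooth_eigenspinor sg)
             (fun Psi a x => c sg *: Obs sg Psi a x
                             - iter (2 * N + 1) (leaf_dirac 0) Psi a x)
             (2 * N)]) /\
    (forall psi, is_smooth_spinor gamma psi -> forall a x, dom M a x ->
       P psi a x = A *m \sum_(sg : bool) c sg *:
         Obs sg (fun b y => eigenproj sg (B *m psi b y)) a x).

End Order.
End PoincareEinstein.

(* Main.v *)
(** Since [h_r = phi(r)^2 h] with [phi(r) = 1 - a r^2], [a = J / 2n], the leaf-wise
    Dirac operator is [phi(r)^-1] times the boundary operator [L], and the mean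
    curvature is [- phi'(r) / phi(r)].  Multiplying [(D(gbar) -+ i lambda) theta] by
    [phi(r)] therefore gives a polynomial in [r], up to a power of [r], and its
    coefficients determine the solution: [theta_j = p_j(L) psi], where, with
    [c_j = j] for [j] even and [c_j = j - (2N+1)] for [j] odd,
    [c_j p_j = X p_(j-1) + a (n + c_j - 2) p_(j-2)].  At [j = 2N+1] the factor [c_j]
    vanishes and the right-hand side is the obstruction.  Expanding the [p_j] of odd
    index in the basis [X * epoly l], with
    [epoly l = (X^2 - 4a 1^2) ... (X^2 - 4a l^2)], the recurrence is
    solved in closed form and the obstruction is a nonzero multiple of
    [X * epoly N], whose roots are [k sqrt(2J/n)] for [|k| <= N].

    The normalizing constants are only specified through the leading part being
    [L^(2N+1)].  They are recovered by evaluating at a point [x0] the operators on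
    [f^(2N+1) b], where [f] is linear in a chart and vanishes at [x0] and [b] is a
    bump spinor: only terms of order [2N+1] survive, and the symbol of [L] at the
    differential of [f] is invertible. *)

Require Import Defs.
From HB Require Import structures.
From mathcomp Require Import all_boot all_order all_algebra.
From mathcomp Require Import complex.
From mathcomp Require Import all_classical all_reals all_analysis.
From mathcomp Require Import ring lra zify.
Set Implicit Arguments.
Unset Strict Implicit.
Unset Printing Implicit Defensive.
Import Order.TTheory GRing.Theory Num.Theory numFieldNormedType.Exports.
Local Open Scope classical_set_scope.
Local Open Scope ring_scope.

(** * The obstruction polynomial *)

Section ObstructionPolynomial.
Variables (F : numFieldType) (a nu : F) (N : nat).

Definition indicial (j : nat) : F := if odd j then j%:R - (2 * N + 1)%:R else j%:R.

Definition epoly (l : nat) : {poly F} :=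
  \prod_(1 <= i < l.+1) ('X^2 - (4%:R * a * i%:R ^+ 2)%:P).

(* [wpoly k] is the solution of index [2k + 1] divided by ['X]; [wpoly_coord k] are
   its coordinates in the basis [epoly]. *)
Definition binom_coef (l s : nat) : F := \prod_(i < s) ((nu + 1 + l%:R + i%:R) / i.+1%:R).
Definition lead_coord (l : nat) : F :=
  - (2 * N)%:R^-1 * \prod_(i < l) (4%:R * i.+1%:R * (i.+1%:R - N%:R))^-1.
Definition wpoly_coord (k l : nat) : F :=
  if (l <= k)%N then lead_coord l * binom_coef l (k - l) * a ^+ (k - l) else 0.
Definition wpoly (k : nat) : {poly F} := \sum_(l < k.+1) wpoly_coord k l *: epoly l.

Lemma epolyS l : epoly l.+1 = epoly l * ('X^2 - (4%:R * a * l.+1%:R ^+ 2)%:P).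
Proof. by rewrite /epoly big_nat_recr. Qed.

Lemma X2_epoly l : 'X^2 * epoly l = epoly l.+1 + (4%:R * a * l.+1%:R ^+ 2) *: epoly l.
Proof. by rewrite epolyS -mul_polyC; ring. Qed.

Lemma nat1r_neq0 (s : nat) : 1 + s%:R != 0 :> F.
Proof. by rewrite nat1r pnatr_eq0. Qed.

Lemma binom_coefS l s : s.+1%:R * binom_coef l s.+1 = (nu + 1 + l%:R + s%:R) * binom_coef l s.
Proof. by rewrite /binom_coef big_ord_recr /=; field; exact: nat1r_neq0. Qed.

Lemma binom_coef_shift l s : s.+1%:R * binom_coef l s.+1 = (nu + l.+1%:R) * binom_coef l.+1 s.
Proof.
elim: s => [|s IH]; first by rewrite /binom_coef big_ord_recl !big_ord0 /=; field.
have -> : binom_coef l s.+2 = (nu + 1 + l%:R + s.+1%:R) / s.+2%:R * binom_coef l s.+1.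
  by rewrite /binom_coef [in LHS]big_ord_recr /= mulrC.
have -> : binom_coef l.+1 s.+1 = (nu + 1 + l.+1%:R + s%:R) / s.+1%:R * binom_coef l.+1 s.
  by rewrite /binom_coef [in LHS]big_ord_recr /= mulrC.
have s2 : 2%:R + s%:R != 0 :> F by rewrite -natrD pnatr_eq0.
transitivity ((nu + 1 + l%:R + s.+1%:R) / s.+1%:R * (s.+1%:R * binom_coef l s.+1)).
  by field; rewrite s2 nat1r_neq0.
by rewrite IH; field; exact: nat1r_neq0.
Qed.

Lemma lead_coordS l : (l.+1 < N)%N ->
  lead_coord l = 4%:R * l.+1%:R * (l.+1%:R - N%:R) * lead_coord l.+1.
Proof.
move=> lN; rewrite /lead_coord big_ord_recr /=.
have h2 : l.+1%:R - N%:R != 0 :> F by rewrite subr_eq0 eqr_nat neq_ltn lN.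
have h1 : l.+1%:R != 0 :> F by rewrite pnatr_eq0.
set P := \prod_(_ < _) _; set Q := (2 * N)%:R^-1.
rewrite invfM invfM.
transitivity (- Q * P * (l.+1%:R * l.+1%:R^-1) * ((l.+1%:R - N%:R) * (l.+1%:R - N%:R)^-1) * (4%:R * 4%:R^-1)).
  by rewrite !mulfV // ?mulr1 // pnatr_eq0.
by ring.
Qed.

Lemma lead_coord_neq0 l : (l < N)%N -> lead_coord l != 0.
Proof.
move=> lN; rewrite /lead_coord mulf_neq0 //.
  by rewrite oppr_eq0 invr_eq0 pnatr_eq0 muln_eq0 /=; case: N lN.
apply/prodf_neq0 => i _; rewrite invr_eq0 !mulf_neq0 // ?pnatr_eq0 //.
by rewrite subr_eq0 eqr_nat neq_ltn (leq_ltn_trans (ltn_ord i)).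
Qed.

(* Three-term recurrence obtained by eliminating the polynomials of even
   index; at [k = N] the left-hand side degenerates to its leading term. *)
Lemma wpoly_rec k (wm2 : {poly F}) : (0 < k <= N)%N ->
  wm2 = (if (1 < k)%N then wpoly k.-2 else 0) ->
  'X^2 * wpoly k.-1
  + (a * (2%:R * nu + 2%:R * k%:R - 2%:R) * (2%:R * (k%:R - 1 - N%:R))) *: wpoly k.-1
  - (a ^+ 2 * (2%:R * nu + 2%:R * k%:R - 2%:R) *
     (2%:R * nu + 2%:R * k%:R - 2%:R * N%:R - 4%:R)) *: wm2
  + (2%:R * k%:R * a * (2%:R * nu + 2%:R * k%:R - 2%:R * N%:R - 2%:R)) *: wpoly k.-1
  = (4%:R * k%:R * (k%:R - N%:R)) *: (\sum_(l < k) wpoly_coord k l *: epoly l)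
    + lead_coord k.-1 *: epoly k.
Proof.
case: k => // k; rewrite /= ltnS => kN wm2E.
have -> : 'X^2 * wpoly k = \sum_(l < k.+1) wpoly_coord k l *: epoly l.+1
    + \sum_(l < k.+1) (4%:R * a * l.+1%:R ^+ 2 * wpoly_coord k l) *: epoly l.
  rewrite /wpoly mulr_sumr -big_split /=; apply: eq_bigr => l _.
  by rewrite -scalerAr X2_epoly scalerDr scalerA [wpoly_coord k l * _]mulrC.
pose g l := 4%:R * l%:R * (l%:R - N%:R) * lead_coord l * binom_coef l.-1 (k.+1 - l) * a ^+ (k.+1 - l).
have -> : \sum_(l < k.+1) wpoly_coord k l *: epoly l.+1
          = \sum_(l < k.+1) g l *: epoly l + lead_coord k *: epoly k.+1.
  rewrite big_ord_recr /= /wpoly_coord leqnn subnn expr0 /binom_coef big_ord0 !mulr1.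
  congr (_ + _); rewrite big_ord_recl /= {1}/g !(mulr0, mul0r) scale0r add0r.
  apply: eq_bigr => l _; rewrite /bump /= add1n (ltnW (ltn_ord l)) /g /= subSS.
  by rewrite (@lead_coordS l) //; apply: leq_ltn_trans kN.
pose w2 l := if (0 < k)%N then wpoly_coord k.-1 l else 0.
have -> : wm2 = \sum_(l < k.+1) w2 l *: epoly l.
  rewrite wm2E big_ord_recr /= /w2; case: (k) => [|k'] /=.
    by rewrite big_ord0 scale0r addr0.
  by rewrite /wpoly_coord ltnn scale0r addr0.
rewrite [LHS]addrC -!addrA addrC -!addrA [lead_coord k *: _ + _]addrC !addrA.
congr (_ + _); rewrite /wpoly !scaler_sumr -sumrN -!big_split /=.
apply: eq_bigr => l _.
rewrite !scalerA -scaleNr -!scalerDl; congr (_ *: _).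
case: l => l /=; rewrite ltnS => lk.
have [s kE] : exists s, k = (l + s)%N by exists (k - l)%N; rewrite subnKC.
have y0 := nat1r_neq0 s.
have gE : g l = 4%:R * (l%:R - N%:R) * lead_coord l
                * (l%:R * (nu + l%:R) / (1 + s%:R) * binom_coef l s) * (a * a ^+ s).
  rewrite /g kE -addnS addKn exprS; congr (_ * _).
  case: (l) => [|l']; first by rewrite !(mulr0, mul0r).
  have /(canRL (mulKf _)) -> := binom_coef_shift l' s; last by rewrite pnatr_eq0.
  by rewrite /=; field.
have wE : wpoly_coord k l = lead_coord l * binom_coef l s * a ^+ s by rewrite /wpoly_coord lk kE addKn.
have wSE : wpoly_coord k.+1 l
           = lead_coord l * ((nu + 1 + l%:R + s%:R) / (1 + s%:R) * binom_coef l s) * (a * a ^+ s).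
  rewrite /wpoly_coord (leqW lk) kE -addnS addKn exprS.
  have /(canRL (mulKf _)) -> := binom_coefS l s; last by rewrite pnatr_eq0.
  by field.
have w2E : (nu + l%:R + s%:R) * (a * w2 l) = s%:R * wpoly_coord k l.
  rewrite wE /w2 kE; case: s {kE y0 gE wE wSE} => [|s].
    rewrite addn0 mul0r; case: (l) => [|l'] /=; first by rewrite !mulr0.
    by rewrite /wpoly_coord ltnn !mulr0.
  rewrite addnS /= /wpoly_coord leq_addr addKn exprS.
  transitivity (lead_coord l * (s.+1%:R * binom_coef l s.+1) * (a * a ^+ s)); last by ring.
  by rewrite binom_coefS; ring.
transitivity (g l + (4%:R * a * l.+1%:R ^+ 2
   + a * (2%:R * nu + 2%:R * k.+1%:R - 2%:R) * (2%:R * (k.+1%:R - 1 - N%:R))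
   + 2%:R * k.+1%:R * a * (2%:R * nu + 2%:R * k.+1%:R - 2%:R * N%:R - 2%:R)) * wpoly_coord k l
   - 2%:R * a * (2%:R * nu + 2%:R * k.+1%:R - 2%:R * N%:R - 4%:R)
     * ((nu + l%:R + s%:R) * (a * w2 l))).
  by rewrite kE; ring.
by rewrite w2E gE wE wSE kE; field.
Qed.

Lemma obstruction_poly (p : nat -> {poly F}) :
  p 0%N = 1 ->
  (forall j, (0 < j <= 2 * N)%N ->
     indicial j *: p j = 'X * p j.-1
       + (if (1 < j)%N then (a * (2%:R * nu + indicial j - 2%:R)) *: p j.-2 else 0)) ->
  exists2 c : F, c != 0 &
    'X * p (2 * N)%N
    + (if (0 < N)%N then (a * (2%:R * nu - 2%:R)) *: p (2 * N).-1 else 0)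
    = c *: ('X * epoly N).
Proof.
move=> p0 prec; case: (posnP N) => [N0|N_gt0].
  by exists 1; rewrite ?oner_eq0 // N0 p0 addr0 scale1r /epoly big_geq.
have indicial_even k : indicial (2 * k) = 2%:R * k%:R by rewrite /indicial mul2n odd_double -mul2n natrM.
have indicial_odd k : indicial (2 * k).+1 = 2%:R * (k%:R - N%:R).
  by rewrite /indicial mul2n /= odd_double /= -!mul2n addn1 -!natr1 !natrM; ring.
pose wm1 k := if (0 < k)%N then wpoly k.-1 else 0.
pose E k := (2%:R * (k%:R - N%:R)) *: wpoly k
      - (a * (2%:R * nu + 2%:R * k%:R - 2%:R * N%:R - 2%:R)) *: wm1 k.
have even_step k : (0 < k <= N)%N -> p (2 * k.-1)%N = E k.-1 ->
    p (2 * k.-1).+1 = 'X * wpoly k.-1 ->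
    (2%:R * k%:R) *: (p (2 * k)%N
      + (a * (2%:R * nu + 2%:R * k%:R - 2%:R * N%:R - 2%:R)) *: wpoly k.-1)
    = (4%:R * k%:R * (k%:R - N%:R)) *: (\sum_(l < k) wpoly_coord k l *: epoly l)
      + lead_coord k.-1 *: epoly k.
  move=> kN pe po; rewrite -(@wpoly_rec k (wm1 k.-1) kN); last first.
    by rewrite /wm1; case: (k) => [|[|k']].
  have := prec (2 * k)%N; rewrite indicial_even muln_gt0 leq_pmul2l //= kN => /(_ isT).
  case: k kN pe po => // k kN; rewrite [k.+1.-1]/= => pe po.
  rewrite scalerDr (mulnS 2 k : _ = (2 * k).+2) /= po pe /E => ->; rewrite scalerDr !scalerN !scalerA.
  by rewrite -(natr1 k) -!mul_polyC; ring.
have odd_step k : (k < N)%N -> p (2 * k)%N = E k ->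
    ((0 < k)%N -> p (2 * k.-1).+1 = 'X * wpoly k.-1) ->
    p (2 * k).+1 = 'X * wpoly k.
  move=> kN pe po.
  have kN0 : 2%:R * (k%:R - N%:R) != 0 :> F.
    by rewrite mulf_neq0 ?pnatr_eq0 // subr_eq0 eqr_nat neq_ltn kN.
  apply: (scalerI kN0); rewrite -indicial_odd prec; last first.
    by rewrite /= (leq_trans _ (leq_mul (leqnn 2) kN)) // mulnS.
  rewrite indicial_odd /= pe /E /wm1; case: (posnP k) => [k0|k_gt0].
    by rewrite k0 /= scaler0 subr0 addr0 -scalerAr.
  rewrite ltnS muln_gt0 /= k_gt0.
  case: k kN pe po kN0 k_gt0 => // k kN pe po kN0 _.
  rewrite (mulnS 2 k : _ = (2 * k).+2) /= po // -!mul_polyC; ring.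
have rec k : (k < N)%N -> p (2 * k)%N = E k /\ p (2 * k).+1 = 'X * wpoly k.
  elim: k => [|k IH] kN.
    have pE : p (2 * 0)%N = E 0%N.
      rewrite muln0 p0 /E /wm1 /= scaler0 subr0 /wpoly big_ord_recl big_ord0 addr0.
      rewrite /wpoly_coord /= /epoly big_geq // scalerA /lead_coord /binom_coef !big_ord0.
      have N0 : N%:R != 0 :> F by rewrite pnatr_eq0 -lt0n.
      rewrite [X in X *: _](_ : _ = 1) ?scale1r // natrM expr0.
      by field.
    by split => //; apply: odd_step.
  have [pe po] := IH (ltnW kN).
  have pE : p (2 * k.+1)%N = E k.+1.
    have k0 : 2%:R * k.+1%:R != 0 :> F by rewrite mulf_neq0 ?pnatr_eq0.
    apply: (scalerI k0); have := @even_step k.+1 (ltnW kN) pe po.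
    rewrite scalerDr => /(canRL (addrK _)) ->.
    rewrite /E /wm1 scalerBr; congr (_ - _).
    rewrite scalerA /wpoly [in RHS]big_ord_recr /= scalerDr; congr (_ + _).
      by congr (_ *: _); ring.
    rewrite !scalerA; congr (_ *: _).
    rewrite /wpoly_coord leqnn subnn expr0 /binom_coef big_ord0 (@lead_coordS k) //; ring.
  by split => //; apply: odd_step.
have [pe po] : p (2 * N.-1)%N = E N.-1 /\ p (2 * N.-1).+1 = 'X * wpoly N.-1.
  by apply: rec; rewrite prednK.
have N0 : N%:R != 0 :> F by rewrite pnatr_eq0 -lt0n.
have N2 : 2%:R * N%:R != 0 :> F by rewrite mulf_neq0 // pnatr_eq0.
exists (lead_coord N.-1 / (2%:R * N%:R)).
  by apply: mulf_neq0; rewrite ?invr_eq0 //; apply: lead_coord_neq0; rewrite prednK.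
have := @even_step N; rewrite N_gt0 leqnn => /(_ isT pe po).
rewrite subrr mulr0 scale0r add0r => /(canRL (scalerK N2)) pE.
have -> : (2 * N).-1 = (2 * N.-1).+1 by rewrite -[in LHS](prednK N_gt0) mulnS.
rewrite po -!mul_polyC; move: pE; rewrite -!mul_polyC => /(canRL (addrK _)) ->.
by rewrite addrK (polyCM (lead_coord _)); ring.
Qed.

End ObstructionPolynomial.

(** * Smooth functions and first-order operators on open subsets of R^n *)

Lemma near_eq_differentiable (R : numFieldType) (V W : normedModType R)
    (f g : V -> W) (x : V) :
  {near x, f =1 g} -> differentiable f x -> differentiable g x.
Proof.
move=> fg dfx; have dfc := diff_continuous dfx.
suff dg : g \o shift x = cst (g x) + 'd f x +o_ 0 id.
  by apply/diff_locallyP; rewrite (diff_unique dfc dg).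
apply/eqaddoP => _/posnumP[e].
have /eqaddoP/(_ e%:num)/(_ [gt0 of e%:num]) := diff_locally dfx.
have fg0 : \forall h \near 0, f (h + x) = g (h + x).
  have := fg; rewrite {1}(near_shift 0 x) /=.
  by apply: filterS => h /=; rewrite subr0.
apply: filter_app; near=> h.
rewrite /= !fctE /= /cst (nbhs_singleton fg).
by have -> : f (h + x) = g (h + x) by near: h; exact: fg0.
Unshelve. all: by end_near. Qed.

Section Ck.
Variables (R : realType) (m : nat).
Implicit Types (U : set 'rV[R]_m) (f g : 'rV[R]_m -> R).

Lemma open_near_eq T U (f g : 'rV[R]_m -> T) y : open U -> U y ->
  (forall z, U z -> f z = g z) -> {near y, f =1 g}.
Proof.
move=> oU Uy fg; have : nbhs y U by exact: open_nbhs_nbhs.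
by apply: filterS.
Qed.

Lemma Ck_on_ext k U f g : open U -> (forall y, U y -> f y = g y) ->
  Ck_on k U f -> Ck_on k U g.
Proof.
move=> oU; elim: k f g => [|k IH] f g fg /=.
  move=> cf y Uy; have : f @ y --> f y := cf y Uy.
  rewrite (fg y Uy) => fy; change (g @ y --> g y); apply: cvg_trans fy.
  exact: (@near_eq_cvg _ _ (nbhs y) _ _ _ (open_near_eq oU Uy fg)).
move=> [df cf]; split=> [y Uy|i].
  exact: near_eq_differentiable (open_near_eq oU Uy fg) (df y Uy).
apply: IH (cf i) => y Uy.
by apply: near_eq_derive; exact: (open_near_eq oU Uy fg).
Qed.

Lemma Ck_onW k U f : Ck_on k.+1 U f -> Ck_on k U f.
Proof.
elim: k f => [|k IH] f [df cf] /=; first by move=> y Uy; exact/differentiable_continuous/df.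
by split=> // i; apply: IH; exact: cf.
Qed.

Lemma Ck_on_cst k U (c : R) : Ck_on k U (fun=> c).
Proof.
elim: k c => [|k IH] c /=; first by move=> y _; exact: cst_continuous.
split=> [y _|i]; first exact: differentiable_cst.
suff -> : (fun y : 'rV[R]_m => 'D_(delta_mx 0 i) (fun=> c : R) y) = (fun=> 0) by exact: IH.
by apply/funext => y; rewrite derive_cst.
Qed.

Lemma Ck_onD k U f g : open U ->
  Ck_on k U f -> Ck_on k U g -> Ck_on k U (fun y => f y + g y).
Proof.
move=> oU; elim: k f g => [|k IH] f g /=.
  by move=> cf cg y Uy; apply: continuousD; [exact: cf | exact: cg].
move=> [df cf] [dg cg]; split=> [y Uy|i].
  exact: differentiableD (df y Uy) (dg y Uy).
apply: Ck_on_ext (IH _ _ (cf i) (cg i)) => // y Uy.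
by rewrite deriveD //; apply: diff_derivable; [exact: df | exact: dg].
Qed.

Lemma Ck_onM k U f g : open U ->
  Ck_on k U f -> Ck_on k U g -> Ck_on k U (fun y => f y * g y).
Proof.
move=> oU; elim: k f g => [|k IH] f g.
  by move=> cf cg y Uy; apply: continuousM; [exact: cf | exact: cg].
move=> Cf Cg; have [df cf] := Cf; have [dg cg] := Cg; split=> [y Uy|i].
  exact: differentiableM (df y Uy) (dg y Uy).
apply: Ck_on_ext (Ck_onD oU (IH _ _ (Ck_onW Cf) (cg i)) (IH _ _ (Ck_onW Cg) (cf i))) => // y Uy.
by rewrite deriveM //; apply: diff_derivable; [exact: df | exact: dg].
Qed.

End Ck.

Lemma derive_coord (R : realType) n (y v : 'rV[R]_n) i :
  'D_v (fun z : 'rV[R]_n => z 0 i) y = v 0 i.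
Proof.
have := @derive_mx R 'rV[R]_n 1 n id y v (@derivable_id _ _ _ _).
by rewrite derive_id => /matrixP/(_ 0 i) ->; rewrite mxE.
Qed.

Section Smooth.
Variables (R : realType) (m : nat) (U : set 'rV[R]_m).
Hypothesis oU : open U.
Implicit Types (f g : 'rV[R]_m -> R).

Lemma smooth_on_differentiable f y : smooth_on U f -> U y -> differentiable f y.
Proof. by move=> /(_ 1%N)[df _]; exact: df. Qed.

Lemma smooth_on_ext f g : (forall y, U y -> f y = g y) ->
  smooth_on U f -> smooth_on U g.
Proof. by move=> fg sf k; apply: Ck_on_ext (sf k). Qed.

Lemma smooth_on_cst (c : R) : smooth_on U (fun=> c).
Proof. by move=> k; exact: Ck_on_cst. Qed.

Lemma smooth_onD f g :
  smooth_on U f -> smooth_on U g -> smooth_on U (fun y => f y + g y).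
Proof. by move=> sf sg k; exact: Ck_onD. Qed.

Lemma smooth_onM f g :
  smooth_on U f -> smooth_on U g -> smooth_on U (fun y => f y * g y).
Proof. by move=> sf sg k; exact: Ck_onM. Qed.

Lemma smooth_onN f : smooth_on U f -> smooth_on U (fun y => - f y).
Proof.
move=> sf; apply: smooth_on_ext (smooth_onM (smooth_on_cst (-1)) sf) => y _.
by rewrite mulN1r.
Qed.

Lemma smooth_onB f g :
  smooth_on U f -> smooth_on U g -> smooth_on U (fun y => f y - g y).
Proof. by move=> sf sg; apply: smooth_onD => //; exact: smooth_onN. Qed.

Lemma smooth_on_sum (I : Type) (r : seq I) (P : pred I) (F : I -> 'rV[R]_m -> R) :
  (forall i, P i -> smooth_on U (F i)) -> smooth_on U (fun y => \sum_(i <- r | P i) F i y).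
Proof.
move=> sF; elim: r => [|i r IH].
  by apply: smooth_on_ext (smooth_on_cst 0) => y _; rewrite big_nil.
case Pi : (P i); last first.
  by apply: smooth_on_ext IH => y _; rewrite big_cons Pi.
by apply: smooth_on_ext (smooth_onD (sF i Pi) IH) => y _; rewrite big_cons Pi.
Qed.

Lemma smooth_onX f n : smooth_on U f -> smooth_on U (fun y => f y ^+ n).
Proof.
move=> sf; elim: n => [|n IH]; first exact: smooth_on_cst.
by apply: smooth_on_ext (smooth_onM sf IH) => y _; rewrite exprS.
Qed.

Lemma smooth_on_partial f i :
  smooth_on U f -> smooth_on U (fun y => 'D_(delta_mx 0 i) f y).
Proof. by move=> sf k; have [_] := sf k.+1; exact. Qed.

Lemma smooth_on_coord (i : 'I_m) : smooth_on U (fun y => y 0 i).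
Proof.
case=> [|k] /=; first by move=> y _; exact/differentiable_continuous/differentiable_coord.
split=> [y _|j]; first exact: differentiable_coord.
by apply: Ck_on_ext (Ck_on_cst k U ((delta_mx 0 j : 'rV[R]_m) 0 i)) => // y _; rewrite derive_coord.
Qed.

(* [e k] is the k-th derivative of the outer function [e 0]. *)
Lemma smooth_on_comp1 (e : nat -> R -> R) f :
  (forall k x, is_derive x (1 : R) (e k) (e k.+1 x)) ->
  smooth_on U f -> smooth_on U (fun y => e 0%N (f y)).
Proof.
move=> de sf.
have dek k x : differentiable (e k) x by apply/derivable1_diffP; case: (de k x).
suff H k l : Ck_on k U (fun y => e l (f y)) by move=> k; exact: H.
elim: k l => [|k IH] l.
  move=> y Uy; have := @differentiable_comp _ _ _ _ f (e l) y.
  by move=> /(_ (smooth_on_differentiable sf Uy) (dek l _)) /differentiable_continuous.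
split=> [y Uy|i].
  exact: (differentiable_comp (smooth_on_differentiable sf Uy) (dek l _)).
apply: Ck_on_ext (Ck_onM oU (IH l.+1) (smooth_on_partial i sf k)) => // y Uy.
rewrite [RHS]deriveE; last first.
  exact: (differentiable_comp (smooth_on_differentiable sf Uy) (dek l _)).
rewrite (diff_comp (smooth_on_differentiable sf Uy) (dek l _)) /=.
rewrite deriveE; last exact: smooth_on_differentiable.
have /derivable1_diffP dl := dek l (f y).
rewrite (deriv1E dl) derive1E; have [_ ->] := de l (f y).
by rewrite mulrC.
Qed.

End Smooth.

Section ComplexCalculus.
Variables (R : realType) (m : nat).
Implicit Types (U : set 'rV[R]_m) (f g : 'rV[R]_m -> R[i]) (y v : 'rV[R]_m).

Definition cderive f y v : R[i] :=
  Complex ('D_v (fun z => complex.Re (f z)) y) ('D_v (fun z => complex.Im (f z)) y).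

Definition cdifferentiable f y : Prop :=
  differentiable (fun z => complex.Re (f z)) y /\
  differentiable (fun z => complex.Im (f z)) y.

Lemma Re_M (a b : R[i]) : complex.Re (a * b) =
  complex.Re a * complex.Re b - complex.Im a * complex.Im b.
Proof. by case: a b => [? ?] []. Qed.

Lemma Im_M (a b : R[i]) : complex.Im (a * b) =
  complex.Re a * complex.Im b + complex.Im a * complex.Re b.
Proof. by case: a b => [? ?] []. Qed.

Lemma Re_D (a b : R[i]) : complex.Re (a + b) = complex.Re a + complex.Re b.
Proof. by case: a b => [? ?] []. Qed.

Lemma Im_D (a b : R[i]) : complex.Im (a + b) = complex.Im a + complex.Im b.
Proof. by case: a b => [? ?] []. Qed.

Lemma Re_sum (I : Type) (r : seq I) (F : I -> R[i]) :
  complex.Re (\sum_(i <- r) F i) = \sum_(i <- r) complex.Re (F i).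
Proof. exact: (big_morph _ Re_D (erefl _)). Qed.

Lemma Im_sum (I : Type) (r : seq I) (F : I -> R[i]) :
  complex.Im (\sum_(i <- r) F i) = \sum_(i <- r) complex.Im (F i).
Proof. exact: (big_morph _ Im_D (erefl _)). Qed.

Lemma complex_eq (a b : R[i]) : complex.Re a = complex.Re b ->
  complex.Im a = complex.Im b -> a = b.
Proof. by case: a b => [? ?] [? ?] /= -> ->. Qed.

Lemma cdifferentiable_cst c y : cdifferentiable (fun=> c) y.
Proof. by split; exact: differentiable_cst. Qed.

Lemma cderive_cst c y v : cderive (fun=> c) y v = 0.
Proof. by rewrite /cderive !derive_cst. Qed.

Lemma cdifferentiableD f g y : cdifferentiable f y -> cdifferentiable g y ->
  cdifferentiable (fun z => f z + g z) y.
Proof.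
move=> [f1 f2] [g1 g2]; rewrite /cdifferentiable.
under eq_fun do rewrite Re_D; under [X in _ /\ differentiable X _]eq_fun do rewrite Im_D.
by split; exact: differentiableD.
Qed.

Lemma cderiveD f g y v : cdifferentiable f y -> cdifferentiable g y ->
  cderive (fun z => f z + g z) y v = cderive f y v + cderive g y v.
Proof.
move=> [f1 f2] [g1 g2]; rewrite /cderive.
under eq_fun do rewrite Re_D; under [X in Complex _ (derive X _ _)]eq_fun do rewrite Im_D.
by apply: complex_eq => /=; rewrite deriveD //; exact: diff_derivable.
Qed.

Lemma cdifferentiableM f g y : cdifferentiable f y -> cdifferentiable g y ->
  cdifferentiable (fun z => f z * g z) y.
Proof.
move=> [f1 f2] [g1 g2]; rewrite /cdifferentiable.
under eq_fun do rewrite Re_M; under [X in _ /\ differentiable X _]eq_fun do rewrite Im_M.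
by split; [apply: differentiableB | apply: differentiableD]; exact: differentiableM.
Qed.

Lemma cderiveM f g y v : cdifferentiable f y -> cdifferentiable g y ->
  cderive (fun z => f z * g z) y v = cderive f y v * g y + f y * cderive g y v.
Proof.
move=> [f1 f2] [g1 g2]; rewrite /cderive.
under eq_fun do rewrite Re_M; under [X in Complex _ (derive X _ _)]eq_fun do rewrite Im_M.
have dg2 := @diff_derivable _ _ _ _ y v g2.
have dg1 := @diff_derivable _ _ _ _ y v g1.
have df2 := @diff_derivable _ _ _ _ y v f2.
have df1 := @diff_derivable _ _ _ _ y v f1.
apply: complex_eq.
  rewrite Re_D !Re_M.
  rewrite [LHS](deriveB (derivableM df1 dg1) (derivableM df2 dg2)).
  rewrite (deriveM df1 dg1) (deriveM df2 dg2) /=.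
  rewrite /GRing.scale /=; move: ('D_v _ y) ('D_v _ y) ('D_v _ y) ('D_v _ y) => a b c d.
  ring.
rewrite Im_D !Im_M.
rewrite [LHS](deriveD (derivableM df1 dg2) (derivableM df2 dg1)).
rewrite (deriveM df1 dg2) (deriveM df2 dg1) /=.
by rewrite /GRing.scale /=; move: ('D_v _ y) ('D_v _ y) ('D_v _ y) ('D_v _ y) => a b c d; ring.
Qed.

Lemma cdifferentiable_sum (I : Type) (r : seq I) (F : I -> 'rV[R]_m -> R[i]) y :
  (forall i, cdifferentiable (F i) y) ->
  cdifferentiable (fun z => \sum_(i <- r) F i z) y.
Proof.
move=> dF; elim: r => [|i r IH].
  by under eq_fun do rewrite big_nil; exact: cdifferentiable_cst.
by under eq_fun do rewrite big_cons; exact: cdifferentiableD.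
Qed.

Lemma cderive_sum (I : Type) (r : seq I) (F : I -> 'rV[R]_m -> R[i]) y v :
  (forall i, cdifferentiable (F i) y) ->
  cderive (fun z => \sum_(i <- r) F i z) y v = \sum_(i <- r) cderive (F i) y v.
Proof.
move=> dF; elim: r => [|i r IH].
  by under eq_fun do rewrite big_nil; rewrite big_nil cderive_cst.
under eq_fun do rewrite big_cons.
by rewrite cderiveD ?big_cons ?IH //; exact: cdifferentiable_sum.
Qed.

Lemma near_eq_cderive f g y v : {near y, f =1 g} -> cderive f y v = cderive g y v.
Proof.
by move=> fg; rewrite /cderive; congr Complex; apply: near_eq_derive;
  apply: filterS fg => z ->.
Qed.

Lemma near_eq_cdifferentiable f g y :
  {near y, f =1 g} -> cdifferentiable f y -> cdifferentiable g y.
Proof.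
by move=> fg [f1 f2]; split; [apply: near_eq_differentiable f1 | apply: near_eq_differentiable f2];
  apply: filterS fg => z ->.
Qed.

Section CSmooth.
Variable U : set 'rV[R]_m.
Hypothesis oU : open U.

Lemma csmooth_on_cdifferentiable f y : csmooth_on U f -> U y -> cdifferentiable f y.
Proof. by move=> [f1 f2] Uy; split; exact: smooth_on_differentiable Uy. Qed.

Lemma csmooth_on_ext f g : (forall y, U y -> f y = g y) ->
  csmooth_on U f -> csmooth_on U g.
Proof.
by move=> fg [f1 f2]; split; [apply: smooth_on_ext f1 | apply: smooth_on_ext f2] => // y Uy; rewrite fg.
Qed.

Lemma csmooth_on_cst c : csmooth_on U (fun=> c).
Proof. by split; exact: smooth_on_cst. Qed.

Lemma csmooth_on_toC (f : 'rV[R]_m -> R) : smooth_on U f -> csmooth_on U (fun y => toC (f y)).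
Proof. by move=> sf; split => //; exact: smooth_on_cst. Qed.

Lemma csmooth_onD f g : csmooth_on U f -> csmooth_on U g ->
  csmooth_on U (fun y => f y + g y).
Proof.
move=> [f1 f2] [g1 g2]; split.
  by apply: smooth_on_ext (smooth_onD oU f1 g1) => // y _; rewrite Re_D.
by apply: smooth_on_ext (smooth_onD oU f2 g2) => // y _; rewrite Im_D.
Qed.

Lemma csmooth_onM f g : csmooth_on U f -> csmooth_on U g ->
  csmooth_on U (fun y => f y * g y).
Proof.
move=> [f1 f2] [g1 g2]; split.
  by apply: smooth_on_ext (smooth_onB oU (smooth_onM oU f1 g1) (smooth_onM oU f2 g2)) => // y _; rewrite Re_M.
by apply: smooth_on_ext (smooth_onD oU (smooth_onM oU f1 g2) (smooth_onM oU f2 g1)) => // y _; rewrite Im_M.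
Qed.

Lemma csmooth_on_sum (I : Type) (r : seq I) (P : pred I) (F : I -> 'rV[R]_m -> R[i]) :
  (forall i, P i -> csmooth_on U (F i)) -> csmooth_on U (fun y => \sum_(i <- r | P i) F i y).
Proof.
move=> sF; elim: r => [|i r IH].
  by apply: csmooth_on_ext (csmooth_on_cst 0) => y _; rewrite big_nil.
case Pi : (P i); last first.
  by apply: csmooth_on_ext IH => y _; rewrite big_cons Pi.
by apply: csmooth_on_ext (csmooth_onD (sF i Pi) IH) => y _; rewrite big_cons Pi.
Qed.

Lemma csmooth_on_partial f i :
  csmooth_on U f -> csmooth_on U (fun y => cderive f y (delta_mx 0 i)).
Proof. by move=> [f1 f2]; split; exact: smooth_on_partial. Qed.

End CSmooth.

End ComplexCalculus.

Section VectorCalculus.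
Variables (R : realType) (m d : nat).
Implicit Types (f g : 'rV[R]_m -> 'cV[R[i]]_d) (y v : 'rV[R]_m).

Definition vdifferentiable d' (f : 'rV[R]_m -> 'cV[R[i]]_d') y :=
  forall i, cdifferentiable (fun z => f z i 0) y.

Lemma vderiveE f y v i : vderive f y v i 0 = cderive (fun z => f z i 0) y v.
Proof. by rewrite mxE. Qed.

Lemma vderiveD f g y v : vdifferentiable f y -> vdifferentiable g y ->
  vderive (fun z => f z + g z) y v = vderive f y v + vderive g y v.
Proof.
move=> df dg; apply/colP => i; rewrite [RHS]mxE !vderiveE.
under eq_fun do rewrite mxE.
by rewrite cderiveD.
Qed.

Lemma vdifferentiableD f g y : vdifferentiable f y -> vdifferentiable g y ->
  vdifferentiable (fun z => f z + g z) y.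
Proof.
move=> df dg i; under eq_fun do rewrite mxE.
exact: cdifferentiableD.
Qed.

Lemma vdifferentiableZ (c : 'rV[R]_m -> R[i]) f y :
  cdifferentiable c y -> vdifferentiable f y ->
  vdifferentiable (fun z => c z *: f z) y.
Proof.
move=> dc df i; under eq_fun do rewrite mxE.
exact: cdifferentiableM.
Qed.

Lemma vderiveZ (c : 'rV[R]_m -> R[i]) f y v :
  cdifferentiable c y -> vdifferentiable f y ->
  vderive (fun z => c z *: f z) y v = cderive c y v *: f y + c y *: vderive f y v.
Proof.
move=> dc df; apply/colP => i; rewrite [RHS]mxE [in X in _ = X + _]mxE [in X in _ = _ + X]mxE !vderiveE.
under eq_fun do rewrite mxE.
by rewrite cderiveM.
Qed.

Lemma vdifferentiable0 y : vdifferentiable (fun=> 0 : 'cV[R[i]]_d) y.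
Proof. by move=> i; under eq_fun do rewrite mxE; exact: cdifferentiable_cst. Qed.

Lemma vderive0 y v : vderive (fun=> 0 : 'cV[R[i]]_d) y v = 0.
Proof.
apply/colP => i; rewrite vderiveE [RHS]mxE.
by under eq_fun do rewrite mxE; rewrite cderive_cst.
Qed.

Lemma vdifferentiable_sum (I : Type) (r : seq I) (F : I -> 'rV[R]_m -> 'cV[R[i]]_d) y :
  (forall i, vdifferentiable (F i) y) ->
  vdifferentiable (fun z => \sum_(i <- r) F i z) y.
Proof.
move=> dF; elim: r => [|i r IH].
  by under eq_fun do rewrite big_nil; exact: vdifferentiable0.
by under eq_fun do rewrite big_cons; exact: vdifferentiableD.
Qed.

Lemma near_eq_vderive f g y v : {near y, f =1 g} -> vderive f y v = vderive g y v.
Proof.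
move=> fg; apply/colP => i; rewrite !vderiveE; apply: near_eq_cderive.
by apply: filterS fg => z ->.
Qed.

Lemma near_eq_vdifferentiable f g y :
  {near y, f =1 g} -> vdifferentiable f y -> vdifferentiable g y.
Proof.
move=> fg df i; apply: near_eq_cdifferentiable (df i).
by apply: filterS fg => z ->.
Qed.

Lemma derive_sum_partial (f : 'rV[R]_m -> R) y v : differentiable f y ->
  'D_v f y = \sum_k v 0 k * 'D_(delta_mx 0 k) f y.
Proof.
move=> df; rewrite deriveE // {1}(row_sum_delta v) linear_sum /=.
by apply: eq_bigr => k _; rewrite linearZ deriveE.
Qed.

Lemma vderive_sum_partial f y v : vdifferentiable f y ->
  vderive f y v = \sum_k toC (v 0 k) *: vderive f y (delta_mx 0 k).
Proof.
move=> df; apply/colP => i; rewrite summxE vderiveE.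
transitivity (\sum_k toC (v 0 k) * cderive (fun z => f z i 0) y (delta_mx 0 k));
  last by apply: eq_bigr => k _; rewrite [RHS]mxE vderiveE.
have [d1 d2] := df i.
rewrite /cderive derive_sum_partial // [X in Complex _ X]derive_sum_partial //.
apply: complex_eq => /=.
  by rewrite Re_sum; apply: eq_bigr => k _; rewrite Re_M /= mul0r subr0.
by rewrite Im_sum; apply: eq_bigr => k _; rewrite [RHS]Im_M /= mul0r addr0.
Qed.

Lemma vsmooth_on_vdifferentiable U f y :
  vsmooth_on U f -> U y -> vdifferentiable f y.
Proof. by move=> sf Uy i; exact: csmooth_on_cdifferentiable (sf i) Uy. Qed.

End VectorCalculus.

Lemma vderive_mulmx (R : realType) m d d' (A : 'M[R[i]]_(d', d))
    (f : 'rV[R]_m -> 'cV[R[i]]_d) y v :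
  vdifferentiable f y -> vderive (fun z => A *m f z) y v = A *m vderive f y v.
Proof.
move=> df; apply/colP => i; rewrite [RHS]mxE vderiveE.
under eq_fun do rewrite mxE.
have dA j : cdifferentiable (fun=> A i j) y by exact: cdifferentiable_cst.
rewrite cderive_sum => [|j]; last exact: cdifferentiableM.
by apply: eq_bigr => j _; rewrite cderiveM // cderive_cst mul0r add0r vderiveE.
Qed.

Section FirstOrderOperator.
Variables (R : realType) (m d : nat).
Variables (P : 'I_m -> 'rV[R]_m -> 'M[R[i]]_d) (Q : 'rV[R]_m -> 'M[R[i]]_d).
Variable U : set 'rV[R]_m.
Hypothesis oU : open U.
Implicit Types (f g : 'rV[R]_m -> 'cV[R[i]]_d) (y v : 'rV[R]_m).

Definition first_order f y : 'cV[R[i]]_d :=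
  \sum_k P k y *m vderive f y (delta_mx 0 k) + Q y *m f y.

Definition msmooth_on p q (F : 'rV[R]_m -> 'M[R[i]]_(p, q)) :=
  forall i j, csmooth_on U (fun y => F y i j).

Lemma first_order_smooth f : (forall k, msmooth_on (P k)) -> msmooth_on Q ->
  vsmooth_on U f -> vsmooth_on U (first_order f).
Proof.
move=> sP sQ sf i.
apply: (@csmooth_on_ext _ _ _ oU (fun y => \sum_k \sum_l P k y i l *
    cderive (fun z => f z l 0) y (delta_mx 0 k) + \sum_l Q y i l * f y l 0)).
  move=> y _; rewrite /first_order [RHS]mxE summxE [X in _ = _ + X]mxE; congr (_ + _).
  apply: eq_bigr => k _; rewrite [RHS]mxE; apply: eq_bigr => l _.
  by rewrite vderiveE.
apply: csmooth_onD => //; apply: csmooth_on_sum => // k _.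
  apply: csmooth_on_sum => // l _; apply: csmooth_onM => //; first exact: sP.
  exact: csmooth_on_partial.
by apply: csmooth_onM => //; exact: sQ.
Qed.

Lemma first_order_ext f g y : {near y, f =1 g} -> first_order f y = first_order g y.
Proof.
move=> fg; rewrite /first_order (nbhs_singleton fg); congr (_ + _).
by apply: eq_bigr => k _; rewrite (near_eq_vderive _ fg).
Qed.

Lemma first_orderD f g y : vdifferentiable f y -> vdifferentiable g y ->
  first_order (fun z => f z + g z) y = first_order f y + first_order g y.
Proof.
move=> df dg; rewrite /first_order mulmxDr addrACA -big_split /=; congr (_ + _).
by apply: eq_bigr => k _; rewrite vderiveD // mulmxDr.
Qed.

Lemma first_orderZ (c : 'rV[R]_m -> R[i]) f y :
  cdifferentiable c y -> vdifferentiable f y ->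
  first_order (fun z => c z *: f z) y
  = (\sum_k cderive c y (delta_mx 0 k) *: P k y) *m f y + c y *: first_order f y.
Proof.
move=> dc df; rewrite /first_order scalerDr addrA -scalemxAr; congr (_ + _).
rewrite mulmx_suml scaler_sumr -big_split /=; apply: eq_bigr => k _.
by rewrite vderiveZ // mulmxDr -!scalemxAr -scalemxAl.
Qed.

Lemma first_orderZl c f y : vdifferentiable f y -> first_order (fun z => c *: f z) y = c *: first_order f y.
Proof.
move=> df; rewrite (first_orderZ (cdifferentiable_cst c y) df).
rewrite big1 ?mul0mx ?add0r // => k _.
by rewrite cderive_cst scale0r.
Qed.

Lemma first_order0 y : first_order (fun=> 0) y = 0.
Proof.
by rewrite /first_order mulmx0 addr0 big1 // => k _; rewrite vderive0 mulmx0.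
Qed.

Lemma first_order_sum (I : Type) (r : seq I) (F : I -> 'rV[R]_m -> 'cV[R[i]]_d) y :
  (forall i, vdifferentiable (F i) y) ->
  first_order (fun z => \sum_(i <- r) F i z) y = \sum_(i <- r) first_order (F i) y.
Proof.
move=> dF; elim: r => [|i r IH].
  by under [X in first_order X]eq_fun do rewrite big_nil; rewrite big_nil first_order0.
under [X in first_order X]eq_fun do rewrite big_cons.
by rewrite first_orderD ?big_cons ?IH //; exact: vdifferentiable_sum.
Qed.

End FirstOrderOperator.

Section ToC.
Variable R : realType.
Lemma toCM (a b : R) : toC (a * b) = toC a * toC b.
Proof. by apply: complex_eq; rewrite ?Re_M ?Im_M /= ?mul0r ?mulr0 ?subr0 ?addr0. Qed.
Lemma toCD (a b : R) : toC (a + b) = toC a + toC b.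
Proof. by apply: complex_eq => /=; rewrite ?addr0. Qed.
Lemma toCN (a : R) : toC (- a) = - toC a.
Proof. by apply: complex_eq => /=; rewrite ?oppr0. Qed.
Lemma toC1 : toC (1 : R) = 1. Proof. by []. Qed.
Lemma toC0 : toC (0 : R) = 0. Proof. by []. Qed.
Lemma toC_eq0 (a : R) : (toC a == 0) = (a == 0).
Proof. by rewrite eq_complex /= eqxx andbT. Qed.
Lemma toC_nat n : toC (n%:R : R) = n%:R.
Proof. by elim: n => [|n IH]; rewrite ?toC0 // -!natr1 toCD IH. Qed.
Lemma toCV (a : R) : toC a^-1 = (toC a)^-1.
Proof.
have [->|a0] := eqVneq a 0; first by rewrite invr0 toC0 invr0.
apply: (mulfI (_ : toC a != 0)); first by rewrite toC_eq0.
by rewrite -toCM !mulfV ?toC_eq0.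
Qed.
End ToC.

(** * The Dirac operator in a chart *)

Section LocalDirac.
Variables (R : realType) (m d : nat).
Implicit Types (g e : 'rV[R]_m -> 'M[R]_m) (eps : 'I_m -> R).
Implicit Types (cl : 'I_m -> 'M[R[i]]_d) (psi : 'rV[R]_m -> 'cV[R[i]]_d).

Definition spin_coef g e eps (i j k : 'I_m) y : R :=
  eps j * eps k * inner g y (nabla g (row i (e y)) (fun z => row j (e z)) y) (row k (e y)).

Definition dirac_symbol e eps cl (k : 'I_m) y : 'M[R[i]]_d :=
  \sum_i toC (eps i * e y i k) *: cl i.

Definition dirac_potential g e eps cl y : 'M[R[i]]_d :=
  \sum_i toC (eps i) *: (cl i *m (toC 2%:R^-1 *:
    \sum_(j < m) \sum_(k < m | (j < k)%N) toC (spin_coef g e eps i j k y) *: (cl j *m cl k))).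

Lemma local_diracE g e eps cl psi y : vdifferentiable psi y ->
  local_dirac g e eps cl psi y
  = first_order (dirac_symbol e eps cl) (dirac_potential g e eps cl) psi y.
Proof.
move=> dpsi; rewrite /local_dirac /first_order /dirac_potential mulmx_suml.
transitivity (\sum_i (toC (eps i) *: (cl i *m vderive psi y (row i (e y)))
   + (toC (eps i) *: (cl i *m (toC 2%:R^-1 *: \sum_(j < m) \sum_(k < m | (j < k)%N)
        toC (spin_coef g e eps i j k y) *: (cl j *m cl k)))) *m psi y)).
  apply: eq_bigr => i _; rewrite /spin_nabla mulmxDr scalerDr; congr (_ + _).
  rewrite -scalemxAl -!mulmxA; congr (_ *: (_ *m _)).
  rewrite -scalemxAl mulmx_suml; congr (_ *: _); apply: eq_bigr => j _.
  rewrite mulmx_suml; apply: eq_bigr => k _.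
  by rewrite -scalemxAl -mulmxA.
rewrite big_split /=; congr (_ + _).
under eq_bigr => i _.
  rewrite vderive_sum_partial // mulmx_sumr scaler_sumr.
  over.
rewrite exchange_big /=; apply: eq_bigr => k _.
rewrite mulmx_suml; apply: eq_bigr => i _.
by rewrite -scalemxAr scalerA -scalemxAl mxE -toCM.
Qed.

Section Smooth.
Variables (g e : 'rV[R]_m -> 'M[R]_m) (eps : 'I_m -> R) (cl : 'I_m -> 'M[R[i]]_d).
Variable U : set 'rV[R]_m.
Hypothesis oU : open U.
Hypothesis sg : forall i j, smooth_on U (fun y => g y i j).
Hypothesis sgV : forall i j, smooth_on U (fun y => invmx (g y) i j).
Hypothesis se : forall i j, smooth_on U (fun y => e y i j).

Lemma smooth_on_christoffel i j k : smooth_on U (fun y => christoffel g y i j k).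
Proof.
apply: smooth_onM => //; first exact: smooth_on_cst.
apply: smooth_on_sum => // l _; apply: smooth_onM => //.
by apply: smooth_onB => //; first apply: smooth_onD => //; exact: smooth_on_partial.
Qed.

Lemma nablaE i j y k : U y ->
  nabla g (row i (e y)) (fun z => row j (e z)) y 0 k
  = \sum_l e y i l * 'D_(delta_mx 0 l) (fun z => e z j k) y
    + \sum_a \sum_b e y i a * e y j b * christoffel g y a b k.
Proof.
move=> Uy; rewrite mxE; congr (_ + _).
  under eq_fun do rewrite mxE.
  rewrite derive_sum_partial; last exact: smooth_on_differentiable Uy.
  by apply: eq_bigr => l _; rewrite mxE.
by apply: eq_bigr => a _; apply: eq_bigr => b _; rewrite !mxE.
Qed.

Lemma smooth_on_spin_coef i j k : smooth_on U (spin_coef g e eps i j k).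
Proof.
apply: smooth_onM => //; first exact: smooth_on_cst.
apply: (@smooth_on_ext _ _ _ oU (fun y => \sum_b (\sum_a
   (\sum_l e y i l * 'D_(delta_mx 0 l) (fun z => e z j a) y
    + \sum_a' \sum_b' e y i a' * e y j b' * christoffel g y a' b' a) * g y a b) * e y k b)).
  move=> y Uy; rewrite /inner mxE; apply: eq_bigr => b _.
  rewrite mxE [in RHS]mxE mxE; congr (_ * _).
  by apply: eq_bigr => a _; rewrite nablaE.
apply: smooth_on_sum => // b _; apply: smooth_onM => //.
apply: smooth_on_sum => // a _; apply: smooth_onM => //.
apply: smooth_onD => //; apply: smooth_on_sum => // a' _.
  by apply: smooth_onM => //; exact: smooth_on_partial.
apply: smooth_on_sum => // b' _; apply: smooth_onM => //.
  exact: smooth_onM.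
exact: smooth_on_christoffel.
Qed.

Lemma msmooth_onZ (c : 'rV[R]_m -> R) p q (A : 'M[R[i]]_(p, q)) :
  smooth_on U c -> msmooth_on U (fun y => toC (c y) *: A).
Proof.
move=> sc i j; under eq_fun do rewrite mxE.
by apply: csmooth_onM => //; [exact: csmooth_on_toC | exact: csmooth_on_cst].
Qed.

Lemma msmooth_on_sum p q (I : Type) (r : seq I) (P : pred I) (F : I -> 'rV[R]_m -> 'M[R[i]]_(p, q)) :
  (forall i, P i -> msmooth_on U (F i)) -> msmooth_on U (fun y => \sum_(i <- r | P i) F i y).
Proof.
move=> sF i j; under eq_fun do rewrite summxE.
by apply: csmooth_on_sum => // k Pk; exact: sF.
Qed.

Lemma msmooth_on_mulmx p q r (A : 'M[R[i]]_(p, q)) (F : 'rV[R]_m -> 'M[R[i]]_(q, r)) :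
  msmooth_on U F -> msmooth_on U (fun y => A *m F y).
Proof.
move=> sF i j; under eq_fun do rewrite mxE.
apply: csmooth_on_sum => // k _; apply: csmooth_onM => //.
exact: csmooth_on_cst.
Qed.

Lemma msmooth_dirac_symbol k : msmooth_on U (dirac_symbol e eps cl k).
Proof.
apply: msmooth_on_sum => i _; apply: msmooth_onZ.
by apply: smooth_onM => //; exact: smooth_on_cst.
Qed.

Lemma msmooth_dirac_potential : msmooth_on U (dirac_potential g e eps cl).
Proof.
apply: msmooth_on_sum => i _ a b; under eq_fun do rewrite mxE.
apply: csmooth_onM => //; first exact: csmooth_on_cst.
apply: (@msmooth_on_mulmx _ _ _ (cl i)) => a' b'; under eq_fun do rewrite mxE.
apply: csmooth_onM => //; first exact: csmooth_on_cst.
apply: msmooth_on_sum => j _; apply: msmooth_on_sum => k _; apply: msmooth_onZ.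
exact: smooth_on_spin_coef.
Qed.

End Smooth.
End LocalDirac.

Section DeriveScale.
Variables (R : realType) (m : nat).
Implicit Types (f : 'rV[R]_m -> R) (y v : 'rV[R]_m).

Lemma derive_scale_fun f (c : R) y v : differentiable f y ->
  'D_v (fun z => c * f z) y = c * 'D_v f y.
Proof. by move=> df; rewrite (deriveMl _ (@diff_derivable _ _ _ _ y v df)). Qed.

Lemma derive_scale_dir f (c : R) y v : differentiable f y ->
  'D_(c *: v) f y = c * 'D_v f y.
Proof. by move=> df; rewrite !deriveE // linearZ. Qed.
End DeriveScale.

Lemma invmxZ_neq0 (F : fieldType) n (c : F) (A : 'M[F]_n) :
  c != 0 -> A \in unitmx -> invmx (c *: A) = c^-1 *: invmx A.
Proof. by move=> c0 uA; rewrite invmxZ // unitmxZ ?unitfE. Qed.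

Section Homothety.
Variables (R : realType) (m d : nat).
Variables (g e : 'rV[R]_m -> 'M[R]_m) (eps : 'I_m -> R) (cl : 'I_m -> 'M[R[i]]_d).
Variables (c : R) (y : 'rV[R]_m).
Hypothesis c0 : c != 0.
Hypothesis ug : g y \in unitmx.
Hypothesis dg : forall i j, differentiable (fun z => g z i j) y.
Hypothesis de : forall i j, differentiable (fun z => e z i j) y.

Lemma christoffel_homothety i j k :
  christoffel (fun z => c ^+ 2 *: g z) y i j k = christoffel g y i j k.
Proof.
rewrite /christoffel; congr (_ * _); apply: eq_bigr => l _.
rewrite invmxZ_neq0 ?expf_neq0 // mxE.
have D v a b : 'D_v (fun z => (c ^+ 2 *: g z) a b) y = c ^+ 2 * 'D_v (fun z => g z a b) y.
  by under eq_fun do rewrite mxE; rewrite derive_scale_fun.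
rewrite !D -mulrDr -mulrBr mulrACA mulVf ?mul1r //.
by rewrite expf_neq0.
Qed.

Lemma spin_coef_homothety i j k :
  spin_coef (fun z => c ^+ 2 *: g z) (fun z => c^-1 *: e z) eps i j k y
  = c^-1 * spin_coef g e eps i j k y.
Proof.
rewrite /spin_coef mulrCA; congr (_ * _).
rewrite [row i (_ *: _)]linearZ [row k (_ *: _)]linearZ /=.
have -> : nabla (fun z => c ^+ 2 *: g z) (c^-1 *: row i (e y))
    (fun z => row j (c^-1 *: e z)) y
  = c^-1 ^+ 2 *: nabla g (row i (e y)) (fun z => row j (e z)) y.
  apply/rowP => l; rewrite [RHS]mxE [LHS]mxE [in RHS]mxE mulrDr; congr (_ + _).
    have -> : (fun z => row j (c^-1 *: e z) 0 l) = (fun z => c^-1 * e z j l).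
      by apply/funext => z; rewrite !mxE.
    have -> : (fun z => row j (e z) 0 l) = (fun z => e z j l).
      by apply/funext => z; rewrite !mxE.
    by rewrite derive_scale_fun // derive_scale_dir // mulrA.
  rewrite mulr_sumr; apply: eq_bigr => a _; rewrite mulr_sumr; apply: eq_bigr => b _.
  by rewrite christoffel_homothety !mxE; ring.
rewrite /inner [(_ *: row k _)^T]linearZ /= -!(scalemxAl, scalemxAr) !scalerA mxE.
by congr (_ * _); field.
Qed.

Lemma local_dirac_homothety psi : vdifferentiable psi y ->
  local_dirac (fun z => c ^+ 2 *: g z) (fun z => c^-1 *: e z) eps cl psi y
  = toC c^-1 *: local_dirac g e eps cl psi y.
Proof.
move=> dpsi; rewrite !local_diracE // /first_order scalerDr; congr (_ + _).
  rewrite scaler_sumr; apply: eq_bigr => k _; rewrite scalemxAl; congr (_ *m _).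
  rewrite scaler_sumr; apply: eq_bigr => i _; rewrite scalerA -toCM mxE.
  by congr (toC _ *: _); ring.
rewrite scalemxAl; congr (_ *m _); rewrite scaler_sumr; apply: eq_bigr => i _.
rewrite scalerA mulrC -scalerA; congr (_ *: _).
rewrite scalemxAr; congr (_ *m _); rewrite scalerA mulrC -scalerA; congr (_ *: _).
rewrite scaler_sumr; apply: eq_bigr => j _.
rewrite scaler_sumr; apply: eq_bigr => k _.
by rewrite scalerA -toCM spin_coef_homothety.
Qed.

End Homothety.

(** * Geometry of the metric dr^2 + phi(r)^2 h *)

Section Cylinder.
Variables (R : realType) (n : nat).
Implicit Types (y : 'rV[R]_n) (r : R).

Lemma yX_ptX y r : yX (ptX y r) = y. Proof. exact: row_mxKl. Qed.
Lemma rX_ptX y r : rX (ptX y r) = r. Proof. by rewrite /rX row_mxKr mxE. Qed.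

Lemma dr_delta : dr R n = delta_mx 0 (rshift n ord0).
Proof.
apply/rowP => i; rewrite !mxE /=; case: split_ordP => j ->; rewrite !mxE.
  by rewrite eq_lrshift.
by rewrite ord1 !eqxx.
Qed.

Lemma dr_quotient (f : 'rV[R]_(n + 1) -> R) y r :
  (fun h : R => h^-1 *: ((f \o shift (ptX y r)) (h *: dr R n) - f (ptX y r)))
  = (fun h : R => h^-1 *: (((fun t => f (ptX y t)) \o shift r) (h *: (1 : R)) - f (ptX y r))).
Proof.
apply/funext => h /=; congr (_ *: (f _ - _)); apply/rowP => i; rewrite !mxE /=.
case: split_ordP => j _; rewrite !mxE; first by rewrite mulr0 add0r.
by rewrite /GRing.scale /=.
Qed.

Lemma derive_dr (f : 'rV[R]_(n + 1) -> R) y r :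
  'D_(dr R n) f (ptX y r) = 'D_1 (fun t => f (ptX y t)) r.
Proof. by rewrite /derive dr_quotient. Qed.

Lemma derivable_dr (f : 'rV[R]_(n + 1) -> R) y r :
  derivable f (ptX y r) (dr R n) -> derivable (fun t => f (ptX y t)) r 1.
Proof. by rewrite /derivable dr_quotient. Qed.

Lemma sum_split_ord (V : nmodType) (F : 'I_(n + 1) -> V) :
  \sum_i F i = \sum_i F (lshift 1 i) + F (rshift n ord0).
Proof. by rewrite big_split_ord /= big_ord1. Qed.

Variable J : R.
Notation phi := (conf_factor n J).
Definition dphi r : R := - (J / n%:R) * r.

Lemma is_derive_conf_factor r : (0 < n)%N -> is_derive r (1 : R) phi (dphi r).
Proof.
move=> n0; rewrite /conf_factor; apply: is_derive_eq.
by rewrite /GRing.scale /= /dphi; field; rewrite pnatr_eq0 -lt0n.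
Qed.
End Cylinder.

Section PoincareEinsteinGeometry.
Variables (R : realType) (n d D : nat) (eps : 'I_n -> R).
Variables (gamma : 'I_n -> 'M[R[i]]_d) (M : spin_manifold eps gamma) (J : R).
Variable Gamma : 'I_(n + 1) -> 'M[R[i]]_D.
Hypothesis n_gt0 : (0 < n)%N.
Hypothesis eps2 : forall i, eps i * eps i = 1.
Variables (a : chart M) (x : M).
Hypothesis ax : dom M a x.
Notation y := (Defs.coord M a x).
Notation phi := (conf_factor n J).
Notation h := (metric M a).
Notation e := (Defs.frame M a).

Lemma frame_metric_inv :
  e y \in unitmx /\ h y \in unitmx /\ invmx (h y) = (e y)^T *m diag_mx (\row_i eps i) *m e y.
Proof.
have ortho := frame_orthonormal ax.
have epsE : diag_mx (\row_i eps i) *m diag_mx (\row_i eps i) = 1%:M.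
  rewrite mulmx_diag; apply/matrixP => i j; rewrite !mxE eps2.
  by [].
have := congr1 (mulmx^~ (diag_mx (\row_i eps i))) ortho.
rewrite epsE -!mulmxA => /mulmx1_unit[ue]; rewrite !mulmxA => _.
have eE : e y *m (h y *m (e y)^T *m diag_mx (\row_i eps i)) = 1%:M.
  by rewrite !mulmxA ortho.
have := mulmx1C eE; rewrite -!mulmxA => hE.
have [uh _] := mulmx1_unit hE.
split=> //; split=> //.
by rewrite -[LHS]mulmx1 -hE mulKmx // mulmxA.
Qed.

Section AtRadius.
Variable r : R.
Hypothesis phi_neq0 : phi r != 0.
Notation pt := (ptX y r).

Lemma metricX_ptX : metricX J a pt = block_mx (phi r ^+ 2 *: h y) 0 0 1%:M.
Proof. by rewrite /metricX rX_ptX yX_ptX. Qed.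

Lemma invmx_metricX :
  invmx (metricX J a pt) = block_mx (phi r ^- 2 *: invmx (h y)) 0 0 1%:M.
Proof.
have [_ [uh _]] := frame_metric_inv.
have uh2 : phi r ^+ 2 *: h y \in unitmx by rewrite unitmxZ // unitfE expf_neq0.
rewrite metricX_ptX invmx_block_diag ?invmx1 ?invmxZ //.
by rewrite unitmxE det_ublock det1 mulr1 -unitmxE.
Qed.

Lemma derive_metricX_row i v :
  'D_v (fun z => metricX J a z (rshift n ord0) i) pt = 0.
Proof.
suff -> : (fun z => metricX J a z (rshift n ord0) i) = cst ((i == rshift n ord0)%:R).
  by rewrite derive_cst.
apply/funext => z; rewrite /metricX; case: (split_ordP i) => j ->.
  by rewrite block_mxEdl mxE eq_lrshift.
by rewrite block_mxEdr mxE eq_rshift eq_sym.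
Qed.

Lemma derive_metricX_col i v :
  'D_v (fun z => metricX J a z i (rshift n ord0)) pt = 0.
Proof.
suff -> : (fun z => metricX J a z i (rshift n ord0)) = cst ((i == rshift n ord0)%:R).
  by rewrite derive_cst.
apply/funext => z; rewrite /metricX; case: (split_ordP i) => j ->.
  by rewrite block_mxEur mxE eq_lrshift.
by rewrite block_mxEdr mxE eq_rshift eq_sym.
Qed.

Lemma derive_metricX i j :
  'D_(dr R n) (fun z => metricX J a z (lshift 1 i) (lshift 1 j)) pt
  = 2%:R * phi r * dphi n J r * h y i j.
Proof.
rewrite derive_dr.
have -> : (fun t => metricX J a (ptX y t) (lshift 1 i) (lshift 1 j)) = (fun t => h y i j * (phi t * phi t)).
  by apply/funext => t; rewrite /metricX rX_ptX yX_ptX block_mxEul !mxE mulrC expr2.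
have dphi := is_derive_conf_factor J r n_gt0.
rewrite (_ : (fun t => _) = (h y i j *: (phi * phi : R -> R))) //.
by rewrite derive_val /GRing.scale /=; ring.
Qed.

Lemma christoffelX_rl l k :
  christoffel (metricX J a) pt (rshift n ord0) (lshift 1 l) k
  = dphi n J r / phi r * (k == lshift 1 l)%:R.
Proof.
have [_ [uh _]] := frame_metric_inv.
rewrite /christoffel -dr_delta sum_split_ord derive_metricX_col derive_metricX_row.
rewrite derive_metricX_row addr0 subr0 mulr0 addr0.
under eq_bigr => m _ do rewrite derive_metricX derive_metricX_row derive_metricX_row addr0 subr0.
rewrite invmx_metricX; case: (split_ordP k) => k' ->; last first.
  rewrite big1 ?mulr0 => [|m _]; last by rewrite block_mxEdl mxE mul0r.
  by rewrite eq_rlshift mulr0.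
rewrite eq_lshift.
transitivity (dphi n J r / phi r * (invmx (h y) *m h y) k' l).
  rewrite mxE !mulr_sumr; apply: eq_bigr => m _; rewrite block_mxEul mxE.
  have -> : h y l m = h y m l by rewrite -[in LHS](Defs.metric_sym ax) mxE.
  by field.
by rewrite mulVmx // mxE.
Qed.

Lemma christoffelX_lr l k :
  christoffel (metricX J a) pt (lshift 1 l) (rshift n ord0) k
  = dphi n J r / phi r * (k == lshift 1 l)%:R.
Proof.
rewrite -christoffelX_rl /christoffel; congr (_ * _); apply: eq_bigr => m _.
congr (_ * _); rewrite -dr_delta !derive_metricX_row !derive_metricX_col.
by rewrite add0r addr0.
Qed.

Lemma nabla_dr_frameX (j : 'I_n) :
  nabla (metricX J a) (dr R n) (fun z => row (lshift 1 j) (frameX J a z)) pt = 0.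
Proof.
apply/rowP => k; rewrite [LHS]mxE [RHS]mxE.
have -> : \sum_i \sum_l dr R n 0 i * row (lshift 1 j) (frameX J a pt) 0 l
      * christoffel (metricX J a) pt i l k
  = \sum_l frameX J a pt (lshift 1 j) (lshift 1 l) * (dphi n J r / phi r * (k == lshift 1 l)%:R).
  rewrite sum_split_ord big1 => [|i _]; last first.
    by rewrite big1 // => l _; rewrite dr_delta !mxE eqxx eq_lrshift !mul0r.
  rewrite add0r sum_split_ord [X in _ + X](_ : _ = 0) ?addr0; last first.
    rewrite [row _ _ _ _]mxE (_ : frameX _ _ _ _ _ = 0) ?mulr0 ?mul0r //.
    by rewrite /frameX block_mxEur mxE.
  apply: eq_bigr => l _; rewrite christoffelX_rl dr_delta [row _ _ _ _]mxE.
  by rewrite mxE !eqxx mul1r.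
rewrite derive_dr; case: (split_ordP k) => k' ->; last first.
  rewrite big1 => [|l _]; last by rewrite eq_rlshift !mulr0.
  have -> : (fun t => row (lshift 1 j) (frameX J a (ptX y t)) 0 (rshift n k')) = cst 0.
    by apply/funext => t; rewrite [row _ _ _ _]mxE /frameX block_mxEur mxE.
  by rewrite derive_cst addr0.
rewrite (bigD1 k') //= big1 => [|l lk]; last first.
  by rewrite eq_lshift eq_sym (negbTE lk) !mulr0.
rewrite eqxx addr0 mulr1.
have -> : (fun t => row (lshift 1 j) (frameX J a (ptX y t)) 0 (lshift 1 k'))
    = (fun t => e y j k' * (phi t)^-1).
  by apply/funext => t; rewrite [row _ _ _ _]mxE /frameX rX_ptX yX_ptX block_mxEul !mxE mulrC.
have [dd dE] := is_derive_conf_factor J r n_gt0.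
rewrite (deriveMl _ (derivableV phi_neq0 dd)) (deriveV phi_neq0 dd) dE.
rewrite /frameX rX_ptX yX_ptX block_mxEul mxE /GRing.scale /=.
by field.
Qed.

Lemma frameX_orthonormal i :
  inner (metricX J a) pt (row (lshift 1 i) (frameX J a pt)) (row (lshift 1 i) (frameX J a pt))
  = eps i.
Proof.
rewrite /inner metricX_ptX /frameX rX_ptX yX_ptX.
have -> : row (lshift 1 i) (block_mx ((phi r)^-1 *: e y) 0 0 1%:M)
    = row_mx ((phi r)^-1 *: row i (e y)) (0 : 'rV_1).
  apply/rowP => k; rewrite [LHS]mxE; case: (split_ordP k) => k' ->.
    by rewrite block_mxEul row_mxEl !mxE.
  by rewrite block_mxEur row_mxEr !mxE.
rewrite tr_row_mx mul_row_block !mulmx0 addr0 add0r mul0mx mul_row_col mul0mx addr0.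
rewrite [(_ *: _)^T]linearZ /= -!(scalemxAl, scalemxAr) !scalerA.
rewrite (_ : _ * _ = 1); last by field.
rewrite scale1r; transitivity ((e y *m h y *m (e y)^T) i i); last first.
  by rewrite (frame_orthonormal ax) !mxE eqxx.
by rewrite -row_mul mxE [RHS]mxE; apply: eq_bigr => k _; rewrite !mxE.
Qed.

Lemma mean_curvE : mean_curv J a pt = - (dphi n J r / phi r).
Proof.
rewrite /mean_curv.
have W i : weingarten J a pt i = - (dphi n J r / phi r) *: row (lshift 1 i) (frameX J a pt).
  rewrite /weingarten scaleNr; congr (- _); apply/rowP => k.
  rewrite [LHS]mxE [RHS]mxE derive_cst add0r.
  under eq_bigr => b _.
    rewrite (bigD1 (rshift n ord0)) //= big1 ?addr0; last first.
      by move=> l lr; rewrite dr_delta [delta_mx _ _ _ _]mxE eqxx (negbTE lr) mulr0 mul0r.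
    rewrite dr_delta [delta_mx _ _ _ _]mxE !eqxx mulr1.
    over.
  rewrite sum_split_ord [row _ _ _ (rshift _ _)]mxE.
  rewrite (_ : frameX _ _ _ _ (rshift _ _) = 0) ?mul0r ?addr0; last first.
    by rewrite /frameX block_mxEur mxE.
  under eq_bigr => b _ do rewrite christoffelX_lr.
  case: (split_ordP k) => k' ->; last first.
    rewrite big1 => [|l _]; last by rewrite eq_rlshift !mulr0.
    by rewrite [row _ _ _ _]mxE block_mxEur mxE mulr0.
  rewrite (bigD1 k') //= big1 => [|l lk]; last first.
    by rewrite eq_lshift eq_sym (negbTE lk) !mulr0.
  by rewrite eqxx mulr1 addr0 mulrC.
under eq_bigr => i _.
  rewrite W /inner -!scalemxAl mxE -/(inner (metricX J a) pt _ _) frameX_orthonormal.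
  rewrite mulrCA eps2 mulr1.
  over.
rewrite sumr_const card_ord -[X in _ * X]mulr_natr mulrCA mulVf ?mulr1 //.

by rewrite pnatr_eq0 -lt0n.
Qed.

Lemma spin_nabla_dr (f : 'rV[R]_(n + 1) -> 'cV[R[i]]_D) :
  spin_nabla (metricX J a) (frameX J a) (epsX eps) Gamma (dr R n) f pt
  = vderive f pt (dr R n).
Proof.
rewrite /spin_nabla big1 ?scaler0 ?addr0 // => j _; rewrite big1 // => k jk.
case: (split_ordP j) jk => j' ->; last first.
  by rewrite ord1 /= addn0 => /ltn_geF; rewrite -ltnS -[(n.+1)%N]addn1 ltn_ord.
move=> _; rewrite nabla_dr_frameX /inner !mul0mx mxE mulr0.
by rewrite toC0 scale0r.
Qed.

End AtRadius.
End PoincareEinsteinGeometry.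

Lemma differentiable_ptX (R : realType) n (r : R) (y : 'rV[R]_n) :
  differentiable (fun z : 'rV[R]_n => ptX z r) y.
Proof.
have -> : (fun z : 'rV[R]_n => ptX z r)
    = (\sum_(k < n) (fun z : 'rV[R]_n => z 0 k *: (delta_mx 0 (lshift 1 k) : 'rV_(n + 1))))
      + cst (ptX 0 r).
  apply/funext => z; rewrite fctE fct_sumE /cst.
  apply/rowP => i; rewrite [RHS]mxE summxE.
  case: (split_ordP i) => j ->.
    rewrite !row_mxEl mxE addr0 (bigD1 j) //= big1 ?addr0 => [|k kj].
      by rewrite !mxE !eqxx mulr1.
    by rewrite !mxE eqxx eq_lshift eq_sym (negbTE kj) mulr0.
  rewrite !row_mxEr !mxE big1 ?add0r // => k _.
  by rewrite !mxE eqxx eq_rlshift mulr0.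
apply: differentiableD; last exact: differentiable_cst.
apply: differentiable_sum => k; apply: differentiableZl.
exact: differentiable_coord.
Qed.

Lemma near_itvoo (R : realType) (P : R -> Prop) (r a b : R) : a < r -> r < b ->
  (forall t, a < t -> t < b -> P t) -> \forall t \near r, P t.
Proof.
move=> ar rb H; near=> t; apply: H.
  by near: t; exact: lt_nbhsr.
by near: t; exact: lt_nbhsl.
Unshelve. all: by end_near. Qed.

Section Parallel.
Variables (R : realType) (n d D : nat) (eps : 'I_n -> R).
Variables (gamma : 'I_n -> 'M[R[i]]_d) (M : spin_manifold eps gamma) (J rad : R).
Variable Gamma : 'I_(n + 1) -> 'M[R[i]]_D.
Hypothesis n_gt0 : (0 < n)%N.
Hypothesis eps2 : forall i, eps i * eps i = 1.
Hypothesis rad_gt0 : 0 < rad.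
Hypothesis rad_small : forall r, 0 <= r -> r < rad -> 0 < conf_factor n J r.
Variables (a : chart M).
Notation U := (Defs.coord M a @` dom M a).

Lemma chart_point y : U y -> exists2 x, dom M a x & y = Defs.coord M a x /\ param M a y = x.
Proof. by move=> [x ax <-]; exists x => //; split=> //; rewrite coordK. Qed.

Lemma open_chart : open U. Proof. exact: image_open. Qed.

Section OneSection.
Variable theta : spinor_familyX D M.
Hypothesis s_theta : is_smooth_spinorX rad Gamma theta.

Lemma slice_extension : exists2 F : 'rV[R]_(n + 1) -> 'cV[R[i]]_D,
    forall y r, U y -> 0 <= r -> r < rad -> vdifferentiable F (ptX y r)
  & forall y r, U y -> 0 <= r -> r < rad -> F (ptX y r) = theta a (param M a y) r.
Proof.
have [_ /(_ a) [W [F [oW AW sF FE]]]] := s_theta.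
exists F => y r Uy r0 rr.
  by apply: vsmooth_on_vdifferentiable sF _; apply: AW; rewrite /= yX_ptX rX_ptX.
by rewrite FE /= ?yX_ptX ?rX_ptX // /inX yX_ptX rX_ptX.
Qed.

Lemma slice_differentiable y r : U y -> 0 <= r -> r < rad ->
  vdifferentiable (fun y' => theta a (param M a y') r) y.
Proof.
move=> Uy r0 rr; have [F dF FE] := slice_extension.
apply: (@near_eq_vdifferentiable _ _ _ (fun y' => F (ptX y' r))).
  by apply: open_near_eq open_chart Uy _ => z Uz; exact: FE.
move=> i; have [d1 d2] := dF y r Uy r0 rr i.
by split; [exact: (differentiable_comp (differentiable_ptX r y) d1)
          | exact: (differentiable_comp (differentiable_ptX r y) d2)].
Qed.

Hypothesis p_theta : is_parallel J rad Gamma theta.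

Lemma real_parallel_cst (u : R -> R) r : 0 <= r -> r < rad ->
  (forall t, 0 <= t -> t < rad -> derivable u t 1) ->
  (forall t, 0 < t -> t < rad -> 'D_1 u t = 0) -> u r = u 0.
Proof.
move=> r0 rr du u0; apply/eqP; rewrite -subr_eq0; apply/eqP.
case: (@MVT_segment _ u (fun=> 0) 0 r r0) => [||t _].
- move=> t; rewrite in_itv /= => /andP[t0 tr].
  by apply: DeriveDef; [apply: du; [exact: ltW | exact: lt_trans rr]
                       | apply: u0 => //; exact: lt_trans rr].
- apply: derivable_within_continuous => t; rewrite in_itv /= => /andP[t0 tr].
  by apply: du => //; exact: le_lt_trans rr.
- by move=> ->; rewrite mul0r.
Qed.

Lemma parallel_cst x r : dom M a x -> 0 <= r -> r < rad -> theta a x r = theta a x 0.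
Proof.
move=> ax r0 rr; pose y := Defs.coord M a x.
have Uy : U y by exists x.
have px : param M a y = x by rewrite coordK.
have [F dF FE] := slice_extension.
have Fx t : 0 <= t -> t < rad -> F (ptX y t) = theta a x t by move=> *; rewrite FE // px.
rewrite -!Fx //; apply/colP => i.
have nearF t : 0 < t -> t < rad -> \forall s \near t, F (ptX y s) = inX theta a (ptX y s).
  move=> t0 tr; apply: near_itvoo t0 tr _ => s s0 sr.
  by rewrite Fx ?ltW // /inX yX_ptX rX_ptX px.
have Dv t : 0 < t -> t < rad -> vderive (inX theta a) (ptX y t) (dr R n) = 0.
  move=> t0 tr; have phi0 : conf_factor n J t != 0 by rewrite gt_eqF // rad_small // ltW.
  rewrite -(spin_nabla_dr Gamma n_gt0 eps2 ax phi0); exact: p_theta.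
apply: complex_eq.
  apply: (@real_parallel_cst (fun t => complex.Re (F (ptX y t) i 0))) => // t t0 tr.
    apply: derivable_dr (fun z => complex.Re (F z i 0)) _ _ _.
    by apply: diff_derivable; case: (dF y t Uy t0 tr i).
  have := congr1 (fun v : 'cV[R[i]]_D => complex.Re (v i 0)) (Dv t t0 tr).
  rewrite vderiveE /= mxE /= derive_dr => <-; apply: near_eq_derive.
  by apply: filterS (nearF t t0 tr) => s ->.
apply: (@real_parallel_cst (fun t => complex.Im (F (ptX y t) i 0))) => // t t0 tr.
  apply: derivable_dr (fun z => complex.Im (F z i 0)) _ _ _.
  by apply: diff_derivable; case: (dF y t Uy t0 tr i).
have := congr1 (fun v : 'cV[R[i]]_D => complex.Im (v i 0)) (Dv t t0 tr).
rewrite vderiveE /= mxE /= derive_dr => <-; apply: near_eq_derive.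
by apply: filterS (nearF t t0 tr) => s ->.
Qed.

End OneSection.
End Parallel.

Lemma near_at_right (R : realType) (P : R -> Prop) (b : R) : 0 < b ->
  (forall t, 0 < t -> t < b -> P t) -> \forall t \near (0 : R)^'+, P t.
Proof.
move=> b0 H; near=> t; apply: H.
  by near: t; exact: nbhs_right_gt.
by near: t; exact: nbhs_right_lt.
Unshelve. all: by end_near. Qed.

Lemma coefs_from_limit (R : realType) (c : nat -> R) (w b a0 : R) (K m : nat)
    (f : R -> R) :
  0 < b -> (m < K)%N ->
  (forall r, 0 < r -> r < b ->
    f r * ((1 - a0 * r ^+ 2) * r ^+ m) = \sum_(k < K) r ^+ k * c k) ->
  f r - w @[r --> 0^'+] --> (0 : R) ->
  (forall k, (k < m)%N -> c k = 0) /\ c m = w.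
Proof.
move=> b0 mK fE fw.
have key k : (k <= m)%N -> (forall i, (i < k)%N -> c i = 0) ->
    c k - (if k == m then w else 0) = 0.
  move=> km c0.
  pose Q : {poly R} := \poly_(i < K - k) c (i + k)%N.
  pose S : {poly R} := (1 - a0 *: 'X^2) * 'X^(m - k).
  have SrE t : S.[t] = (1 - a0 * t ^+ 2) * t ^+ (m - k).
    by rewrite /S hornerM hornerXn hornerD hornerN hornerZ hornerXn -[1]/(1%:P) hornerC.
  have kK : (k < K)%N := leq_ltn_trans km mK.
  have QE r : \sum_(i < K) r ^+ i * c i = Q.[r] * r ^+ k.
    rewrite horner_poly mulr_suml -(subnKC (ltnW kK)) big_split_ord /= big1 ?add0r.
      rewrite addKn; apply: eq_bigr => i _; rewrite addnC exprD; ring.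
    by move=> i _; rewrite c0 ?mulr0.
  have lim0 : (Q - w *: S).[r] @[r --> 0^'+] --> (0 : R).
    rewrite -[X in _ --> X](mul0r S.[0]).
    have SE : S.[r] @[r --> 0^'+] --> S.[0].
      by apply: cvg_at_right_filter; exact: continuous_horner.
    suff E : \forall r \near (0 : R)^'+, (f r - w) * S.[r] = (Q - w *: S).[r].
      exact: cvg_trans (near_eq_cvg E) (cvgM fw SE).
    apply: near_at_right b0 _ => r r0 rb.
    rewrite hornerD hornerN hornerZ mulrBl; congr (_ - _).
    apply: (mulIf (_ : r ^+ k != 0)); first by rewrite expf_neq0 // gt_eqF.
    rewrite -QE -fE // -mulrA; congr (_ * _).
    by rewrite SrE -mulrA -exprD subnK.
  have limQ : (Q - w *: S).[r] @[r --> 0^'+] --> (Q - w *: S).[0].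
    by apply: cvg_at_right_filter; exact: continuous_horner.
  have := cvg_unique _ limQ lim0 => /(_ (@Rhausdorff R)) E.
  rewrite -[RHS]E hornerD hornerN hornerZ; congr (_ - _).
    by rewrite horner_coef0 coef_poly subn_gt0 kK.
  rewrite SrE expr0n /= mulr0 subr0 mul1r expr0n subn_eq0.
  by rewrite eqn_leq km /=; case: (m <= k)%N; rewrite ?mulr1 ?mulr0.
have c0 : forall k, (k < m)%N -> c k = 0.
  elim/ltn_ind => k IH km; have := key k (ltnW km).
  rewrite (ltn_eqF km) subr0; apply => i ik; apply: IH => //.
  exact: ltn_trans km.
split=> //; have := key m (leqnn m) c0; rewrite eqxx => /eqP.
by rewrite subr_eq0 => /eqP.
Unshelve. all: by end_near. Qed.

Section DiracGbar.
Variables (R : realType) (n d D : nat) (eps : 'I_n -> R).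
Variables (gamma : 'I_n -> 'M[R[i]]_d) (M : spin_manifold eps gamma) (J rad : R).
Variable Gamma : 'I_(n + 1) -> 'M[R[i]]_D.
Hypothesis n_gt0 : (0 < n)%N.
Hypothesis eps2 : forall i, eps i * eps i = 1.
Hypothesis rad_gt0 : 0 < rad.
Hypothesis rad_small : forall r, 0 <= r -> r < rad -> 0 < conf_factor n J r.
Variables (a : chart M).
Notation U := (Defs.coord M a @` dom M a).
Notation h := (metric M a).
Notation e := (Defs.frame M a).
Notation GR := (GammaR Gamma).

Let oU : open U. Proof. exact: open_chart. Qed.

Definition boundary_dirac (f : 'rV[R]_n -> 'cV[R[i]]_D) y : 'cV[R[i]]_D :=
  GR *m local_dirac h e eps (GammaT Gamma) f y.

Lemma metric_differentiable i j y : U y -> differentiable (fun z => h z i j) y.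
Proof. move=> Uy; apply: smooth_on_differentiable Uy; exact: metric_smooth. Qed.
Lemma frame_differentiable i j y : U y -> differentiable (fun z => e z i j) y.
Proof. move=> Uy; apply: smooth_on_differentiable Uy; exact: frame_smooth. Qed.

Lemma local_dirac_ext (cl : 'I_n -> 'M[R[i]]_D) f g y : U y -> (forall z, U z -> f z = g z) ->
  vdifferentiable f y ->
  local_dirac h e eps cl f y = local_dirac h e eps cl g y.
Proof.
move=> Uy fg df; have fgn := open_near_eq oU Uy fg.
rewrite !local_diracE //; first exact: first_order_ext.
exact: near_eq_vdifferentiable fgn df.
Qed.

Variables (N : nat) (theta : nat -> spinor_familyX D M).
Hypothesis s_theta : forall j, (j <= 2 * N)%N ->
  is_smooth_spinorX rad Gamma (theta j) /\ is_parallel J rad Gamma (theta j).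

Definition boundary_coef j (y : 'rV[R]_n) := theta j a (param M a y) 0.

Lemma boundary_coef_vdifferentiable j y : (j <= 2 * N)%N -> U y -> vdifferentiable (boundary_coef j) y.
Proof. by move=> jN Uy; apply: (slice_differentiable (s_theta jN).1 Uy). Qed.

Lemma theta_boundary_coef j y r : (j <= 2 * N)%N -> U y -> 0 <= r -> r < rad ->
  theta j a (param M a y) r = boundary_coef j y.
Proof.
move=> jN Uy r0 rr; have [x ax [yE ->]] := chart_point Uy.
rewrite /boundary_coef yE coordK //.
exact: (parallel_cst n_gt0 eps2 rad_gt0 rad_small (s_theta jN).1 (s_theta jN).2).
Qed.

Notation mu := (expo R n N).

Lemma theta_bar_boundary_coef y r : U y -> 0 <= r -> r < rad ->
  theta_bar N theta a (param M a y) r = \sum_(j < (2 * N).+1) toC (r `^ mu j) *: boundary_coef j y.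
Proof. by move=> Uy r0 rr; apply: eq_bigr => j _; rewrite theta_boundary_coef // -ltnS. Qed.

Lemma leaf_dirac_theta_bar x r : dom M a x -> 0 <= r -> r < rad ->
  leaf_dirac J Gamma r (fun b x' => theta_bar N theta b x' r) a x
  = toC (conf_factor n J r)^-1 *: \sum_(j < (2 * N).+1)
      toC (r `^ mu j) *: boundary_dirac (boundary_coef j) (Defs.coord M a x).
Proof.
move=> ax r0 rr; set y := Defs.coord M a x.
have Uy : U y by exists x.
have phi0 : conf_factor n J r != 0 by rewrite gt_eqF // rad_small.
have [_ [uh _]] := frame_metric_inv eps2 ax.
pose f z := \sum_(j < (2 * N).+1) toC (r `^ mu j) *: boundary_coef j z.
have df j : (j <= 2 * N)%N -> vdifferentiable (fun z => toC (r `^ mu j) *: boundary_coef j z) y.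
  move=> jN; apply: vdifferentiableZ; [exact: cdifferentiable_cst | exact: boundary_coef_vdifferentiable].
have dfs : vdifferentiable f y.
  by apply: vdifferentiable_sum => j; apply: df; rewrite -ltnS.
have fgn : {near y, f =1 (fun z => theta_bar N theta a (param M a z) r)}.
  by apply: open_near_eq oU Uy _ => z Uz; rewrite theta_bar_boundary_coef.
have dg := near_eq_vdifferentiable fgn dfs.
rewrite /leaf_dirac.
rewrite [X in GR *m X](local_dirac_homothety eps (GammaT Gamma) phi0 uh) //; first last.
- by move=> i j; exact: frame_differentiable.
- by move=> i j; exact: metric_differentiable.
rewrite -scalemxAr; congr (_ *: _).
rewrite local_diracE // -(first_order_ext _ _ fgn) first_order_sum => [|j]; last by apply: df; rewrite -ltnS.
rewrite mulmx_sumr; apply: eq_bigr => j _.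
have dj : vdifferentiable (boundary_coef j) y by apply: boundary_coef_vdifferentiable => //; rewrite -ltnS.
by rewrite first_orderZl // -scalemxAr /boundary_dirac local_diracE.
Qed.

Lemma nabla_dr_theta_bar x r : dom M a x -> 0 < r -> r < rad ->
  nabla_dr J Gamma (theta_bar N theta) a x r
  = \sum_(j < (2 * N).+1) toC (mu j * r `^ (mu j - 1)) *: boundary_coef j (Defs.coord M a x).
Proof.
move=> ax r0 rr; set y := Defs.coord M a x.
have Uy : U y by exists x.
have phi0 : conf_factor n J r != 0 by rewrite gt_eqF // rad_small // ltW.
rewrite /nabla_dr (spin_nabla_dr Gamma n_gt0 eps2 ax phi0).
have E t : 0 < t -> t < rad -> inX (theta_bar N theta) a (ptX y t)
    = \sum_(j < (2 * N).+1) toC (t `^ mu j) *: boundary_coef j y.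
  by move=> t0 tr; rewrite /inX yX_ptX rX_ptX theta_bar_boundary_coef // ltW.
have D1 (c : 'I_(2 * N).+1 -> R) : 'D_1 (fun t => \sum_(j < (2 * N).+1) t `^ mu j * c j) r
    = \sum_(j < (2 * N).+1) mu j * r `^ (mu j - 1) * c j.
  have dj (j : 'I_(2 * N).+1) : is_derive r (1 : R) (fun t => t `^ mu j * c j) (mu j * r `^ (mu j - 1) * c j).
    have dp := is_derive1_powR (mu j) r0.
    have -> : (fun t => t `^ mu j * c j) = c j *: (fun t => t `^ mu j).
      by apply/funext => t; rewrite fctE /GRing.scale /= mulrC.
    by rewrite mulrC; apply: is_deriveZ.
  have -> : (fun t => \sum_(j < (2 * N).+1) t `^ mu j * c j) = \sum_(j < (2 * N).+1) (fun t => t `^ mu j * c j).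
    by apply/funext => t; rewrite fct_sumE.
  by have [_ ->] := is_derive_sum dj.
have ReE (c : 'I_(2 * N).+1 -> R) i : complex.Re ((\sum_(j < (2 * N).+1) toC (c j) *: boundary_coef j y) i 0)
    = \sum_(j < (2 * N).+1) c j * complex.Re (boundary_coef j y i 0).
  rewrite summxE Re_sum; apply: eq_bigr => j _.
  by rewrite mxE Re_M /= mul0r subr0.
have ImE (c : 'I_(2 * N).+1 -> R) i : complex.Im ((\sum_(j < (2 * N).+1) toC (c j) *: boundary_coef j y) i 0)
    = \sum_(j < (2 * N).+1) c j * complex.Im (boundary_coef j y i 0).
  rewrite summxE Im_sum; apply: eq_bigr => j _.
  by rewrite mxE Im_M /= mul0r addr0.
apply/colP => i; rewrite vderiveE; apply: complex_eq.
  rewrite ReE /= derive_dr -D1; apply: near_eq_derive.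
  by apply: near_itvoo r0 rr _ => t t0 tr; rewrite E // ReE.
rewrite ImE /= derive_dr -D1; apply: near_eq_derive.
by apply: near_itvoo r0 rr _ => t t0 tr; rewrite E // ImE.
Qed.

Lemma dirac_gbar_theta_bar x r : dom M a x -> 0 < r -> r < rad ->
  dirac_gbar J Gamma (theta_bar N theta) a x r
  = \sum_(j < (2 * N).+1) toC (r `^ mu j) *:
     (toC (- (r / conf_factor n J r)) *: (GR *m boundary_dirac (boundary_coef j) (Defs.coord M a x))
      + toC (n%:R / 2%:R * r * (dphi n J r / conf_factor n J r) + (mu j - n%:R / 2%:R))
          *: (GR *m boundary_coef j (Defs.coord M a x))).
Proof.
move=> ax r0 rr; set y := Defs.coord M a x.
have Uy : U y by exists x.
have phi0 : conf_factor n J r != 0 by rewrite gt_eqF // rad_small // ltW.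
rewrite /dirac_gbar leaf_dirac_theta_bar // ?ltW // nabla_dr_theta_bar //.
rewrite (mean_curvE n_gt0 eps2 ax phi0) -/y.
have -> : theta_bar N theta a x r = \sum_(j < (2 * N).+1) toC (r `^ mu j) *: boundary_coef j y.
  by rewrite -(theta_bar_boundary_coef Uy (ltW r0) rr) coordK.
rewrite -scalemxAr scalerA -!(@scaleNr _ 'cV[R[i]]_D) !mulmx_sumr !scaler_sumr -!big_split /=.
apply: eq_bigr => j _; rewrite -!scalemxAr !scalerDr !scalerA -addrA -addrA.
congr (_ + _).
  by congr (_ *: _); rewrite -toCM -toCN -!toCM; congr toC; ring.
rewrite -!scalerDl; congr (_ *: _); rewrite -!toCN -!toCM -!toCD; congr toC.
have -> : r * (mu j * r `^ (mu j - 1)) = mu j * r `^ mu j.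
  rewrite powRB; last by apply/implyP => _; rewrite gt_eqF.
  by rewrite powRr1 ?ltW //; field; rewrite gt_eqF.
ring.
Qed.

End DiracGbar.

Section Intertwine.
Variables (R : realType) (m d d' : nat).
Variables (g e : 'rV[R]_m -> 'M[R]_m) (eps : 'I_m -> R).
Variables (cl : 'I_m -> 'M[R[i]]_d) (cl' : 'I_m -> 'M[R[i]]_d').

Lemma local_dirac_intertwine (s : R[i]) (X : 'M[R[i]]_(d', d)) f y :
  s * s = 1 -> (forall i, X *m cl i = s *: (cl' i *m X)) -> vdifferentiable f y ->
  X *m local_dirac g e eps cl f y = s *: local_dirac g e eps cl' (fun z => X *m f z) y.
Proof.
move=> s2 Xcl df; rewrite /local_dirac mulmx_sumr scaler_sumr; apply: eq_bigr => i _.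
rewrite -scalemxAr scalerA mulrC -scalerA; congr (_ *: _).
rewrite mulmxA Xcl -scalemxAl -mulmxA; congr (_ *: (_ *m _)).
rewrite /spin_nabla mulmxDr vderive_mulmx //; congr (_ + _).
rewrite -scalemxAr mulmx_sumr; congr (_ *: _); apply: eq_bigr => j _.
rewrite mulmx_sumr; apply: eq_bigr => k _; rewrite -scalemxAr; congr (_ *: _).
rewrite (mulmxA X (cl j)) Xcl -scalemxAl -mulmxA (mulmxA X (cl k)) Xcl -scalemxAl -scalemxAr.
by rewrite scalerA s2 scale1r -mulmxA.
Qed.
End Intertwine.

(** * Polynomials in a linear differential operator *)

Section PolynomialAction.
Variables (R : realType) (m d : nat) (U : set 'rV[R]_m).
Hypothesis oU : open U.
Variable L : ('rV[R]_m -> 'cV[R[i]]_d) -> 'rV[R]_m -> 'cV[R[i]]_d.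
Hypothesis L_smooth : forall f, vsmooth_on U f -> vsmooth_on U (L f).
Hypothesis L_ext : forall f g, vsmooth_on U f -> (forall y, U y -> f y = g y) ->
  forall y, U y -> L f y = L g y.
Hypothesis L_D : forall f g y, U y -> vsmooth_on U f -> vsmooth_on U g ->
  L (fun z => f z + g z) y = L f y + L g y.
Hypothesis L_Z : forall c f y, U y -> vsmooth_on U f ->
  L (fun z => c *: f z) y = c *: L f y.

Definition pact (p : {poly R[i]}) f y : 'cV[R[i]]_d :=
  \sum_(i < size p) p`_i *: iter i L f y.

Lemma vsmooth_on0 : vsmooth_on U (fun=> 0 : 'cV[R[i]]_d).
Proof. by move=> i; under eq_fun do rewrite mxE; exact: csmooth_on_cst. Qed.

Lemma vsmooth_onD f g : vsmooth_on U f -> vsmooth_on U g ->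
  vsmooth_on U (fun z => f z + g z : 'cV[R[i]]_d).
Proof.
by move=> sf sg i; under eq_fun do rewrite mxE; apply: csmooth_onD; [exact: oU|exact: sf|exact: sg].
Qed.

Lemma vsmooth_onZ c f : csmooth_on U c -> vsmooth_on U f ->
  vsmooth_on U (fun z => c z *: f z : 'cV[R[i]]_d).
Proof.
by move=> sc sf i; under eq_fun do rewrite mxE; apply: csmooth_onM; [exact: oU|exact: sc|exact: sf].
Qed.

Lemma vsmooth_onZl c f : vsmooth_on U f -> vsmooth_on U (fun z => c *: f z : 'cV[R[i]]_d).
Proof. by apply: vsmooth_onZ; exact: csmooth_on_cst. Qed.

Lemma vsmooth_on_sum (I : Type) (r : seq I) (F : I -> 'rV[R]_m -> 'cV[R[i]]_d) :
  (forall i, vsmooth_on U (F i)) -> vsmooth_on U (fun z => \sum_(i <- r) F i z).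
Proof.
move=> sF; elim: r => [|i r IH].
  by under eq_fun do rewrite big_nil; exact: vsmooth_on0.
by under eq_fun do rewrite big_cons; exact: vsmooth_onD.
Qed.

Lemma vsmooth_on_ext f g : (forall y, U y -> f y = g y) -> vsmooth_on U f ->
  vsmooth_on U (g : _ -> 'cV[R[i]]_d).
Proof. by move=> fg sf i; apply: csmooth_on_ext (sf i) => // y Uy; rewrite fg. Qed.

Lemma iter_smooth k f : vsmooth_on U f -> vsmooth_on U (iter k L f).
Proof. by move=> sf; elim: k => //= k; exact: L_smooth. Qed.

Lemma pact_smooth p f : vsmooth_on U f -> vsmooth_on U (pact p f).
Proof.
by move=> sf; apply: vsmooth_on_sum => i; apply: vsmooth_onZl; exact: iter_smooth.
Qed.

Lemma iter_ext k f g : vsmooth_on U f -> (forall y, U y -> f y = g y) ->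
  forall y, U y -> iter k L f y = iter k L g y.
Proof.
by move=> sf fg; elim: k => //= k IH; apply: L_ext => //; exact: iter_smooth.
Qed.

Lemma pact_ext p f g : vsmooth_on U f -> (forall y, U y -> f y = g y) ->
  forall y, U y -> pact p f y = pact p g y.
Proof. by move=> sf fg y Uy; apply: eq_bigr => i _; rewrite (iter_ext _ sf fg). Qed.

Implicit Types (p q : {poly R[i]}).

Lemma pact_widen p f y n : (size p <= n)%N ->
  pact p f y = \sum_(i < n) p`_i *: iter i L f y.
Proof.
move=> pn; rewrite -(subnKC pn) big_split_ord /= [X in _ = _ + X]big1 ?addr0 // => i _.
by rewrite nth_default ?scale0r // leq_addr.
Qed.

Lemma pactD p q f y : pact (p + q) f y = pact p f y + pact q f y.
Proof.
have h : (size (p + q)%R <= maxn (size p) (size q))%N by exact: size_polyD.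
rewrite !(@pact_widen _ f y (maxn (size p) (size q))) ?leq_maxl ?leq_maxr // -big_split /=.
by apply: eq_bigr => i _; rewrite coefD scalerDl.
Qed.

Lemma pactZ c p f y : pact (c *: p) f y = c *: pact p f y.
Proof.
rewrite (@pact_widen _ f y (size p)) ?size_scale_leq // scaler_sumr.
by apply: eq_bigr => i _; rewrite coefZ scalerA.
Qed.

Lemma pactC c f y : pact c%:P f y = c *: f y.
Proof.
rewrite (@pact_widen _ _ _ 1) ?size_polyC ?leq_b1 //.
by rewrite big_ord1 coefC.
Qed.

Lemma L_sum (I : Type) (r : seq I) (F : I -> 'rV[R]_m -> 'cV[R[i]]_d) y :
  U y -> (forall i, vsmooth_on U (F i)) ->
  L (fun z => \sum_(i <- r) F i z) y = \sum_(i <- r) L (F i) y.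
Proof.
move=> Uy sF; elim: r => [|i r IH].
  have -> : (fun z => \sum_(i <- [::]) F i z) = (fun z => 0 *: (0 : 'cV[R[i]]_d)).
    by apply/funext => z; rewrite big_nil scale0r.
  by rewrite L_Z ?scale0r ?big_nil //; exact: vsmooth_on0.
under [X in L X]eq_fun do rewrite big_cons.
by rewrite L_D ?big_cons ?IH //; exact: vsmooth_on_sum.
Qed.

Lemma pactX p f y : U y -> vsmooth_on U f -> pact ('X * p) f y = L (pact p f) y.
Proof.
move=> Uy sf; rewrite (@pact_widen _ _ _ (size p).+1); last first.
  by rewrite (leq_trans (size_polyMleq _ _)) // size_polyX.
rewrite big_ord_recl coefXM /= scale0r add0r.
rewrite /pact L_sum // => [|i]; last by apply: vsmooth_onZl; exact: iter_smooth.
apply: eq_bigr => i _; rewrite L_Z //; last exact: iter_smooth.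
by rewrite coefXM.
Qed.

Lemma pactXn k f y : pact 'X^k f y = iter k L f y.
Proof.
rewrite (@pact_widen _ _ _ k.+1) ?size_polyXn // big_ord_recr /= big1 ?add0r.
  by rewrite coefXn eqxx scale1r.
by move=> i _; rewrite coefXn ltn_eqF ?scale0r.
Qed.

End PolynomialAction.

Section ChartDirac.
Variables (R : realType) (n d D : nat) (eps : 'I_n -> R).
Variables (gamma : 'I_n -> 'M[R[i]]_d) (M : spin_manifold eps gamma).
Hypothesis eps2 : forall i, eps i * eps i = 1.
Variables (a : chart M) (cl : 'I_n -> 'M[R[i]]_D).
Notation U := (Defs.coord M a @` dom M a).
Notation h := (metric M a).
Notation e := (Defs.frame M a).
Notation L := (local_dirac h e eps cl).

Let oU : open U. Proof. exact: open_chart. Qed.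

Lemma smooth_on_metric i j : smooth_on U (fun y => h y i j).
Proof. exact: metric_smooth. Qed.
Lemma smooth_on_frame i j : smooth_on U (fun y => e y i j).
Proof. exact: frame_smooth. Qed.
Lemma smooth_on_inv_metric i j : smooth_on U (fun y => invmx (h y) i j).
Proof.
apply: (@smooth_on_ext _ _ _ oU (fun y => \sum_k e y k i * eps k * e y k j)).
  move=> _ [x ax <-]; have [_ [_ ->]] := frame_metric_inv eps2 ax.
  rewrite mul_mx_diag mxE; apply: eq_bigr => k _; rewrite !mxE; congr (_ * _).
apply: smooth_on_sum => // k _; apply: smooth_onM => //; last exact: smooth_on_frame.
apply: smooth_onM => //; [exact: smooth_on_frame | exact: smooth_on_cst].
Qed.

Lemma chart_dirac_smooth f : vsmooth_on U f -> vsmooth_on U (L f).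
Proof.
move=> sf; apply: (vsmooth_on_ext oU
  (f := first_order (dirac_symbol e eps cl) (dirac_potential h e eps cl) f)).
  by move=> y Uy; rewrite local_diracE //; exact: vsmooth_on_vdifferentiable Uy.
apply: first_order_smooth => // [k|].
  by apply: msmooth_dirac_symbol => //; exact: smooth_on_frame.
apply: msmooth_dirac_potential => //; [exact: smooth_on_metric
  | exact: smooth_on_inv_metric | exact: smooth_on_frame].
Qed.

Lemma chart_dirac_ext f g : vsmooth_on U f -> (forall y, U y -> f y = g y) ->
  forall y, U y -> L f y = L g y.
Proof.
move=> sf fg y Uy; have df := vsmooth_on_vdifferentiable sf Uy.
exact: local_dirac_ext df.
Qed.

Lemma chart_diracD f g y : U y -> vsmooth_on U f -> vsmooth_on U g ->
  L (fun z => f z + g z) y = L f y + L g y.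
Proof.
move=> Uy /vsmooth_on_vdifferentiable/(_ Uy) df /vsmooth_on_vdifferentiable/(_ Uy) dg.
by rewrite !local_diracE ?first_orderD //; exact: vdifferentiableD.
Qed.

Lemma chart_diracZ c f y : U y -> vsmooth_on U f ->
  L (fun z => c *: f z) y = c *: L f y.
Proof.
move=> Uy /vsmooth_on_vdifferentiable/(_ Uy) df.
rewrite !local_diracE ?first_orderZl //; apply: vdifferentiableZ => //; exact: cdifferentiable_cst.
Qed.

End ChartDirac.

Section Shift.
Variables (R : comNzRingType) (V : lmodType R).

(* the contribution of [X 0, ..., X (K - 1)], moved up by [m] degrees, to the
   coefficient of degree [k] *)
Definition shifted (K m : nat) (X : nat -> V) k : V :=
  if (m <= k < m + K)%N then X (k - m)%N else 0.

Lemma sum_shifted K K' m (X : nat -> V) (c : nat -> R) : (m + K <= K')%N ->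
  \sum_(k < K') c k *: shifted K m X k = \sum_(j < K) c (m + j)%N *: X j.
Proof.
move=> mK; rewrite -(subnKC mK) !big_split_ord /= big1 ?add0r.
  rewrite [X in _ + X]big1 ?addr0 => [|i _].
    apply: eq_bigr => j _; rewrite /shifted leq_addr ltn_add2l ltn_ord /=.
    by rewrite addKn.
  by rewrite /shifted [(_ < m + K)%N]ltnNge leq_addr andbF scaler0.
by move=> i _; rewrite /shifted leqNgt ltn_ord /= scaler0.
Qed.
End Shift.

(** * The formal solution and its obstruction *)

(* With the equation multiplied by [G] this is a linear system for [u] and [G u] of
   determinant [alpha ^+ 2 - beta ^+ 2], so that both conclusions follow. *)
Lemma eigen_step (R : realType) D (G : 'M[R[i]]_D) (alpha beta sigma : R[i]) (u v : 'cV[R[i]]_D) :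
  G *m G = - 1%:M -> sigma * sigma = 1 -> alpha ^+ 2 != beta ^+ 2 ->
  alpha *: (G *m u) - ('i%C * beta) *: u = (sigma * 'i%C) *: v ->
  G *m v = (sigma * 'i%C) *: v ->
  (alpha - sigma * beta) *: u = v /\ G *m u = (sigma * 'i%C) *: u.
Proof.
move=> G2 s2 ab e1 Gv.
have ii : 'i%C * 'i%C = -1 :> R[i] by rewrite -expr2 sqr_i.
have Guu : G *m (G *m u) = - u by rewrite mulmxA G2 mulNmx mul1mx.
have e2 : - (alpha *: u) - ('i%C * beta) *: (G *m u) = - v.
  have := congr1 (mulmx G) e1; rewrite mulmxBr -!scalemxAr Guu Gv scalerN scalerA => ->.
  by rewrite mulrACA s2 ii mul1r scaleN1r.
have dif : (alpha - sigma * beta) * (alpha + sigma * beta) = alpha ^+ 2 - beta ^+ 2.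
  transitivity (alpha ^+ 2 - (sigma * sigma) * beta ^+ 2); first by ring.
  by rewrite s2 mul1r.
have nz : (alpha - sigma * beta) * (alpha + sigma * beta) != 0 by rewrite dif subr_eq0.
have [nm np] : alpha - sigma * beta != 0 /\ alpha + sigma * beta != 0.
  by move: nz; rewrite mulf_eq0 negb_or => /andP.
have E : (alpha - sigma * beta) *: u = v.
  apply/colP => k; move/colP/(_ k): e1; move/colP/(_ k): e2.
  move: (G *m u) => g; rewrite !mxE => e2 e1; apply: (mulfI np).
  transitivity ((alpha ^+ 2 - beta ^+ 2) * u k 0); first by rewrite -dif; ring.
  transitivity (- alpha * (- (alpha * u k 0) - 'i%C * beta * g k 0)
    - 'i%C * beta * (alpha * g k 0 - 'i%C * beta * u k 0)).
    transitivity (alpha ^+ 2 * u k 0 + ('i%C * 'i%C) * (beta ^+ 2 * u k 0)); last by ring.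
    by rewrite ii; ring.
  rewrite e1 e2; transitivity (alpha * v k 0 - ('i%C * 'i%C) * (sigma * beta * v k 0)); first by ring.
  by rewrite ii; ring.
split=> //; apply: (scalerI nm).
by rewrite scalemxAr E Gv -E !scalerA mulrC.
Qed.

Section SolutionPolynomials.
Variables (F : numFieldType) (a nu : F) (N : nat).

Fixpoint solution_pair (k : nat) : {poly F} * {poly F} :=
  if k is k'.+1 then
    let: (p, p') := solution_pair k' in
    ((indicial F N k)^-1 *: ('X * p + (a * (2%:R * nu + indicial F N k - 2%:R)) *: p'), p)
  else (1, 0).
Definition solution_poly k : {poly F} := (solution_pair k).1.
Definition residue_poly k : {poly F} := 'X * solution_poly k.-1
  + (if (1 < k)%N then (a * (2%:R * nu + indicial F N k - 2%:R)) *: solution_poly k.-2 else 0).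

Lemma solution_polyS k : solution_poly k.+1 = (indicial F N k.+1)^-1 *: residue_poly k.+1.
Proof.
rewrite /residue_poly /solution_poly /=; case: k => [|k] /=; first by rewrite scaler0.
by case: (solution_pair k).
Qed.

Lemma indicial_neq0 j : (0 < j <= 2 * N)%N -> indicial F N j != 0.
Proof.
move=> /andP[j0 jN]; rewrite /indicial; case: odd; last by rewrite pnatr_eq0 -lt0n.
by rewrite subr_eq0 eqr_nat ltn_eqF // addn1 ltnS.
Qed.

Lemma residue_solution : exists2 c : F, c != 0 &
  residue_poly (2 * N + 1) = c *: ('X * epoly a N).
Proof.
have [||c c0 E] := @obstruction_poly F a nu N solution_poly.
- by [].
- case=> // j jN; rewrite solution_polyS scalerA mulfV ?scale1r //.
  exact: indicial_neq0.
- exists c => //; have k0 : indicial F N (2 * N).+1 = 0.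
    by rewrite /indicial /= {1}mul2n odd_double addn1 subrr.
  by rewrite -E /residue_poly addn1 /= k0 addr0 ltnS muln_gt0.
Qed.
End SolutionPolynomials.

Section Recursion.
Variables (R : realType) (n d D : nat) (eps : 'I_n -> R).
Variables (gamma : 'I_n -> 'M[R[i]]_d) (M : spin_manifold eps gamma) (J rad : R).
Variable Gamma : 'I_(n + 1) -> 'M[R[i]]_D.
Hypothesis n_gt0 : (0 < n)%N.
Hypothesis eps2 : forall i, eps i * eps i = 1.
Hypothesis rad_gt0 : 0 < rad.
Hypothesis rad_small : forall r, 0 <= r -> r < rad -> 0 < conf_factor n J r.
Notation GR := (GammaR Gamma).
Hypothesis GR2 : GR *m GR = - 1%:M.
Hypothesis GRanti : forall i, GR *m GammaT Gamma i = - (GammaT Gamma i *m GR).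
Variables (a : chart M).
Notation U := (Defs.coord M a @` dom M a).
Notation h := (metric M a).
Notation e := (Defs.frame M a).

Definition boundary_clifford i : 'M[R[i]]_D := GR *m GammaT Gamma i.
Notation L := (local_dirac h e eps boundary_clifford).

Lemma boundary_clifford2 j k :
  boundary_clifford j *m boundary_clifford k = GammaT Gamma j *m GammaT Gamma k.
Proof.
rewrite /boundary_clifford GRanti mulNmx -mulmxA (mulmxA GR GR) GR2.
by rewrite mulNmx mul1mx mulmxN opprK.
Qed.

Lemma GR_boundary_clifford i : GR *m boundary_clifford i = (-1) *: (boundary_clifford i *m GR).
Proof.
by rewrite /boundary_clifford scaleN1r -mulmxA -[GammaT _ _ *m _]opprK -GRanti mulmxN opprK.
Qed.

Lemma boundary_diracE f y : boundary_dirac Gamma a f y = L f y.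
Proof.
have S v : spin_nabla h e eps (GammaT Gamma) v f y
         = spin_nabla h e eps boundary_clifford v f y.
  rewrite /spin_nabla; congr (vderive f y v + _ *: _).
  apply: eq_bigr => j _; apply: eq_bigr => k _; congr (_ *: _).
  by rewrite [LHS]mulmxA [RHS]mulmxA boundary_clifford2.
rewrite /boundary_dirac /local_dirac mulmx_sumr; apply: eq_bigr => i _.
by rewrite -scalemxAr S mulmxA.
Qed.

Variables (N : nat) (sg : bool) (theta : nat -> spinor_familyX D M) (omega : spinor_familyX D M).
Hypothesis s_theta : forall j, (j <= 2 * N)%N ->
  is_smooth_spinorX rad Gamma (theta j) /\ is_parallel J rad Gamma (theta j).
Hypothesis s_omega : is_smooth_spinorX rad Gamma omega /\ is_parallel J rad Gamma omega.
Notation lam := (lambda R N).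
Notation sgi := (signC R sg * 'i%C).
Hypothesis lim_theta : forall x, dom M a x ->
  vcvg0_right (fun r =>
    toC (r `^ (- expo R n N (2 * N + 1)))
      *: (dirac_gbar J Gamma (theta_bar N theta) a x r
          - (signC R sg * 'i%C * toC lam) *: theta_bar N theta a x r)
    - omega a x r).

Notation t := (boundary_coef a theta).
Notation a0 := (J / (2%:R * n%:R)).

Definition coefA y j := toC (lam + j%:R) *: (GR *m t j y) - (sgi * toC lam) *: t j y.
Definition coefB y j := GR *m L (t j) y.
Definition coefE y j := toC (n%:R * a0) *: (GR *m t j y) + toC a0 *: coefA y j.
Definition coefC y k : 'cV[R[i]]_D :=
  shifted (2 * N + 1) 0 (coefA y) k - shifted (2 * N + 1) 1 (coefB y) k
  - shifted (2 * N + 1) 2 (coefE y) k.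

Lemma powR_shift r j : 0 < r ->
  r ^+ (2 * N + 1) * r `^ (- expo R n N (2 * N + 1)) * r `^ expo R n N j = r ^+ j.
Proof.
move=> r0; have r_neq0 : r != 0 by rewrite gt_eqF.
rewrite -!powR_mulrn ?ltW // -!powRD; try by apply/implyP.
by congr (_ `^ _); rewrite /expo; ring.
Qed.

Lemma residue_expansion x r : dom M a x -> 0 < r -> r < rad ->
  toC ((1 - a0 * r ^+ 2) * r ^+ (2 * N + 1)) *:
    (toC (r `^ (- expo R n N (2 * N + 1)))
      *: (dirac_gbar J Gamma (theta_bar N theta) a x r
          - (signC R sg * 'i%C * toC lam) *: theta_bar N theta a x r))
  = \sum_(k < 2 * N + 3) toC (r ^+ k) *: coefC (Defs.coord M a x) k.
Proof.
move=> ax r0 rr; set y := Defs.coord M a x.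
have Uy : U y by exists x.
have phi0 : conf_factor n J r != 0 by rewrite gt_eqF // rad_small // ltW.
rewrite (dirac_gbar_theta_bar n_gt0 eps2 rad_gt0 rad_small s_theta) // -/y.
have -> : theta_bar N theta a x r = \sum_(j < (2 * N).+1) toC (r `^ expo R n N j) *: t j y.
  by rewrite -(theta_bar_boundary_coef n_gt0 eps2 rad_gt0 rad_small s_theta Uy (ltW r0) rr) coordK.
transitivity (\sum_(j < 2 * N + 1) toC (r ^+ (0 + j)) *: coefA y j
   - \sum_(j < 2 * N + 1) toC (r ^+ (1 + j)) *: coefB y j
   - \sum_(j < 2 * N + 1) toC (r ^+ (2 + j)) *: coefE y j); last first.
  rewrite -(@sum_shifted _ _ _ (2 * N + 3) 0 _ (fun k => toC (r ^+ k))); last lia.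
  rewrite -(@sum_shifted _ _ _ (2 * N + 3) 1 _ (fun k => toC (r ^+ k))); last by rewrite addnCA leq_add2l.
  rewrite -(@sum_shifted _ _ _ (2 * N + 3) 2 _ (fun k => toC (r ^+ k))); last by rewrite addnCA.
  rewrite -!sumrB; apply: eq_bigr => k _.
  by rewrite /coefC !scalerBr.
rewrite -!sumrB -[(2 * N).+1]addn1 scaler_sumr -sumrB !scaler_sumr; apply: eq_bigr => j _.
rewrite boundary_diracE; change (GR *m L (t j) y) with (coefB y j).
rewrite /coefE /coefA scalerDr scalerA scalerBr scalerDr !scalerA.
rewrite [in RHS]scalerBr [in RHS]scalerDr [in RHS]scalerBr !scalerA.
have phiE : 1 - a0 * r ^+ 2 = conf_factor n J r by [].
have n0 : n%:R != 0 :> R by rewrite pnatr_eq0 -lt0n.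
have rE : r ^+ (2 * N + 1) * (r `^ (- expo R n N (2 * N + 1)) * r `^ expo R n N j) = r ^+ j.
  by rewrite mulrA powR_shift.
have F0 : toC ((1 - a0 * r ^+ 2) * r ^+ (2 * N + 1)) *
   (toC (r `^ (- expo R n N (2 * N + 1))) * toC (r `^ expo R n N j))
   = toC (conf_factor n J r * r ^+ j).
  by rewrite -!toCM; congr toC; rewrite -[in RHS]rE phiE !mulrA.
have cb : toC (conf_factor n J r * r ^+ j) * toC (- (r / conf_factor n J r)) = - toC (r ^+ (1 + j)).
  by rewrite -toCM -toCN exprS; congr toC; field.
have cu : toC (conf_factor n J r * r ^+ j) * toC (n%:R / 2 * r * (dphi n J r / conf_factor n J r) +
      (expo R n N j - n%:R / 2))
    = toC (r ^+ (0 + j)) * toC (lam + j%:R) - toC (r ^+ (2 + j)) * toC (n%:R * a0)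
      - toC (r ^+ (2 + j)) * toC a0 * toC (lam + j%:R).
  rewrite -!toCM -!toCN -!toCD; congr toC; rewrite add0n exprD /expo /dphi.
  transitivity (r ^+ j * (n%:R / 2 * r * (- (J / n%:R) * r) + conf_factor n J r * (lam + j%:R))).
    by field; rewrite n0.
  by rewrite -phiE; field.
have cv : toC ((1 - a0 * r ^+ 2) * r ^+ (2 * N + 1)) *
   toC (r `^ (- expo R n N (2 * N + 1))) * (sgi * toC lam * toC (r `^ expo R n N j))
   = toC (r ^+ (0 + j)) * (sgi * toC lam) - toC (r ^+ (2 + j)) * toC a0 * (sgi * toC lam).
  transitivity (toC (conf_factor n J r * r ^+ j) * (sgi * toC lam)).
    by rewrite -F0; ring.
  rewrite -mulrBl; congr (_ * _); rewrite -toCM -toCN -toCD -phiE; congr toC.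
  by rewrite add0n exprD; ring.
rewrite F0 scalerDr !scalerA scalerN scalerA cb cu cv.
move: (coefB y j) (GR *m t j y) (t j y) => b u v.
apply/colP => i; rewrite !mxE.
by ring.
Qed.

Lemma coefC_eqs x : dom M a x ->
  (forall k, (k < 2 * N + 1)%N -> coefC (Defs.coord M a x) k = 0) /\
  coefC (Defs.coord M a x) (2 * N + 1) = omega a x 0.
Proof.
move=> ax; set y := Defs.coord M a x.
have om r : 0 < r -> r < rad -> omega a x r = omega a x 0.
  move=> r0 rr; apply: (parallel_cst n_gt0 eps2 rad_gt0 rad_small s_omega.1 s_omega.2) => //.
  exact: ltW.
pose V r := toC (r `^ (- expo R n N (2 * N + 1)))
      *: (dirac_gbar J Gamma (theta_bar N theta) a x r
          - (signC R sg * 'i%C * toC lam) *: theta_bar N theta a x r).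
have mK : (2 * N + 1 < 2 * N + 3)%N by rewrite ltn_add2l.
have Vlim := lim_theta ax.
have BE (u v : 'cV[R[i]]_D) i :
    complex.Re ((u - v) i 0) = complex.Re (u i 0) - complex.Re (v i 0) /\
    complex.Im ((u - v) i 0) = complex.Im (u i 0) - complex.Im (v i 0).
  by rewrite !mxE; case: (u i 0) => ? ?; case: (v i 0).
have re i := @coefs_from_limit R (fun k => complex.Re (coefC y k i 0))
   (complex.Re (omega a x 0 i 0)) rad a0 (2 * N + 3) (2 * N + 1)
   (fun r => complex.Re (V r i 0)) rad_gt0 mK.
have im i := @coefs_from_limit R (fun k => complex.Im (coefC y k i 0))
   (complex.Im (omega a x 0 i 0)) rad a0 (2 * N + 3) (2 * N + 1)
   (fun r => complex.Im (V r i 0)) rad_gt0 mK.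
have {}re i : (forall k, (k < 2 * N + 1)%N -> complex.Re (coefC y k i 0) = 0) /\
    complex.Re (coefC y (2 * N + 1) i 0) = complex.Re (omega a x 0 i 0).
  apply: re => [r r0 rr|].
    have /colP/(_ i) := residue_expansion ax r0 rr; rewrite -/(V r) [LHS]mxE summxE.
    move=> /(congr1 (@complex.Re R)); rewrite Re_M /= mul0r subr0 mulrC => ->.
    by rewrite Re_sum; apply: eq_bigr => k _; rewrite mxE Re_M /= mul0r subr0.
  have [lre _] := Vlim i; apply: cvg_trans lre; apply: near_eq_cvg.
  apply: near_at_right rad_gt0 _ => r r0 rr.
  by rewrite -/(V r) om // (BE _ _ i).1.
have {}im i : (forall k, (k < 2 * N + 1)%N -> complex.Im (coefC y k i 0) = 0) /\
    complex.Im (coefC y (2 * N + 1) i 0) = complex.Im (omega a x 0 i 0).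
  apply: im => [r r0 rr|].
    have /colP/(_ i) := residue_expansion ax r0 rr; rewrite -/(V r) [LHS]mxE summxE.
    move=> /(congr1 (@complex.Im R)); rewrite Im_M /= mul0r addr0 mulrC => ->.
    by rewrite Im_sum; apply: eq_bigr => k _; rewrite mxE Im_M /= mul0r addr0.
  have [_ lim] := Vlim i; apply: cvg_trans lim; apply: near_eq_cvg.
  apply: near_at_right rad_gt0 _ => r r0 rr.
  by rewrite -/(V r) om // (BE _ _ i).2.
split=> [k kN|]; apply/colP => i; apply: complex_eq.
- by rewrite (re i).1 // mxE.
- by rewrite (im i).1 // mxE.
- by rewrite (re i).2.
- by rewrite (im i).2.
Qed.

Variable Psi : spinor_family M D.
Hypothesis Psi_smooth : is_smooth_eigenspinor Gamma sg Psi.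
Hypothesis theta0 : forall x, dom M a x -> theta 0%N a x 0 = Psi a x.
Notation psi0 := (fun y => Psi a (param M a y)).
Notation aC := (toC a0).
Notation nuC := (n%:R / 2%:R : R[i]).
Notation p_ := (solution_poly aC nuC N).
Notation q_ := (residue_poly aC nuC N).
Notation indicialC := (indicial R[i] N).

Definition eigen_sign j : R[i] := (-1) ^+ j * signC R sg.

Lemma eigen_sign2 j : eigen_sign j * eigen_sign j = 1.
Proof. by rewrite /eigen_sign /signC mulrACA -!expr2 !sqrr_sign mulr1. Qed.

Lemma psi0_smooth : vsmooth_on U psi0.
Proof. by case: Psi_smooth => [[_ +] _]; exact. Qed.

Let oU : open U. Proof. exact: open_chart. Qed.
Let Ls := @chart_dirac_smooth R n d D eps gamma M eps2 a boundary_clifford.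
Let Lx := @chart_dirac_ext R n d D eps gamma M a boundary_clifford.
Let LD := @chart_diracD R n d D eps gamma M a boundary_clifford.
Let LZ := @chart_diracZ R n d D eps gamma M a boundary_clifford.

Definition solved j := forall y, U y ->
  t j y = pact L (p_ j) psi0 y /\ GR *m t j y = (eigen_sign j * 'i%C) *: t j y.

Lemma solved_smooth j : solved j -> vsmooth_on U (t j).
Proof.
move=> sj; apply: (vsmooth_on_ext oU (f := pact L (p_ j) psi0)).
  by move=> y /sj[].
apply: pact_smooth => //; exact: psi0_smooth.
Qed.

Lemma indicialE j : toC (lam + j%:R) - (-1) ^+ j * toC lam = indicialC j.
Proof.
rewrite /indicial /lambda toCD toC_nat toCN toCM toCV !toC_nat -signr_odd.
case: odd; last by rewrite expr0; ring.
by rewrite expr1; field.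
Qed.

Lemma step_rhs k : (k <= 2 * N)%N -> solved k -> ((0 < k)%N -> solved k.-1) ->
  forall y, U y ->
  coefB y k + (if (0 < k)%N then coefE y k.-1 else 0)
    = (eigen_sign k.+1 * 'i%C) *: pact L (q_ k.+1) psi0 y /\
  GR *m pact L (q_ k.+1) psi0 y = (eigen_sign k.+1 * 'i%C) *: pact L (q_ k.+1) psi0 y.
Proof.
move=> kN sk sk1 y Uy.
have sp := psi0_smooth; have st := solved_smooth sk.
have m1 : -1 * -1 = 1 :> R[i] by rewrite mulrNN mulr1.
have GRB : coefB y k = (eigen_sign k.+1 * 'i%C) *: L (t k) y.
  rewrite /coefB (local_dirac_intertwine h e eps m1 GR_boundary_clifford); last first.
    exact: vsmooth_on_vdifferentiable Uy.
  have -> : L (fun z => GR *m t k z) y = L (fun z => (eigen_sign k * 'i%C) *: t k z) y.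
    apply: Lx => // [|z /sk[]//].
    apply: (vsmooth_on_ext oU (f := fun z => (eigen_sign k * 'i%C) *: t k z)).
      by move=> z /sk[].
    exact: vsmooth_onZl.
  by rewrite LZ // scalerA /eigen_sign exprS; congr (_ *: _); ring.
have LE : L (t k) y = pact L ('X * p_ k) psi0 y.
  rewrite (pactX oU Ls LD LZ (p_ k) Uy sp).
  exact: (Lx st (fun z Uz => (sk z Uz).1) Uy).
have qE : pact L (q_ k.+1) psi0 y = L (t k) y + (if (0 < k)%N
    then (aC * (2%:R * nuC + indicialC k.+1 - 2%:R)) *: t k.-1 y else 0).
  rewrite /residue_poly pactD LE ltnS; congr (_ + _).
  case: (posnP k) => [k0|k_gt0]; first by rewrite -[0 in LHS]polyC0 pactC scale0r.
  by rewrite pactZ; have [-> _] := sk1 k_gt0 y Uy.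
have GRE : (0 < k)%N -> GR *m t k.-1 y = (eigen_sign k.+1 * 'i%C) *: t k.-1 y.
  move=> k0; have [_ ->] := sk1 k0 y Uy; congr (_ * _ *: _).
  by rewrite /eigen_sign -[in RHS](prednK k0) !exprS !mulN1r opprK.
split.
  rewrite qE scalerDr GRB; congr (_ + _); case: (posnP k) => [|k0]; first by rewrite scaler0.
  rewrite /coefE /coefA GRE // scalerBr !scalerA -scalerBl -scalerDl; congr (_ *: _).
  have sE : signC R sg = (-1) ^+ k.+1 * eigen_sign k.+1.
    by rewrite /eigen_sign mulrA -expr2 sqrr_sign mul1r.
  rewrite sE -indicialE toCD toC_nat toCM toC_nat.
  have kE : k.+1%:R = k.-1%:R + 2%:R :> R.
    by rewrite -[in LHS](prednK k0) -!natr1; ring.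
  rewrite kE !toCD !toC_nat.
  by field; rewrite pnatr_eq0 -lt0n.
rewrite qE mulmxDr scalerDr -GRB; congr (_ + _).
case: (posnP k) => [|k0]; first by rewrite mulmx0 scaler0.
by rewrite -scalemxAr GRE // !scalerA mulrC.
Qed.

Lemma coefC_mid y k : (0 < k <= 2 * N)%N ->
  coefC y k = coefA y k - (coefB y k.-1 + (if (1 < k)%N then coefE y k.-2 else 0)).
Proof.
move=> /andP[k0 kN]; rewrite /coefC /shifted.
have -> : (0 <= k < 0 + (2 * N + 1))%N by lia.
have -> : (1 <= k < 1 + (2 * N + 1))%N by lia.
have -> : (2 <= k < 2 + (2 * N + 1))%N = (1 < k)%N by lia.
by rewrite subn0 subn1 subn2 opprD addrA.
Qed.

Lemma coefC_last y :
  coefC y (2 * N + 1)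
  = - (coefB y (2 * N) + (if (0 < 2 * N)%N then coefE y (2 * N).-1 else 0)).
Proof.
rewrite /coefC /shifted.
have -> : (0 <= 2 * N + 1 < 0 + (2 * N + 1))%N = false by lia.
have -> : (1 <= 2 * N + 1 < 1 + (2 * N + 1))%N by lia.
have -> : (2 <= 2 * N + 1 < 2 + (2 * N + 1))%N = (0 < 2 * N)%N by lia.
by rewrite addn1 subn1 subn2 sub0r opprD.
Qed.

Lemma all_solved j : (j <= 2 * N)%N -> solved j.
Proof.
elim/ltn_ind: j => -[_ _ _ [x ax <-]|k IH kN y Uy].
  rewrite /boundary_coef coordK // theta0 // -[p_ 0%N]/(1 : {poly _}) -polyC1 pactC scale1r coordK //.
  split=> //; rewrite /eigen_sign expr0 mul1r.
  by case: Psi_smooth => _; apply.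
have sk : solved k by apply: IH => //; exact: ltnW.
have sk1 : (0 < k)%N -> solved k.-1.
  by move=> k0; apply: IH; rewrite ?ltnS ?leq_pred // (leq_trans (leq_pred _)) // ltnW.
have [rhs Gq] := step_rhs (ltnW kN) sk sk1 Uy.
have [x ax yE] := Uy.
have := (coefC_eqs ax).1 k.+1; rewrite addn1 ltnS => /(_ kN); rewrite yE.
rewrite coefC_mid // ltnS /= rhs => /eqP; rewrite subr_eq0 => /eqP.
rewrite /coefA -[_ * 'i%C * toC lam]mulrA [signC R sg * _]mulrCA => e1.
have ab : toC (lam + k.+1%:R) ^+ 2 != (signC R sg * toC lam) ^+ 2.
  rewrite exprMn /signC sqrr_sign mul1r -subr_eq0 !expr2 -!toCM -toCN -toCD toC_eq0.
  have -> : (lam + k.+1%:R) * (lam + k.+1%:R) - lam * lam = k.+1%:R * (k.+1%:R - (2 * N + 1)%:R).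
    by rewrite /lambda; field.
  rewrite mulf_neq0 ?pnatr_eq0 // subr_eq0 eqr_nat ltn_eqF //.
  by rewrite addn1 ltnS.
have [tE ->] := eigen_step GR2 (eigen_sign2 k.+1) ab e1 Gq; split=> //.
move: tE; rewrite /eigen_sign mulrA -[_ * _ * signC R sg]mulrA -expr2 sqrr_sign mulr1 indicialE => tE.
by rewrite solution_polyS pactZ -tE scalerA mulVf ?scale1r // indicial_neq0.
Qed.

Lemma omega_residue x : dom M a x ->
  omega a x 0 = (signC R sg * 'i%C) *: pact L (q_ (2 * N + 1)) psi0 (Defs.coord M a x).
Proof.
move=> ax; set y := Defs.coord M a x; have Uy : U y by exists x.
rewrite -(coefC_eqs ax).2 coefC_last.
have [-> _] := step_rhs (leqnn _) (all_solved (leqnn _))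
  (fun _ => all_solved (leq_pred _)) Uy.
rewrite (addn1 (2 * N)) -scaleNr /eigen_sign exprS exprM sqrrN !expr1n mulr1.
by rewrite mulN1r mulNr opprK.
Qed.

Lemma omega_eigen x : dom M a x -> GR *m omega a x 0 = - (signC R sg * 'i%C) *: omega a x 0.
Proof.
move=> ax; rewrite omega_residue //; set y := Defs.coord M a x; have Uy : U y by exists x.
have [_ E] := step_rhs (leqnn _) (all_solved (leqnn _)) (fun _ => all_solved (leq_pred _)) Uy.
rewrite -scalemxAr (addn1 (2 * N)) E !scalerA mulrC; congr (_ * _ *: _).
by rewrite /eigen_sign exprS exprM sqrrN !expr1n mulr1 mulN1r mulNr.
Qed.

End Recursion.

(** * Test spinors and the normalizing constants *)

Section Flat.
Variable R : realType.
Implicit Types (p : {poly R}) (x : R).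

(* Differentiation maps [flat p] to some [flat q], so these functions are smooth. *)
Definition flat p x : R := if 0 < x then p.[x^-1] * expR (- x^-1) else 0.

Lemma flat_bound p : exists2 C, 0 <= C & forall x, 0 < x -> `|flat p x| <= C * x.
Proof.
exists (\sum_(i < size p) `|p`_i| * (i.+1)`!%:R).
  by apply: sumr_ge0 => i _; rewrite mulr_ge0.
move=> x x0; rewrite /flat x0 horner_coef mulr_suml.
apply: le_trans (ler_norm_sum _ _ _) _; rewrite mulr_suml; apply: ler_sum => i _.
have u0 : 0 < x^-1 by rewrite invr_gt0.
rewrite !normrM -!mulrA; apply: ler_wpM2l => //.
have ui0 : 0 <= x^-1 ^+ i by rewrite exprn_ge0 // ltW.
rewrite (ger0_norm (expR_ge0 _)) (ger0_norm ui0).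
have := expR_ge1Dxn i (ltW u0); set f := (i.+1)`!%:R => h.
have f0 : 0 < f :> R by rewrite ltr0n fact_gt0.
rewrite expRN ler_pdivrMr ?expR_gt0 // -mulrA -ler_pdivrMl //.
rewrite -ler_pdivrMl //; apply: le_trans h.
have -> : x^-1 * (f^-1 * x^-1 ^+ i) = x^-1 ^+ i.+1 / f by rewrite exprS; ring.
by rewrite lerDr.
Qed.

Lemma flat_pos p x : 0 < x -> is_derive x (1 : R)
  (fun t : R => p.[t^-1] * expR (- t^-1)) (flat ('X^2 * (p - p^`())) x).
Proof.
move=> x0; have xn0 : x != 0 by rewrite gt_eqF.
have dV : is_derive x (1 : R) (fun t : R => t^-1) (- x ^- 2 *: 1) by exact: is_deriveV.
have d1 : is_derive x (1 : R) (fun t : R => p.[t^-1]) (p^`().[x^-1] * (- x ^- 2 *: 1)).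
  exact: (@is_derive1_comp _ (horner p) (fun t => t^-1)).
have d2 : is_derive x (1 : R) (fun t : R => expR (- t^-1)) (expR (- x^-1) * - (- x ^- 2 *: 1)).
  apply: (@is_derive1_comp _ expR (fun t => - t^-1)).
rewrite /flat x0; apply: is_derive_eq.
rewrite /GRing.scale /= hornerM hornerXn hornerD hornerN exprVn; ring.
Qed.

Lemma is_derive_flat p x : is_derive x (1 : R) (flat p) (flat ('X^2 * (p - p^`())) x).
Proof.
have [x0|x0|->] := ltgtP x 0.
- rewrite /flat [in X in is_derive _ _ _ X]ltNge (ltW x0) /=.
  apply: (@near_eq_is_derive _ _ _ (fun=> 0)).
  by near=> t; rewrite ltNge ltW //; near: t; exact: lt_nbhsl.
- apply: near_eq_is_derive (flat_pos p x0).
  by near=> t; rewrite /flat ifT //; near: t; exact: lt_nbhsr.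
have -> : flat ('X^2 * (p - p^`())) 0 = 0 by rewrite /flat ltxx.
have lim0 : (fun h : R => h^-1 *: ((flat p \o shift 0) (h *: 1) - flat p 0)) @ 0^' --> (0 : R).
  have [C C0 HC] := flat_bound ('X * p).
  apply/cvgrPdist_le => /= eps eps0.
  have d0 : 0 < eps / (C + 1) by rewrite divr_gt0 // ltr_wpDl.
  near=> h.
  have h0 : h != 0 by near: h; exact: nbhs_dnbhs_neq.
  rewrite /flat ltxx subr0 sub0r normrN addr0 /GRing.scale /= mulr1.
  case: ifP => hpos; last by rewrite mulr0 normr0 ltW.
  have -> : h^-1 * (p.[h^-1] * expR (- h^-1)) = flat ('X * p) h.
    by rewrite /flat hpos hornerM hornerX mulrA.
  apply: le_trans (HC h hpos) _.
  have hC : h < eps / (C + 1).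
    by apply: le_lt_trans (ler_norm h) _; near: h; exact: dnbhs0_lt.
  apply: (@le_trans _ _ ((C + 1) * h)); first by rewrite ler_pM2r // lerDl.
  by rewrite mulrC -ler_pdivlMr ?ltr_wpDl // ltW.
by split; [apply/cvg_ex; exists 0 | exact/cvg_lim].
Unshelve. all: by end_near. Qed.

End Flat.

Section VanishingOrder.
Variables (R : realType) (m d : nat) (U : set 'rV[R]_m).
Hypothesis oU : open U.
Variable f : 'rV[R]_m -> R[i].
Hypothesis sf : csmooth_on U f.
Implicit Types (F G : 'rV[R]_m -> 'cV[R[i]]_d).

Lemma csmooth_onX k : csmooth_on U (fun y => f y ^+ k).
Proof.
elim: k => [|k IH]; first exact: csmooth_on_cst.
by apply: csmooth_on_ext (csmooth_onM oU sf IH) => // y _; rewrite exprS.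
Qed.

Lemma cderiveX k y v : U y -> cderive (fun z => f z ^+ k.+1) y v
  = k.+1%:R * f y ^+ k * cderive f y v.
Proof.
move=> Uy; have df := csmooth_on_cdifferentiable sf Uy.
elim: k => [|k IH]; first by rewrite expr0 !mul1r.
have -> : (fun z => f z ^+ k.+2) = (fun z => f z * f z ^+ k.+1).
  by apply/funext => z; rewrite exprS.
rewrite cderiveM //; last exact: csmooth_on_cdifferentiable (csmooth_onX _) Uy.
by rewrite IH !exprS -(natr1 k.+1); ring.
Qed.

Lemma vderive_smooth F i : vsmooth_on U F -> vsmooth_on U (fun y => vderive F y (delta_mx 0 i)).
Proof.
move=> sF j; have := csmooth_on_partial i (sF j).
by apply: csmooth_on_ext => // y _; rewrite vderiveE.
Qed.

Lemma partials_vanish k F G w : vsmooth_on U G ->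
  (forall y, U y -> F y = f y ^+ k *: G y) -> (size w <= k)%N ->
  exists2 G', vsmooth_on U G' &
    forall y, U y -> partials w F y = f y ^+ (k - size w) *: G' y.
Proof.
move=> sG FG; elim: w => [|i w IH] /= wk; first by exists G; rewrite ?subn0.
have [G' sG' E] := IH (ltnW wk); set l := (k - (size w).+1)%N.
have lE : (k - size w)%N = l.+1 by rewrite /l; lia.
exists (fun y => (l.+1%:R * cderive f y (delta_mx 0 i)) *: G' y + f y *: vderive G' y (delta_mx 0 i)).
  apply: vsmooth_onD => //; apply: vsmooth_onZ => //; last exact: vderive_smooth.
  by apply: csmooth_onM => //; [exact: csmooth_on_cst | exact: csmooth_on_partial].
move=> y Uy; rewrite (near_eq_vderive _ (open_near_eq oU Uy E)) lE.
rewrite vderiveZ; last exact: vsmooth_on_vdifferentiable Uy.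
  rewrite cderiveX // scalerDr !scalerA exprS; congr (_ *: _ + _ *: _); ring.
exact: csmooth_on_cdifferentiable (csmooth_onX _) Uy.
Qed.

Variables (P : 'I_m -> 'rV[R]_m -> 'M[R[i]]_d) (Q : 'rV[R]_m -> 'M[R[i]]_d).
Hypothesis sP : forall k, msmooth_on U (P k).
Hypothesis sQ : msmooth_on U Q.
Variable L : ('rV[R]_m -> 'cV[R[i]]_d) -> 'rV[R]_m -> 'cV[R[i]]_d.
Hypothesis LE : forall F y, U y -> vdifferentiable F y -> L F y = first_order P Q F y.
Variable y0 : 'rV[R]_m.
Hypothesis f0 : f y0 = 0.

Definition symbol_at y : 'M[R[i]]_d := \sum_k cderive f y (delta_mx 0 k) *: P k y.

Lemma mulmx_smooth p q (X : 'rV[R]_m -> 'M[R[i]]_(p, q)) (F : 'rV[R]_m -> 'cV[R[i]]_q) :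
  msmooth_on U X -> vsmooth_on U F -> vsmooth_on U (fun y => X y *m F y).
Proof.
move=> sX sF i.
apply: (@csmooth_on_ext _ _ _ oU (fun y => \sum_j X y i j * F y j 0)).
  by move=> y _; rewrite mxE.
by apply: csmooth_on_sum => // j _; apply: csmooth_onM => //; exact: sX.
Qed.

(* At a zero [y0] of [f] only the derivatives falling on [f] contribute: [k] steps
   of [L] on [f ^+ n *: G] leave [f ^+ (n - k)] times a power of the symbol. *)
Lemma iter_vanish n F G k : vsmooth_on U G ->
  (forall y, U y -> F y = f y ^+ n *: G y) -> (k <= n)%N ->
  exists G', [/\ vsmooth_on U G',
    forall y, U y -> iter k L F y = f y ^+ (n - k) *: G' y
    & G' y0 = (n ^_ k)%:R *: iter k (mulmx (symbol_at y0)) (G y0)].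
Proof.
move=> sG FG; elim: k => [|k IH] kn.
  by exists G; split; rewrite ?subn0 // ffactn0 scale1r.
have [G' [sG' E G'0]] := IH (ltnW kn); set l := (n - k.+1)%N.
have lE : (n - k)%N = l.+1 by rewrite /l; lia.
have s_symbol : msmooth_on U symbol_at.
  move=> i j; apply: (@csmooth_on_ext _ _ _ oU (fun y => \sum_k cderive f y (delta_mx 0 k) * P k y i j)).
    by move=> y _; rewrite summxE; apply: eq_bigr => b _; rewrite mxE.
  apply: csmooth_on_sum => // b _; apply: csmooth_onM => //; last exact: sP.
  exact: csmooth_on_partial.
exists (fun y => l.+1%:R *: (symbol_at y *m G' y) + f y *: first_order P Q G' y); split.
- apply: vsmooth_onD => //; first by apply: vsmooth_onZl => //; exact: mulmx_smooth.
  by apply: vsmooth_onZ => //; exact: first_order_smooth.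
- move=> y Uy /=.
  have dG' := vsmooth_on_vdifferentiable sG' Uy.
  have near_E := open_near_eq oU Uy E.
  have dfG : vdifferentiable (fun z => f z ^+ l.+1 *: G' z) y.
    by apply: vdifferentiableZ => //; exact: csmooth_on_cdifferentiable (csmooth_onX _) Uy.
  rewrite lE in near_E.
  rewrite LE //; last by apply: near_eq_vdifferentiable dfG; apply: filterS near_E => z ->.
  rewrite (first_order_ext _ _ near_E) first_orderZ //; last exact: csmooth_on_cdifferentiable (csmooth_onX _) Uy.
  have -> : \sum_b cderive (fun z => f z ^+ l.+1) y (delta_mx 0 b) *: P b y
      = (l.+1%:R * f y ^+ l) *: symbol_at y.
    by rewrite scaler_sumr; apply: eq_bigr => b _; rewrite cderiveX // scalerA.
  rewrite -scalemxAl [RHS]scalerDr [X in _ = X + _]scalerA [X in _ = _ + X]scalerA exprSr.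
  by congr (_ *: _ + _ *: _); ring.
rewrite f0 scale0r addr0 G'0 -scalemxAr scalerA -natrM; congr (_%:R *: _).
by rewrite ffactnSr lE mulnC.
Qed.

End VanishingOrder.

Section CliffordWords.
Variables (R : realType) (n : nat).

Lemma clifford_mul_sq d (eps : 'I_n -> R) (cl : 'I_n -> 'M[R[i]]_d) (v : 'rV[R]_n) :
  (forall i j, cl i *m cl j + cl j *m cl i
     = (if i == j then - 2%:R * toC (eps i) else 0)%:M) ->
  clifford_mul cl v *m clifford_mul cl v = (- toC (\sum_i eps i * v 0 i ^+ 2))%:M.
Proof.
move=> rel; have two : 2%:R != 0 :> R[i] by rewrite pnatr_eq0.
apply: (scalerI two); rewrite scaler_nat mulr2n.
have E : clifford_mul cl v *m clifford_mul cl v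
    = \sum_i \sum_j (toC (v 0 i) * toC (v 0 j)) *: (cl i *m cl j).
  rewrite /clifford_mul mulmx_suml; apply: eq_bigr => i _.
  rewrite mulmx_sumr; apply: eq_bigr => j _.
  by rewrite -scalemxAl -scalemxAr scalerA.
rewrite {1}E {1}exchange_big /= E -big_split /=.
transitivity (\sum_i ((- 2%:R * toC (eps i * v 0 i ^+ 2))%:M : 'M[R[i]]_d)).
  apply: eq_bigr => i _; rewrite -big_split /= (bigD1 i) //= big1 ?addr0 => [|j ji].
    rewrite -scalerDr rel eqxx scale_scalar_mx; congr (_%:M).
    by rewrite !toCM; ring.
  by rewrite [toC (v 0 j) * _]mulrC -scalerDr rel (negbTE ji) scale_scalar_mx mulr0 raddf0.
rewrite -raddf_sum scale_scalar_mx; congr (_%:M).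
rewrite -mulr_sumr mulrN -mulNr; congr (_ * _).
by apply/esym; apply: (big_morph (@toC R) (@toCD R) (@toC0 R)).
Qed.

Lemma spin_action_intertwine d d' (cl : 'I_n -> 'M[R[i]]_d) (cl' : 'I_n -> 'M[R[i]]_d')
    (s : R[i]) (X : 'M[R[i]]_(d, d')) w :
  (forall i, cl i *m X = s *: (X *m cl' i)) ->
  spin_action cl w *m X = s ^+ size w *: (X *m spin_action cl' w).
Proof.
move=> clX; elim: w => [|v w IH] /=; first by rewrite mul1mx mulmx1 scale1r.
have vX : clifford_mul cl v *m X = s *: (X *m clifford_mul cl' v).
  rewrite /clifford_mul mulmx_suml mulmx_sumr scaler_sumr; apply: eq_bigr => i _.
  by rewrite -scalemxAl clX -scalemxAr !scalerA mulrC.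
rewrite -mulmxA IH -scalemxAr (mulmxA (clifford_mul cl v)) vX -scalemxAl scalerA exprSr.
by rewrite -mulmxA.
Qed.

Lemma spin_action_even_eq d (cl cl' : 'I_n -> 'M[R[i]]_d) w :
  (forall i j, cl i *m cl j = cl' i *m cl' j) -> ~~ odd (size w) ->
  spin_action cl w = spin_action cl' w.
Proof.
move=> cc; have [k] := ubnP (size w); elim: k w => // k IH [|u [|v w]] //=.
move=> wk; rewrite negbK => ow; rewrite (IH w) //; last by lia.
rewrite !mulmxA; congr (_ *m _); rewrite /clifford_mul !mulmx_suml.
apply: eq_bigr => i _; rewrite !mulmx_sumr; apply: eq_bigr => j _.
by rewrite -!scalemxAl -!scalemxAr cc.
Qed.

Lemma spin_action_unit d (eps : 'I_n -> R) (cl : 'I_n -> 'M[R[i]]_d) w :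
  (forall i j, cl i *m cl j + cl j *m cl i
     = (if i == j then - 2%:R * toC (eps i) else 0)%:M) ->
  spin_word eps w -> spin_action cl w \in unitmx.
Proof.
move=> rel [_]; elim: w => [|v w IH] vw /=; first exact: unitmx1.
rewrite unitmx_mul IH; last by move=> u uw; apply: vw; rewrite inE uw orbT.
rewrite andbT; have q1 := vw v (mem_head _ _).
have := clifford_mul_sq v rel; set q := \sum_i _ => sq.
have q0 : - toC q != 0.
  rewrite oppr_eq0 toC_eq0 /q.
  by case: q1 => ->; rewrite ?oppr_eq0 oner_eq0.
have uq : (- toC q)%:M \in @unitmx R[i] d.
  by rewrite unitmxE det_scalar unitfE expf_neq0.
by move: uq; rewrite -sq unitmx_mul => /andP[].
Qed.

End CliffordWords.

Lemma Ck_on_local (R : realType) m k (U : set 'rV[R]_m) f :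
  (forall y, U y -> exists2 V, V y & Ck_on k V f) -> Ck_on k U f.
Proof.
elim: k f => [|k IH] f loc /=; first by move=> y /loc[V Vy cf]; exact: cf.
split=> [y /loc[V Vy [df _]]|i]; first exact: df.
by apply: IH => y /loc[V Vy [_ cf]]; exists V => //; exact: cf.
Qed.

Lemma vsmooth_on_local (R : realType) m d (U : set 'rV[R]_m) (f : _ -> 'cV[R[i]]_d) :
  (forall y, U y -> exists2 V, V y & vsmooth_on V f) -> vsmooth_on U f.
Proof.
move=> loc i; split=> k; apply: Ck_on_local => y /loc[V Vy /(_ i)[f1 f2]].
  by exists V => //; exact: f1.
by exists V => //; exact: f2.
Qed.

Section BoxBump.
Variables (R : realType) (n : nat) (y0 xi : 'rV[R]_n) (rho : R) (K : nat).
Hypothesis rho0 : 0 < rho.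

Definition linear_part (u : 'rV[R]_n) : R := \sum_k (u 0 k - y0 0 k) * xi 0 k.
Definition box_bump (u : 'rV[R]_n) : R := flat 1 (rho ^+ 2 - \sum_k (u 0 k - y0 0 k) ^+ 2).
Definition bump_jet (u : 'rV[R]_n) : R := linear_part u ^+ K * box_bump u.

Definition box : set 'rV[R]_n := [set u | forall k, `[y0 0 k - rho, y0 0 k + rho]%classic (u 0 k)].

Lemma box_compact : compact box.
Proof.
apply: (@rV_compact R n (fun k => `[y0 0 k - rho, y0 0 k + rho]%classic)) => k.
exact: segment_compact.
Qed.

Lemma bump_center : 0 < box_bump y0.
Proof.
rewrite /box_bump big1 => [|k _]; last by rewrite subrr expr0n.
by rewrite subr0 /flat exprn_gt0 // hornerC mul1r expR_gt0.
Qed.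

Lemma bump_jet_support u : ~ box u -> bump_jet u = 0.
Proof.
move=> nb; rewrite /bump_jet /box_bump /flat; case: ifP; rewrite ?mulr0 // subr_gt0 => lt_rho.
exfalso; apply: nb => k; rewrite /= in_itv /= -ler_distlC distrC.
rewrite -(ler_pXn2r (n := 2)) ?nnegrE // ?(ltW rho0) // real_normK ?num_real //.
apply: ltW; apply: le_lt_trans lt_rho; rewrite (bigD1 k) //= lerDl.
by apply: sumr_ge0 => j _; rewrite sqr_ge0.
Qed.

Section Compose.
Variables (m : nat) (V : set 'rV[R]_m) (Phi : 'rV[R]_m -> 'rV[R]_n).
Hypothesis oV : open V.
Hypothesis sPhi : forall k, smooth_on V (fun y => Phi y 0 k).

Lemma smooth_on_linear_part : smooth_on V (fun y => linear_part (Phi y)).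
Proof.
apply: smooth_on_sum => // k _; apply: smooth_onM => //; last exact: smooth_on_cst.
by apply: smooth_onB => //; exact: smooth_on_cst.
Qed.

Lemma smooth_on_bump : smooth_on V (fun y => box_bump (Phi y)).
Proof.
pose p k := iter k (fun q : {poly R} => 'X^2 * (q - q^`())) 1.
apply: (@smooth_on_comp1 _ _ _ oV (fun k => flat (p k))).
  by move=> k x; exact: is_derive_flat.
apply: smooth_onB => //; first exact: smooth_on_cst.
apply: smooth_on_sum => // k _; apply: smooth_onX => //.
by apply: smooth_onB => //; exact: smooth_on_cst.
Qed.

Lemma smooth_on_bump_jet : smooth_on V (fun y => bump_jet (Phi y)).
Proof.
apply: smooth_onM => //; last exact: smooth_on_bump.
by apply: smooth_onX => //; exact: smooth_on_linear_part.
Qed.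
End Compose.
End BoxBump.

Lemma exists_box (R : realType) n (U : set 'rV[R]_n) y0 : open U -> U y0 ->
  exists2 rho, 0 < rho & box y0 rho `<=` U.
Proof.
move=> oU Uy0; have : nbhs y0 U by exact: open_nbhs_nbhs.
move=> /nbhs_ballP[e /= e0 eU]; exists (e / 2); first by rewrite divr_gt0.
move=> u bu; apply: eU; split=> // i j; rewrite (ord1 i).
have := bu j; rewrite /= in_itv /= -ler_distlC => H.
change (`|y0 0 j - u 0 j| < e); apply: le_lt_trans H _.
by rewrite ltr_pdivrMr // ltr_pMr // ltr1n.
Qed.

Section TestSpinors.
Variables (R : realType) (n d D : nat) (eps : 'I_n -> R).
Variables (gamma : 'I_n -> 'M[R[i]]_d) (M : spin_manifold eps gamma).
Variable Gamma : 'I_(n + 1) -> 'M[R[i]]_D.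
Notation GR := (GammaR Gamma).
Notation G := (boundary_clifford Gamma).
Hypothesis rel_gamma : forall i j, gamma i *m gamma j + gamma j *m gamma i
     = (if i == j then - 2%:R * toC (eps i) else 0)%:M.
Hypothesis GR2 : GR *m GR = - 1%:M.
Hypothesis GRanti : forall i, GR *m GammaT Gamma i = - (GammaT Gamma i *m GR).
Variables (A A' : 'M[R[i]]_(d, D)) (B B' : 'M[R[i]]_(D, d)).
Hypothesis BA : B *m A + B' *m A' = 1%:M.
Hypothesis GB : forall i, G i *m B = B *m gamma i.
Hypothesis GB' : forall i, G i *m B' = - (B' *m gamma i).

Lemma GR_G i : G i *m GR = (-1) *: (GR *m G i).
Proof. by rewrite (GR_boundary_clifford GRanti) scalerA mulrNN mulr1 scale1r. Qed.

Lemma lift_G w : ~~ odd (size w) -> spin_action (GammaT Gamma) w = spin_action G w.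
Proof. by apply: spin_action_even_eq => i j; rewrite (boundary_clifford2 GR2 GRanti). Qed.

Lemma lift_B w : ~~ odd (size w) ->
  spin_action (GammaT Gamma) w *m B = B *m spin_action gamma w /\
  spin_action (GammaT Gamma) w *m B' = B' *m spin_action gamma w.
Proof.
move=> ew; rewrite lift_G //; split.
  rewrite (@spin_action_intertwine _ _ _ _ _ gamma 1) ?expr1n ?scale1r // => i.
  by rewrite scale1r.
have s1 : (-1) ^+ size w = 1 :> R[i] by rewrite -signr_odd (negbTE ew).
rewrite (@spin_action_intertwine _ _ _ _ _ gamma (-1)) ?s1 ?scale1r // => i.
by rewrite scaleN1r GB'.
Qed.

(* Even Clifford words on [S(X)] restricted to the boundary are determined by those
   on [S(M)]: this transfers the cocycle condition and smoothness of the lifts. *)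
Lemma lift_split w : ~~ odd (size w) ->
  spin_action (GammaT Gamma) w = B *m spin_action gamma w *m A + B' *m spin_action gamma w *m A'.
Proof.
move=> ew; have [<- <-] := lift_B ew.
by rewrite -!mulmxA -mulmxDr BA mulmx1.
Qed.

Lemma lift_GR w : ~~ odd (size w) ->
  spin_action (GammaT Gamma) w *m GR = GR *m spin_action (GammaT Gamma) w.
Proof.
move=> ew; have s1 : (-1) ^+ size w = 1 :> R[i] by rewrite -signr_odd (negbTE ew).
rewrite lift_G // (@spin_action_intertwine _ _ _ _ _ G (-1)) ?s1 ?scale1r //.
exact: GR_G.
Qed.

Lemma lift_even a b x : dom M a x -> dom M b x -> ~~ odd (size (spin_lift M a b x)).
Proof. by move=> ax bx; case: (lift_spin ax bx). Qed.

Notation P_ a b x := (spin_action (GammaT Gamma) (spin_lift M a b x)).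

Lemma lift_cocycleX a b c x : dom M a x -> dom M b x -> dom M c x ->
  P_ a b x *m P_ b c x = P_ a c x.
Proof.
move=> ax bx cx; rewrite (lift_split (lift_even bx cx)) mulmxDr !mulmxA.
have [-> ->] := lift_B (lift_even ax bx).
rewrite -(mulmxA B) -(mulmxA B') (lift_cocycle ax bx cx).
by rewrite -(lift_split (lift_even ax cx)).
Qed.

Lemma lift_selfX a x : dom M a x -> P_ a a x = 1%:M.
Proof.
move=> ax; have S1 : spin_action gamma (spin_lift M a a x) = 1%:M.
  have uS := spin_action_unit rel_gamma (lift_spin ax ax).
  by rewrite -[LHS](mulKmx uS) (lift_cocycle ax ax ax) mulVmx.
by rewrite (lift_split (lift_even ax ax)) S1 !mulmx1.
Qed.

Lemma param_dom b y : (Defs.coord M b @` dom M b) y -> dom M b (param M b y).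
Proof. by move=> [x bx <-]; rewrite coordK. Qed.

Lemma coord_param b y : (Defs.coord M b @` dom M b) y -> Defs.coord M b (param M b y) = y.
Proof. by move=> [x bx <-]; rewrite coordK. Qed.

Lemma param_nbhs b y (W : set M) : (Defs.coord M b @` dom M b) y ->
  nbhs (param M b y) W -> nbhs y [set z | W (param M b z)].
Proof.
move=> [x bx <-]; rewrite coordK // => xW.
by have := param_continuous bx; rewrite /prop_for /continuous_at coordK //; apply.
Qed.

Lemma overlap_open b c : open (Defs.coord M b @` (dom M b `&` dom M c)).
Proof.
rewrite openE => _ [x [bx cx] <-]; rewrite /interior.
have Uy : (Defs.coord M b @` dom M b) (Defs.coord M b x) by exists x.
have n1 : nbhs (Defs.coord M b x) (Defs.coord M b @` dom M b).
  by apply: open_nbhs_nbhs; split => //; exact: image_open.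
have n2 : nbhs (Defs.coord M b x) [set z | dom M c (param M b z)].
  by apply: param_nbhs => //; rewrite coordK //; apply: open_nbhs_nbhs; split=> //; exact: dom_open.
apply: filterS (filterI n1 n2) => z [[x' bx' <-]] /=; rewrite coordK // => cx'.
by exists x'.
Qed.

Lemma lift_smoothX a b :
  msmooth_on (Defs.coord M a @` (dom M a `&` dom M b)) (fun y => P_ a b (param M a y)).
Proof.
pose V := Defs.coord M a @` (dom M a `&` dom M b).
have oV : open V by exact: overlap_open.
pose S y := spin_action gamma (spin_lift M a b (param M a y)).
have sS : msmooth_on V S by move=> i j; exact: lift_smooth.
have sXY p q p' q' (X : 'M[R[i]]_(p, q)) (F : _ -> 'M[R[i]]_(q, p')) (Y : 'M[R[i]]_(p', q')) :
    msmooth_on V F -> msmooth_on V (fun y => X *m F y *m Y).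
  move=> sF i j; apply: (@csmooth_on_ext _ _ _ oV (fun y => \sum_k (\sum_l X i l * F y l k) * Y k j)).
    by move=> y _; rewrite [RHS]mxE; apply: eq_bigr => k _; rewrite mxE.
  apply: csmooth_on_sum => // k _; apply: csmooth_onM => //; last exact: csmooth_on_cst.
  apply: csmooth_on_sum => // l _; apply: csmooth_onM => //.
  exact: csmooth_on_cst.
move=> i j; apply: (@csmooth_on_ext _ _ _ oV
    (fun y => (B *m S y *m A) i j + (B' *m S y *m A') i j)).
  move=> _ [x [ax bx] <-]; rewrite /S coordK // (lift_split (lift_even ax bx)).
  by rewrite [RHS]mxE.
by apply: csmooth_onD => //; exact: sXY.
Qed.

Variables (a : chart M) (x0 : M) (ax0 : dom M a x0).
Notation U := (Defs.coord M a @` dom M a).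
Notation y0 := (Defs.coord M a x0).
Variables (xi : 'rV[R]_n) (rho : R) (K : nat).
Hypothesis rho0 : 0 < rho.
Hypothesis boxU : box y0 rho `<=` U.
Variables (sg : bool) (v : 'cV[R[i]]_D).
Hypothesis v_eigen : in_eigenbundle Gamma sg v.
Notation T := (bump_jet y0 xi rho K).

Definition test_spinor : spinor_family M D := fun b x =>
  if pselect (dom M a x) then toC (T (Defs.coord M a x)) *: (P_ b a x *m v) else 0.

Definition support : set M := param M a @` box y0 rho.

(* Compactness alone would not make the extension by zero smooth: the support has to
   be closed in all of [M], which uses that [M] is Hausdorff. *)
Lemma support_closed : closed support.
Proof.
apply: compact_closed; first exact: hausdorffM.
apply: continuous_compact; last exact: box_compact.
apply: continuous_in_subspaceT => y /set_mem /boxU [x ax <-].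
exact: param_continuous.
Qed.

Lemma test_smooth : is_smooth_eigenspinor Gamma sg test_spinor.
Proof.
split; last first.
  move=> b x bx; rewrite /in_eigenbundle /test_spinor; case: pselect => [ax|nax]; last first.
    by rewrite mulmx0 scaler0.
  rewrite -scalemxAr mulmxA -(lift_GR (lift_even bx ax)) -mulmxA v_eigen -scalemxAr.
  by rewrite !scalerA mulrC.
split=> [b c x bx cx|b].
  rewrite /test_spinor; case: pselect => [ax|nax]; last by rewrite mulmx0.
  by rewrite -scalemxAr mulmxA lift_cocycleX.
apply: vsmooth_on_local => y Uy; set x := param M b y.
have bx : dom M b x by exact: param_dom.
have [ax|nax] := pselect (dom M a x).
  exists (Defs.coord M b @` (dom M b `&` dom M a)); first by exists x => //; exact: coord_param.
  have oV : open (Defs.coord M b @` (dom M b `&` dom M a)) by exact: overlap_open.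
  have sT : smooth_on (Defs.coord M b @` (dom M b `&` dom M a))
      (fun y => T (Defs.coord M a (param M b y))).
    apply: (smooth_on_bump_jet y0 xi rho K (Phi := fun y => Defs.coord M a (param M b y)) oV).
    by move=> k; rewrite setIC; exact: transition_smooth.
  apply: (vsmooth_on_ext oV (f := fun y => toC (T (Defs.coord M a (param M b y)))
      *: (P_ b a (param M b y) *m v))).
    move=> _ [x' [bx' ax'] <-]; rewrite coordK // /test_spinor.
    by case: pselect.
  apply: vsmooth_onZ => //; first exact: csmooth_on_toC.
  apply: mulmx_smooth => //; first exact: lift_smoothX.
  by move=> i; exact: csmooth_on_cst.
have nK : ~ support x.
  move=> [u bu ux]; apply: nax; rewrite -ux; exact: param_dom (boxU bu).
have nb : nbhs x (~` support).
  by apply: open_nbhs_nbhs; split => //; apply: closed_openC; exact: support_closed.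
have := param_nbhs Uy nb; rewrite nbhsE => -[V [oV Vy] VK].
exists V => //; apply: (vsmooth_on_ext oV (f := fun=> 0)); last exact: vsmooth_on0.
move=> z /VK /= nz; rewrite /test_spinor; case: pselect => // az.
rewrite bump_jet_support ?toC0 ?scale0r // => bz; apply: nz.
by exists (Defs.coord M a (param M b z)) => //; exact: coordK.
Qed.

End TestSpinors.

Lemma derive_linear_part (R : realType) n (y0 xi y v : 'rV[R]_n) :
  'D_v (linear_part y0 xi) y = \sum_k v 0 k * xi 0 k.
Proof.
have -> : linear_part y0 xi = \sum_k (fun u : 'rV[R]_n => xi 0 k * u 0 k) - cst (\sum_k y0 0 k * xi 0 k).
  apply/funext => u.
  transitivity (\sum_k xi 0 k * u 0 k - \sum_k y0 0 k * xi 0 k); last by rewrite fct_sumE.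
  by rewrite -sumrB; apply: eq_bigr => k _; ring.
have dc k : derivable (fun u : 'rV[R]_n => u 0 k) y v.
  by apply: diff_derivable; exact: differentiable_coord.
have dk k : derivable (fun u : 'rV[R]_n => xi 0 k * u 0 k) y v.
  by apply: derivableM => //; exact: derivable_cst.
rewrite deriveB; [|exact: derivable_sum|exact: derivable_cst].
rewrite derive_cst subr0 derive_sum //; apply: eq_bigr => k _.
by rewrite (deriveMl _ (dc k)) derive_coord mulrC.
Qed.

Lemma square_scalar_inj (F : fieldType) d (X : 'M[F]_d) c (u : 'cV[F]_d) :
  c != 0 -> X *m X = c%:M -> X *m u = 0 -> u = 0.
Proof.
move=> c0 XX Xu; apply: (scalerI c0).
by rewrite -mul_scalar_mx -XX -mulmxA Xu mulmx0 scaler0.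
Qed.

Section LeadingCoefficient.
Variables (R : realType) (n d D : nat) (eps : 'I_n -> R).
Variables (gamma : 'I_n -> 'M[R[i]]_d) (M : spin_manifold eps gamma).
Variable Gamma : 'I_(n + 1) -> 'M[R[i]]_D.
Hypothesis n_gt0 : (0 < n)%N.
Hypothesis D_gt0 : (0 < D)%N.
Hypothesis eps2 : forall i, eps i * eps i = 1.
Notation GR := (GammaR Gamma).
Notation G := (boundary_clifford Gamma).
Hypothesis rel_gamma : forall i j, gamma i *m gamma j + gamma j *m gamma i
     = (if i == j then - 2%:R * toC (eps i) else 0)%:M.
Hypothesis GR2 : GR *m GR = - 1%:M.
Hypothesis GRanti : forall i, GR *m GammaT Gamma i = - (GammaT Gamma i *m GR).
Hypothesis GammaT2 : forall i, GammaT Gamma i *m GammaT Gamma i = (- toC (eps i))%:M.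
Variables (A A' : 'M[R[i]]_(d, D)) (B B' : 'M[R[i]]_(D, d)).
Hypothesis BA : B *m A + B' *m A' = 1%:M.
Hypothesis GB : forall i, G i *m B = B *m gamma i.
Hypothesis GB' : forall i, G i *m B' = - (B' *m gamma i).
Variables (a : chart M) (x0 : M) (ax0 : dom M a x0).
Notation U := (Defs.coord M a @` dom M a).
Notation y0 := (Defs.coord M a x0).
Notation h := (metric M a).
Notation e := (Defs.frame M a).
Notation L := (local_dirac h e eps G).
Variable sg : bool.

Lemma eps_neq0 i : eps i != 0.
Proof. by apply/eqP => e0; move/eqP: (eps2 i); rewrite e0 mul0r eq_sym oner_eq0. Qed.

Lemma signCi2 : (signC R sg * 'i%C) * (signC R sg * 'i%C) = -1.
Proof. by rewrite mulrACA -!expr2 /signC sqrr_sign mul1r sqr_i. Qed.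

Lemma eigenproj_eigen (w : 'cV[R[i]]_D) : in_eigenbundle Gamma sg (eigenproj Gamma sg w).
Proof.
rewrite /in_eigenbundle /eigenproj; move: (signC R sg * 'i%C) signCi2 => z zz.
rewrite -scalemxAr [RHS]scalerA [z * _]mulrC -[RHS]scalerA; congr (_ *: _).
rewrite mulmxBr scalerBr -scalemxAr mulmxA GR2 mulNmx mul1mx scalerN opprK.
by rewrite scalerA zz scaleN1r opprK addrC.
Qed.

(* If one eigenspace of [GR] were zero then [GR] would be scalar, whereas it
   anticommutes with the invertible [GammaT i0]. *)
Lemma exists_eigenvector : exists2 v : 'cV[R[i]]_D, v != 0 & in_eigenbundle Gamma sg v.
Proof.
apply: contrapT => nex.
have i0 := Ordinal n_gt0.
have P0 w : eigenproj Gamma sg w = 0.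
  apply/eqP; apply/negPn/negP => w0; apply: nex; exists (eigenproj Gamma sg w) => //.
  exact: eigenproj_eigen.
have E (w : 'cV[R[i]]_D) : w = (signC R sg * 'i%C) *: (GR *m w).
  apply/eqP; rewrite -subr_eq0; apply/eqP/(scalerI (_ : toC 2%:R^-1 != 0)).
    by rewrite toC_eq0 invr_eq0 pnatr_eq0.
  by rewrite scaler0 -[RHS](P0 w).
have GRw (w : 'cV[R[i]]_D) : GR *m w = - (signC R sg * 'i%C) *: w.
  by rewrite {1}[w]E -(scalemxAr _ GR) mulmxA GR2 mulNmx mul1mx scalerN scaleNr.
pose w : 'cV[R[i]]_D := delta_mx (Ordinal D_gt0) 0.
have e2 : GR *m (GammaT Gamma i0 *m w) = (signC R sg * 'i%C) *: (GammaT Gamma i0 *m w).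
  by rewrite mulmxA GRanti mulNmx -mulmxA GRw -scalemxAr scaleNr opprK.
have s0 : 2%:R * (signC R sg * 'i%C) != 0 :> R[i].
  rewrite mulf_neq0 ?pnatr_eq0 //; apply/eqP => s0; move: signCi2; rewrite s0 mul0r => /eqP.
  by rewrite eq_sym oppr_eq0 oner_eq0.
have /eqP : (2%:R * (signC R sg * 'i%C)) *: (GammaT Gamma i0 *m w) = 0.
  by rewrite [_%:R * _]mulr_natl mulr2n scalerDl -{1}e2 GRw scaleNr addNr.
rewrite scaler_eq0 (negbTE s0) /= => /eqP Gw.
have /square_scalar_inj/(_ (GammaT2 i0) Gw) : - toC (eps i0) != 0.
  by rewrite oppr_eq0 toC_eq0 eps_neq0.
move=> /colP/(_ (Ordinal D_gt0)); rewrite !mxE !eqxx => /eqP.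
by rewrite oner_eq0.
Qed.

Variables (N : nat) (kappa : R[i]) (P : {poly R[i]}).
Hypothesis P_monic : P`_(2 * N + 1) = 1.
Hypothesis P_size : (size P <= (2 * N + 1).+1)%N.
Variable Q : spinor_family M D -> spinor_family M D.
Hypothesis Q_order : diff_op_order_le (is_smooth_eigenspinor Gamma sg) Q (2 * N).
Hypothesis QE : forall Psi, is_smooth_eigenspinor Gamma sg Psi -> forall x, dom M a x ->
  Q Psi a x = kappa *: pact L P (fun y => Psi a (param M a y)) (Defs.coord M a x)
    - iter (2 * N + 1) L (fun y => Psi a (param M a y)) (Defs.coord M a x).

Lemma leading_coefficient : kappa = 1.
Proof.
have oU : open U by exact: open_chart.
have Uy0 : U y0 by exists x0.
have [rho rho0 boxU] := exists_box oU Uy0.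
have [v v0 v_eigen] := exists_eigenvector.
pose i0 := Ordinal n_gt0.
pose xi : 'rV[R]_n := \row_k invmx (e y0) k i0.
pose K := (2 * N + 1)%N.
have toCX (r : R) k : toC (r ^+ k) = toC r ^+ k.
  by elim: k => // k IH; rewrite !exprS toCM IH.
pose Psi := @test_spinor R n d D eps gamma M Gamma a x0 xi rho K v.
have sPsi : is_smooth_eigenspinor Gamma sg Psi.
  exact: (test_smooth GR2 GRanti BA GB GB' xi K rho0 boxU v_eigen).
pose f u := toC (linear_part y0 xi u).
pose Gf u := toC (box_bump y0 rho u) *: v.
have sf : csmooth_on U f.
  apply: csmooth_on_toC; apply: (smooth_on_linear_part y0 xi (Phi := id) oU) => k.
  exact: smooth_on_coord.
have sG : vsmooth_on U Gf.
  apply: vsmooth_onZ => //; last by move=> i; exact: csmooth_on_cst.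
  apply: csmooth_on_toC; apply: (smooth_on_bump y0 rho (Phi := id) oU) => k.
  exact: smooth_on_coord.
have FE y : U y -> Psi a (param M a y) = f y ^+ K *: Gf y.
  move=> Uy; have ay := param_dom Uy; rewrite /Psi /test_spinor; case: pselect => // ay2.
  rewrite (lift_selfX rel_gamma GR2 GRanti BA GB GB' ay) mul1mx coord_param //.
  by rewrite /Gf scalerA /bump_jet toCM toCX.
have f0 : f y0 = 0 by rewrite /f /linear_part big1 // => k _; rewrite subrr mul0r.
have LE F y : U y -> vdifferentiable F y ->
    L F y = first_order (dirac_symbol e eps G) (dirac_potential h e eps G) F y.
  by move=> _; exact: local_diracE.
have sS k : msmooth_on U (dirac_symbol e eps G k).
  by apply: msmooth_dirac_symbol => //; exact: smooth_on_frame.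
have sPot : msmooth_on U (dirac_potential h e eps G).
  apply: msmooth_dirac_potential => //; [exact: smooth_on_metric
    | exact: smooth_on_inv_metric | exact: smooth_on_frame].
pose psi0 := fun y => Psi a (param M a y).
have itK k : (k < K)%N -> iter k L psi0 y0 = 0.
  move=> kK; have [G' [_ -> //]] := iter_vanish oU sf sS sPot LE f0 sG FE (ltnW kK).
  by rewrite f0 expr0n subn_eq0 leqNgt kK scale0r.
have symE : symbol_at f (dirac_symbol e eps G) y0 = toC (eps i0) *: G i0.
  have df k : cderive f y0 (delta_mx 0 k) = toC (xi 0 k).
    apply: complex_eq => /=; last by rewrite derive_cst.
    rewrite derive_linear_part (bigD1 k) //= big1 ?addr0 => [|j jk].
      by rewrite !mxE !eqxx mul1r.
    by rewrite !mxE eqxx (negbTE jk) mul0r.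
  rewrite /symbol_at /dirac_symbol.
  under eq_bigr => k _ do rewrite df scaler_sumr.
  rewrite exchange_big /=.
  transitivity (\sum_i toC (eps i * (i == i0)%:R) *: G i).
    apply: eq_bigr => i _.
    under eq_bigr => k _ do rewrite scalerA -toCM.
    rewrite -scaler_suml -(big_morph (@toC R) (@toCD R) (@toC0 R)); congr (toC _ *: _).
    have [ue _] := frame_metric_inv eps2 ax0.
    transitivity (eps i * (e y0 *m invmx (e y0)) i i0); last by rewrite mulmxV // mxE.
    rewrite mxE mulr_sumr; apply: eq_bigr => k _.
    by rewrite mxE; ring.
  rewrite (bigD1 i0) //= big1 ?addr0 => [|i ii0]; first by rewrite ?eqxx mulr1.
  by rewrite (negbTE ii0) mulr0 toC0 scale0r.
have [G' [_ itE G'0]] := iter_vanish oU sf sS sPot LE f0 sG FE (leqnn K).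
have := itE y0 Uy0; rewrite subnn expr0 scale1r G'0 => {itE}{}itE.
have lead0 : iter K L psi0 y0 != 0.
  rewrite itE ffactnn scaler_eq0 pnatr_eq0 negb_or -lt0n fact_gt0 /=.
  have pow0 k (w : 'cV[R[i]]_D) : w != 0 -> iter k (mulmx (symbol_at f (dirac_symbol e eps G) y0)) w != 0.
    move=> w0; elim: k => // k IH.
    rewrite /= {1}symE -scalemxAl; apply: contra_neq IH => /eqP.
    rewrite scaler_eq0 toC_eq0 (negbTE (eps_neq0 _)) /= => /eqP.
    apply: (@square_scalar_inj _ _ _ (- toC (eps i0))).
      by rewrite oppr_eq0 toC_eq0 eps_neq0.
    by rewrite (boundary_clifford2 GR2 GRanti) GammaT2.
  apply: pow0; rewrite scaler_eq0 negb_or v0 toC_eq0 andbT.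
  by rewrite gt_eqF // bump_center.
have [Acf [_ HA]] := Q_order a.
have := HA Psi sPsi x0 ax0; rewrite QE // big1 => [|l _]; last first.
  rewrite big1 // => w _.
  have sw : (size w <= K)%N by rewrite size_tuple; case: l w => l /= lK _; rewrite /K; lia.
  have [G'' _ ->] := partials_vanish oU sf sG FE sw; last by [].
  rewrite f0 expr0n subn_eq0 leqNgt size_tuple.
  have -> : (l < K)%N by rewrite /K addn1.
  by rewrite scale0r mulmx0.
have -> : pact L P psi0 y0 = iter K L psi0 y0.
  rewrite (pact_widen _ _ _ P_size) big_ord_recr /= P_monic scale1r big1 ?add0r // => k _.
  by rewrite itK ?scaler0.
rewrite -[X in _ - X]scale1r -scalerBl => /eqP; rewrite scaler_eq0 (negbTE lead0) orbF.
by rewrite subr_eq0 => /eqP.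
Qed.

End LeadingCoefficient.

(** * Assembling the two eigenbundles *)

Section PolynomialActionProduct.
Variables (R : realType) (m d : nat) (U : set 'rV[R]_m).
Hypothesis oU : open U.
Variable L : ('rV[R]_m -> 'cV[R[i]]_d) -> 'rV[R]_m -> 'cV[R[i]]_d.
Hypothesis L_smooth : forall f, vsmooth_on U f -> vsmooth_on U (L f).
Hypothesis L_ext : forall f g, vsmooth_on U f -> (forall y, U y -> f y = g y) ->
  forall y, U y -> L f y = L g y.
Hypothesis L_D : forall f g y, U y -> vsmooth_on U f -> vsmooth_on U g ->
  L (fun z => f z + g z) y = L f y + L g y.
Hypothesis L_Z : forall c f y, U y -> vsmooth_on U f ->
  L (fun z => c *: f z) y = c *: L f y.

Lemma pactM (p q : {poly R[i]}) f y : U y -> vsmooth_on U f ->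
  pact L (p * q) f y = pact L p (pact L q f) y.
Proof.
move=> Uy sf; elim/poly_ind: p y Uy => [|p c IH] y Uy.
  by rewrite mul0r -polyC0 !pactC !scale0r.
have sq : vsmooth_on U (pact L q f) by exact: pact_smooth.
have spq : vsmooth_on U (pact L (p * q) f) by exact: pact_smooth.
rewrite mulrDl [p * 'X]mulrC -mulrA mul_polyC !pactD pactZ pactC.
rewrite !(pactX oU L_smooth L_D L_Z) //.
by congr (_ + _); apply: L_ext.
Qed.

Lemma iterD k f g y : U y -> vsmooth_on U f -> vsmooth_on U g ->
  iter k L (fun z => f z + g z) y = iter k L f y + iter k L g y.
Proof.
move=> Uy sf sg; elim: k y Uy => // k IH y Uy /=.
have sfk : vsmooth_on U (iter k L f) by exact: iter_smooth.
have sgk : vsmooth_on U (iter k L g) by exact: iter_smooth.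
rewrite -L_D //; apply: L_ext => //.
by apply: iter_smooth => //; exact: vsmooth_onD.
Qed.

Lemma pact_add p f g y : U y -> vsmooth_on U f -> vsmooth_on U g ->
  pact L p (fun z => f z + g z) y = pact L p f y + pact L p g y.
Proof.
move=> Uy sf sg; rewrite -big_split /=; apply: eq_bigr => i _.
by rewrite iterD // scalerDr.
Qed.

Section Transfer.
Variables (d' : nat) (L' : ('rV[R]_m -> 'cV[R[i]]_d') -> 'rV[R]_m -> 'cV[R[i]]_d').
Variable X : 'M[R[i]]_(d', d).
Hypothesis L'_ext : forall f g, vsmooth_on U f -> (forall y, U y -> f y = g y) ->
  forall y, U y -> L' f y = L' g y.
Hypothesis XL : forall f y, U y -> vsmooth_on U f ->
  X *m L f y = L' (fun z => X *m f z) y.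

Lemma const_mulmx_smooth f : vsmooth_on U f -> vsmooth_on U (fun z => X *m f z).
Proof.
by apply: mulmx_smooth => // i j; exact: csmooth_on_cst.
Qed.

Lemma pact_transfer p f y : U y -> vsmooth_on U f ->
  X *m pact L p f y = pact L' p (fun z => X *m f z) y.
Proof.
move=> Uy sf; rewrite /pact mulmx_sumr; apply: eq_bigr => i _.
rewrite -scalemxAr; congr (_ *: _); elim: (i : nat) y Uy => // k IH y Uy /=.
have sk : vsmooth_on U (iter k L f) by exact: iter_smooth.
rewrite XL //; apply: L'_ext => //; exact: const_mulmx_smooth.
Qed.
End Transfer.

End PolynomialActionProduct.

Section FactorProduct.
Variables (F : fieldType) (mu : F) (N : nat).

Lemma prod_linear_factors :
  \prod_(1 <= j < (2 * N + 1).+1) ('X - ((N%:R - j%:R + 1) * mu)%:P)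
  = 'X * \prod_(1 <= j < N.+1) ('X^2 - (j%:R ^+ 2 * mu ^+ 2)%:P) :> {poly F}.
Proof.
rewrite (@big_cat_nat _ _ _ N.+1) //=; last by lia.
rewrite [X in _ * X]big_ltn; last by lia.
have -> : N%:R - N.+1%:R + 1 = 0 :> F by rewrite -natr1; ring.
rewrite mul0r polyC0 subr0 mulrCA; congr (_ * _).
rewrite big_nat_rev /= -[N.+2]/(1 + N.+1)%N big_addn.
have -> : ((2 * N + 1).+1 - N.+1 = N.+1)%N by lia.
rewrite -big_split /=; apply: eq_big_nat => j /andP[j1 jN].
have -> : (1 + N.+1 - j.+1 = N.+1 - j)%N by lia.
rewrite natrB ?(leq_trans (ltnW jN)) // natrD -!natr1.
rewrite (_ : (N%:R - (N%:R + 1 - j%:R) + 1) * mu = j%:R * mu); last by ring.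
rewrite (_ : (N%:R - (j%:R + (N%:R + 1)) + 1) * mu = - (j%:R * mu)); last by ring.
rewrite polyCN opprK -exprMn polyC_exp.
by ring.
Qed.
End FactorProduct.

Lemma prod_linear_epoly (F : numFieldType) (a mu : F) N : 4%:R * a = mu ^+ 2 ->
  \prod_(1 <= j < (2 * N + 1).+1) ('X - ((N%:R - j%:R + 1) * mu)%:P) = 'X * epoly a N.
Proof.
move=> a_mu; rewrite prod_linear_factors; congr (_ * _); apply: eq_bigr => j _.
by rewrite a_mu mulrC.
Qed.

Lemma prod_quadratic_epoly (F : numFieldType) (a b : F) N : 4%:R * a = b ->
  \prod_(1 <= j < N.+1) ('X^2 - (j%:R ^+ 2 * b)%:P) = epoly a N.
Proof. by move=> <-; apply: eq_bigr => j _; rewrite mulrC. Qed.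

Lemma epolyX_monic (F : numFieldType) (a : F) N :
  (size ('X * epoly a N)%R <= (2 * N + 1).+1)%N /\ ('X * epoly a N)`_(2 * N + 1) = 1.
Proof.
have s2 c : size ('X^2 - c%:P : {poly F}) = 3.
  by rewrite size_polyDl size_polyXn // size_polyN (leq_ltn_trans (size_polyC_leq1 _)).
have m2 c : ('X^2 - c%:P : {poly F}) \is monic.
  rewrite monicE lead_coefDl ?lead_coefXn // size_polyXn size_polyN.
  by rewrite (leq_ltn_trans (size_polyC_leq1 _)).
have me l : epoly a l \is monic /\ size (epoly a l) = (2 * l).+1.
  elim: l => [|l [ml sl]]; first by rewrite /epoly big_geq // monic1 size_poly1.
  rewrite epolyS; split; first by rewrite monicMl.
  by rewrite size_monicM // ?monic_neq0 // s2 sl; lia.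
have [mN sN] := me N.
have sX : size ('X * epoly a N) = (2 * N).+2 by rewrite mulrC size_mulX ?monic_neq0 // sN.
split; first by rewrite sX addn1.
have : 'X * epoly a N \is monic by rewrite monicMl ?monicX.
by rewrite monicE lead_coefE sX addn1 => /eqP.
Qed.

Section CliffordRelations.
Variables (R : realType) (n D : nat) (eps : 'I_n -> R) (Gamma : 'I_(n + 1) -> 'M[R[i]]_D).
Hypothesis rel : forall i j, Gamma i *m Gamma j + Gamma j *m Gamma i
  = (if i == j then - 2%:R * toC (epsX eps i) else 0)%:M.

Lemma half_anticommutator (X : 'M[R[i]]_D) c : X *m X + X *m X = (- 2%:R * c)%:M -> X *m X = (- c)%:M.
Proof.
move=> E; have two : 2%:R != 0 :> R[i] by rewrite pnatr_eq0.
apply: (scalerI two); rewrite scale_scalar_mx scaler_nat mulr2n E.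
by rewrite mulrN mulNr.
Qed.

Lemma GammaR_sq : GammaR Gamma *m GammaR Gamma = - 1%:M.
Proof.
have := rel (rshift n ord0) (rshift n ord0); rewrite eqxx => /half_anticommutator.
rewrite /epsX; case: split_ordP => j; first by move/eqP; rewrite eq_rlshift.
by move=> _; rewrite toC1 raddfN.
Qed.

Lemma GammaR_anti i : GammaR Gamma *m GammaT Gamma i = - (GammaT Gamma i *m GammaR Gamma).
Proof.
have := rel (rshift n ord0) (lshift 1 i); rewrite eq_rlshift raddf0 => /eqP.
by rewrite addr_eq0 => /eqP.
Qed.

Lemma GammaT_sq i : GammaT Gamma i *m GammaT Gamma i = (- toC (eps i))%:M.
Proof.
have := rel (lshift 1 i) (lshift 1 i); rewrite eqxx => /half_anticommutator.
rewrite /epsX; case: split_ordP => j; last by move/eqP; rewrite eq_lrshift.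
by move=> /lshift_inj <-.
Qed.
End CliffordRelations.

(* For [n] even the second summand is absent, [A' = 0] and [B' = 0]. *)
Lemma identification_split (R : realType) (n d D : nat) (gamma : 'I_n -> 'M[R[i]]_d)
    (Gamma : 'I_(n + 1) -> 'M[R[i]]_D) (A : 'M[R[i]]_(d, D)) (B : 'M[R[i]]_(D, d)) :
  is_spinor_identification gamma Gamma A B ->
  exists A' B', [/\ A *m B = 1%:M, B *m A + B' *m A' = 1%:M,
    forall i, A *m boundary_clifford Gamma i = gamma i *m A,
    forall i, boundary_clifford Gamma i *m B = B *m gamma i
    & forall i, boundary_clifford Gamma i *m B' = - (B' *m gamma i) :> 'M[R[i]]_(D, d)].
Proof.
rewrite /is_spinor_identification; case: odd => [[A' [B' [[AB A'B'] [AB' A'B] BA HA HA']]]|[AB BA HA]].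
  have HG i : A *m boundary_clifford Gamma i = gamma i *m A := HA i.
  have HG' i : A' *m boundary_clifford Gamma i = - (gamma i *m A') := HA' i.
  have key (g : 'M[R[i]]_D) (c : 'M[R[i]]_d) : A *m g = c *m A -> A' *m g = - (c *m A') ->
      g *m B = B *m c /\ g *m B' = - (B' *m c).
    move=> Ag A'g; split; rewrite -[LHS]mul1mx -BA mulmxDl -!mulmxA (mulmxA A) (mulmxA A') Ag A'g.
      by rewrite mulNmx -!mulmxA AB A'B mulmx1 mulmx0 oppr0 mulmx0 addr0.
    by rewrite mulNmx -!mulmxA AB' A'B' mulmx1 mulmx0 mulmx0 add0r mulmxN.
  by exists A', B'; split=> // i; have [] := key _ _ (HG i) (HG' i).
have HG i : A *m boundary_clifford Gamma i = gamma i *m A := HA i.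
exists 0, 0; split=> // [|i|i]; rewrite ?mulmx0 ?mul0mx ?addr0 ?oppr0 //.
move: (HG i); move: (boundary_clifford Gamma i) => g Ag.
by rewrite -[LHS]mul1mx -BA -mulmxA (mulmxA A) Ag -mulmxA AB mulmx1.
Qed.

Section CompositionProducts.
Variables (R : realType) (n d : nat) (eps : 'I_n -> R).
Variables (gamma : 'I_n -> 'M[R[i]]_d) (M : spin_manifold eps gamma).
Hypothesis eps2 : forall i, eps i * eps i = 1.
Variable a : chart M.
Notation U := (Defs.coord M a @` dom M a).
Notation L := (local_dirac (metric M a) (Defs.frame M a) eps gamma).
Notation D := (@dirac_op R n d eps gamma M).
Notation loc phi := (fun y => phi a (param M a y)).

Let oU : open U. Proof. exact: open_chart. Qed.
Let Ls := @chart_dirac_smooth R n d d eps gamma M eps2 a gamma.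
Let Lx := @chart_dirac_ext R n d d eps gamma M a gamma.
Let LD := @chart_diracD R n d d eps gamma M a gamma.
Let LZ := @chart_diracZ R n d d eps gamma M a gamma.

Lemma dirac_op_loc phi y : U y -> loc (D phi) y = L (loc phi) y.
Proof. by move=> Uy; rewrite /dirac_op coord_param. Qed.

Definition acts_as (F : spinor_family M d -> spinor_family M d) (p : {poly R[i]}) :=
  forall phi, vsmooth_on U (loc phi) -> forall y, U y ->
    loc (F phi) y = pact L p (loc phi) y.

Lemma acts_as_comp (F : nat -> spinor_family M d -> spinor_family M d) (p : nat -> {poly R[i]})
    (s : seq nat) :
  (forall j, acts_as (F j) (p j)) ->
  acts_as (\big[(fun F G => F \o G)/id]_(j <- s) F j) (\prod_(j <- s) p j).
Proof.
move=> Fp; elim: s => [|j s IH] phi sphi y Uy.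
  by rewrite !big_nil -polyC1 pactC scale1r.
have sp : vsmooth_on U (pact L (\prod_(j <- s) p j) (loc phi)) by exact: pact_smooth.
have sq : vsmooth_on U (loc ((\big[(fun F G => F \o G)/id]_(j <- s) F j) phi)).
  by apply: vsmooth_on_ext sp => // z Uz; rewrite IH.
rewrite !big_cons (pactM oU Ls Lx LD LZ) //= Fp //.
by apply: (pact_ext Ls Lx) => // z Uz; exact: IH.
Qed.

Lemma acts_as_linear c : acts_as (fun phi b y => D phi b y - c *: phi b y) ('X - c%:P).
Proof.
move=> phi sphi y Uy; rewrite -polyCN pactD pactC scaleNr; congr (_ - _).
by rewrite -[pact _ _ _ _]/(pact L 'X^1 _ _) pactXn; exact: dirac_op_loc.
Qed.

Lemma acts_as_quadratic c : acts_as (fun phi b y => D (D phi) b y - c *: phi b y) ('X^2 - c%:P).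
Proof.
move=> phi sphi y Uy; rewrite -polyCN pactD pactC scaleNr; congr (_ - _).
rewrite pactXn; apply: etrans (dirac_op_loc (D phi) Uy) _.
exact: (esym (Lx (Ls sphi) (fun z Uz => esym (dirac_op_loc phi Uz)) Uy)).
Qed.

End CompositionProducts.

Section EigenSections.
Variables (R : realType) (n d D : nat) (eps : 'I_n -> R).
Variables (gamma : 'I_n -> 'M[R[i]]_d) (M : spin_manifold eps gamma) (J rad : R).
Variable Gamma : 'I_(n + 1) -> 'M[R[i]]_D.
Hypothesis n_gt0 : (0 < n)%N.
Hypothesis eps2 : forall i, eps i * eps i = 1.
Hypothesis rad_gt0 : 0 < rad.
Hypothesis rad_small : forall r, 0 <= r -> r < rad -> 0 < conf_factor n J r.
Notation GR := (GammaR Gamma).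
Hypothesis GR2 : GR *m GR = - 1%:M.
Hypothesis GRanti : forall i, GR *m GammaT Gamma i = - (GammaT Gamma i *m GR).
Notation G := (boundary_clifford Gamma).
Notation signCi sg := (signC R sg * 'i%C).

Lemma eigenproj_opposite sg (w : 'cV[R[i]]_D) :
  GR *m w = - signCi sg *: w -> eigenproj Gamma (~~ sg) w = w.
Proof.
move=> Gw; rewrite /eigenproj Gw.
have -> : signC R (~~ sg) * 'i%C = - signCi sg.
  by rewrite /signC; case: sg {Gw}; rewrite expr0 expr1 mulN1r mul1r ?opprK.
have E (z : R[i]) : z * z = -1 -> - z *: (- z *: w) = - w.
  by move=> zz; rewrite scalerA mulrNN zz scaleN1r.
rewrite (E _ (signCi2 R sg)) opprK -mulr2n -[w *+ _]scaler_nat scalerA.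
by rewrite -toC_nat -toCM mulVf ?scale1r // pnatr_eq0.
Qed.

Lemma eigenproj_sum (w : 'cV[R[i]]_D) : eigenproj Gamma true w + eigenproj Gamma false w = w.
Proof.
rewrite /eigenproj /signC expr0 expr1 -scalerDr mul1r mulN1r scaleNr opprK addrACA addrN addr0.
by rewrite -mulr2n -[w *+ _]scaler_nat scalerA -toC_nat -toCM mulVf ?scale1r // pnatr_eq0.
Qed.

Variables (A A' : 'M[R[i]]_(d, D)) (B B' : 'M[R[i]]_(D, d)).
Hypothesis BA : B *m A + B' *m A' = 1%:M.
Hypothesis GB : forall i, G i *m B = B *m gamma i.
Hypothesis GB' : forall i, G i *m B' = - (B' *m gamma i).

Lemma eigenproj_mulmx sg (X : 'M[R[i]]_D) (w : 'cV[R[i]]_D) : X *m GR = GR *m X ->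
  eigenproj Gamma sg (X *m w) = X *m eigenproj Gamma sg w.
Proof.
by move=> XG; rewrite /eigenproj -scalemxAr mulmxBr -scalemxAr !mulmxA XG.
Qed.

Lemma eigenprojE sg (w : 'cV[R[i]]_D) :
  eigenproj Gamma sg w = (toC 2%:R^-1 *: (1%:M - signCi sg *: GR)) *m w.
Proof. by rewrite /eigenproj -scalemxAl mulmxBl mul1mx -scalemxAl. Qed.

Lemma eigenproj_smooth sg (psi : spinor_family M d) : is_smooth_spinor gamma psi ->
  is_smooth_eigenspinor Gamma sg (fun b y => eigenproj Gamma sg (B *m psi b y)).
Proof.
move=> [tr sm]; split; last by move=> a x ax; exact: eigenproj_eigen.
split=> [a b x ax bx|a].
  have ev := lift_even ax bx.
  rewrite (tr a b x ax bx) mulmxA -(lift_B GR2 GRanti GB GB' ev).1 -mulmxA eigenproj_mulmx //.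
  exact: (lift_GR GR2 GRanti ev).
have oU : open (Defs.coord M a @` dom M a) by exact: open_chart.
apply: (vsmooth_on_ext oU (f := fun y =>
  ((toC 2%:R^-1 *: (1%:M - signCi sg *: GR)) *m B) *m psi a (param M a y))).
  by move=> y _; rewrite eigenprojE mulmxA.
by apply: mulmx_smooth => // i j; exact: csmooth_on_cst.
Qed.

Lemma leaf_dirac0 a Psi x : dom M a x ->
  leaf_dirac J Gamma 0 Psi a x
  = local_dirac (metric M a) (Defs.frame M a) eps G (fun y => Psi a (param M a y)) (Defs.coord M a x).
Proof.
move=> ax; rewrite -(@boundary_diracE R n d D eps gamma M Gamma GR2 GRanti a) /leaf_dirac /boundary_dirac.
have c0 : conf_factor n J 0 = 1 by rewrite /conf_factor expr0n mulr0 subr0.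
have -> : leaf_metric J a 0 = metric M a.
  by apply/funext => y; rewrite /leaf_metric c0 expr1n scale1r.
have -> // : leaf_frame J a 0 = Defs.frame M a.
by apply/funext => y; rewrite /leaf_frame c0 invr1 scale1r.
Qed.

Lemma iter_leaf_dirac0 a k Psi x :
  vsmooth_on (Defs.coord M a @` dom M a) (fun y => Psi a (param M a y)) -> dom M a x ->
  iter k (leaf_dirac J Gamma 0) Psi a x
  = iter k (local_dirac (metric M a) (Defs.frame M a) eps G)
      (fun y => Psi a (param M a y)) (Defs.coord M a x).
Proof.
move=> sPsi; elim: k x => [|k IH] x ax; first by rewrite /= coordK.
have oU : open (Defs.coord M a @` dom M a) by exact: open_chart.
have Uy : (Defs.coord M a @` dom M a) (Defs.coord M a x) by exists x.
have sk := iter_smooth (chart_dirac_smooth eps2 G) k sPsi.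
have E y : (Defs.coord M a @` dom M a) y ->
    iter k (local_dirac (metric M a) (Defs.frame M a) eps G) (fun y => Psi a (param M a y)) y
    = iter k (leaf_dirac J Gamma 0) Psi a (param M a y).
  by move=> Uz; rewrite IH ?coord_param //; exact: param_dom.
have e1 := @leaf_dirac0 a (iter k (leaf_dirac J Gamma 0) Psi) x ax.
have e2 := @chart_dirac_ext _ _ _ _ _ _ _ a G _ _ sk E _ Uy.
exact: (etrans e1 (esym e2)).
Qed.

End EigenSections.

Theorem theorem5p2 (R : realType) (n p q : nat)
    (n_eq : n = (p + q)%N) (n_ge3 : (3 <= n)%N)
    (gamma : 'I_n -> 'M[R[i]]_(2 ^ n./2))
    (gamma_rep : is_irreducible_clifford_rep (sign_of R p) gamma)
    (Gamma : 'I_(n + 1) -> 'M[R[i]]_(2 ^ (n + 1)./2))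
    (Gamma_rep : is_irreducible_clifford_rep (epsX (sign_of R p)) Gamma)
    (A : 'M[R[i]]_(2 ^ n./2, 2 ^ (n + 1)./2))
    (B : 'M[R[i]]_(2 ^ (n + 1)./2, 2 ^ n./2))
    (AB_ident : is_spinor_identification gamma Gamma A B)
    (M : spin_manifold (sign_of R p) gamma)
    (J : R) (M_einstein : is_einstein M J)
    (rad : R) (rad_gt0 : 0 < rad)
    (rad_small : forall r, 0 <= r -> r < rad -> 0 < conf_factor n J r)
    (sqrtJ : R[i]) (sqrtJ2 : sqrtJ ^+ 2 = toC (2%:R * J / n%:R))
    (N : nat) (DN : spinor_family M (2 ^ n./2) -> spinor_family M (2 ^ n./2))
    (DN_conformal_power : is_conformal_power J rad Gamma N A B DN)
    (psi : spinor_family M (2 ^ n./2)) (psi_smooth : is_smooth_spinor gamma psi)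
    (a : chart M) (x : M) (ax : dom M a x) :
  let D := @dirac_op R n (2 ^ n./2) (sign_of R p) gamma M in
  let prod1 :=
    \big[(fun F G => F \o G)/id]_(1 <= j < (2 * N + 1).+1)
      (fun phi : spinor_family M (2 ^ n./2) => fun b y =>
         D phi b y - ((N%:R - j%:R + 1) * sqrtJ) *: phi b y) in
  let prod2 :=
    \big[(fun F G => F \o G)/id]_(1 <= j < N.+1)
      (fun phi : spinor_family M (2 ^ n./2) => fun b y =>
         D (D phi) b y - (j%:R ^+ 2 * toC (2%:R * J / n%:R)) *: phi b y) in
  DN psi a x = prod1 psi a x /\ prod1 psi a x = D (prod2 psi) a x.
Proof.
move=> D prod1 prod2.
have n_gt0 : (0 < n)%N by rewrite (leq_trans _ n_ge3).
have eps2 (i : 'I_n) : sign_of R p i * sign_of R p i = 1.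
  by rewrite /sign_of; case: ifP; rewrite ?mulrNN mulr1.
have D_gt0 : (0 < 2 ^ (n + 1)./2)%N by rewrite expn_gt0.
have GR2 := GammaR_sq Gamma_rep.1.
have GRanti := GammaR_anti Gamma_rep.1.
have GammaT2 := GammaT_sq Gamma_rep.1.
have [A' [B' [AB BA AG GB GB']]] := identification_split AB_ident.
pose U := Defs.coord M a @` dom M a.
have oU : open U by exact: open_chart.
set y := Defs.coord M a x; have Uy : U y by exists x.
pose L := local_dirac (metric M a) (Defs.frame M a) (sign_of R p) gamma.
pose LX := local_dirac (metric M a) (Defs.frame M a) (sign_of R p) (boundary_clifford Gamma).
pose aC : R[i] := toC (J / (2%:R * n%:R)).
have mu2 : 4%:R * aC = sqrtJ ^+ 2.
  rewrite sqrtJ2 /aC -toC_nat -toCM; congr toC; field.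
  by rewrite pnatr_eq0 -lt0n.
pose P : {poly R[i]} := 'X * epoly aC N.
have P_prod1 : \prod_(1 <= j < (2 * N + 1).+1) ('X - ((N%:R - j%:R + 1) * sqrtJ)%:P) = P.
  exact: prod_linear_epoly.
have psi0_smooth : vsmooth_on U (fun z => psi a (param M a z)) by exact: psi_smooth.2.
have px : param M a y = x by rewrite coordK.
have E1 : prod1 psi a x = pact L P (fun z => psi a (param M a z)) y.
  rewrite -P_prod1 -[in LHS]px.
  have H := acts_as_comp eps2 (a := a)
    (F := fun j phi b z => D phi b z - ((N%:R - j%:R + 1) * sqrtJ) *: phi b z)
    (p := fun j => 'X - ((N%:R - j%:R + 1) * sqrtJ)%:P)
    (index_iota 1 (2 * N + 1).+1) (fun j => acts_as_linear (a := a) _).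
  exact: (H psi psi0_smooth y Uy).
have E2 : D (prod2 psi) a x = pact L P (fun z => psi a (param M a z)) y.
  have P2E : \prod_(1 <= j < N.+1) ('X^2 - (j%:R ^+ 2 * toC (2%:R * J / n%:R))%:P) = epoly aC N.
    by apply: prod_quadratic_epoly; rewrite mu2.
  have H := acts_as_comp eps2 (a := a)
    (F := fun j phi b z => D (D phi) b z - (j%:R ^+ 2 * toC (2%:R * J / n%:R)) *: phi b z)
    (p := fun j => 'X^2 - (j%:R ^+ 2 * toC (2%:R * J / n%:R))%:P)
    (index_iota 1 N.+1) (fun j => acts_as_quadratic eps2 (a := a) _).
  rewrite P2E in H; have {}H := H psi psi0_smooth.
  have sq : vsmooth_on U (pact L (epoly aC N) (fun z => psi a (param M a z))).
    by apply: pact_smooth => //; exact: (chart_dirac_smooth eps2).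
  have sprod2 : vsmooth_on U (fun z => prod2 psi a (param M a z)).
    by apply: (vsmooth_on_ext oU _ sq) => z Uz; exact: (esym (H z Uz)).
  rewrite (pactX oU (chart_dirac_smooth eps2 gamma) (@chart_diracD _ _ _ _ _ _ _ a gamma)
    (@chart_diracZ _ _ _ _ _ _ _ a gamma) _ Uy psi0_smooth).
  have e1 := dirac_op_loc (prod2 psi) Uy.
  have e2 := @chart_dirac_ext _ _ _ _ _ _ _ a gamma _ _ sprod2 H y Uy.
  by rewrite -[in LHS]px [LHS]e1; exact: e2.
split; last by rewrite E1 E2.
have [Obs [c [Obs_c DN_E]]] := DN_conformal_power.
pose PsiB sg := fun b z => eigenproj Gamma sg (B *m psi b z).
have PsiB_smooth sg : is_smooth_eigenspinor Gamma sg (PsiB sg).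
  exact: (eigenproj_smooth GR2 GRanti GB GB' sg psi_smooth).
pose nuC : R[i] := n%:R / 2%:R.
have [cq cq0 cqE] := residue_solution aC nuC N.
have ObsE sg Psi : is_smooth_eigenspinor Gamma sg Psi -> forall x', dom M a x' ->
    Obs sg Psi a x' = (signC R sg * 'i%C * cq)
      *: pact LX P (fun z => Psi a (param M a z)) (Defs.coord M a x').
  move=> sPsi x' ax'; have [_ /(_ _ sPsi) + _] := Obs_c sg.
  move=> [theta [omega [s_theta theta0 s_omega lim_theta XiE]]].
  have lim_a x1 (ax1 : dom M a x1) := lim_theta a x1 ax1.
  have theta0_a x1 (ax1 : dom M a x1) := theta0 a x1 ax1.
  have om := omega_residue n_gt0 eps2 rad_gt0 rad_small GR2 GRanti s_theta s_omega
     lim_a sPsi theta0_a ax'.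
  have ome := omega_eigen n_gt0 eps2 rad_gt0 rad_small GR2 GRanti s_theta s_omega
     lim_a sPsi theta0_a ax'.
  rewrite XiE // (eigenproj_opposite ome) om cqE pactZ scalerA.
  by [].
have P_size : (size P <= (2 * N + 1).+1)%N /\ P`_(2 * N + 1) = 1.
  exact: epolyX_monic.
have kappa1 sg : c sg * (signC R sg * 'i%C * cq) = 1.
  have [c0 _ dord] := Obs_c sg.
  apply: (leading_coefficient n_gt0 D_gt0 eps2 gamma_rep.1 GR2 GRanti GammaT2 BA GB GB'
    ax P_size.2 P_size.1 dord).
  move=> Psi sPsi x' ax' /=; rewrite ObsE // scalerA; congr (_ - _).
  exact: (iter_leaf_dirac0 J eps2 GR2 GRanti (2 * N + 1) (sPsi.1.2 a) ax').
have PB sg : vsmooth_on U (fun z => PsiB sg a (param M a z)) by exact: (PsiB_smooth sg).1.2.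
have termE sg : c sg *: Obs sg (PsiB sg) a x = pact LX P (fun z => PsiB sg a (param M a z)) y.
  by rewrite ObsE // scalerA kappa1 scale1r.
have sumE : \sum_(sg : bool) c sg *: Obs sg (PsiB sg) a x
    = pact LX P (fun z => PsiB true a (param M a z) + PsiB false a (param M a z)) y.
  rewrite big_bool (termE true) (termE false).
  exact: (esym (pact_add oU (chart_dirac_smooth eps2 _) (@chart_dirac_ext _ _ _ _ _ _ _ a _)
    (@chart_diracD _ _ _ _ _ _ _ a _) P Uy (PB true) (PB false))).
rewrite (DN_E psi psi_smooth a x ax) E1.
transitivity (A *m pact LX P (fun z => PsiB true a (param M a z) + PsiB false a (param M a z)) y).
  by rewrite -sumE.
have sB := vsmooth_onD oU (PB true) (PB false).
have AL f z : U z -> vsmooth_on U f -> A *m LX f z = L (fun z => A *m f z) z.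
  move=> Uz sf; have m1 : (1 : R[i]) * 1 = 1 by rewrite mulr1.
  have AG1 i : A *m boundary_clifford Gamma i = 1 *: (gamma i *m A) by rewrite scale1r.
  rewrite (local_dirac_intertwine _ _ _ m1 AG1) ?scale1r //.
  exact: vsmooth_on_vdifferentiable Uz.
rewrite (pact_transfer oU (chart_dirac_smooth eps2 _) (@chart_dirac_ext _ _ _ _ _ _ _ a _) AL P Uy sB).
apply: (pact_ext (chart_dirac_smooth eps2 _) (@chart_dirac_ext _ _ _ _ _ _ _ a _)) => //.
  exact: const_mulmx_smooth.
by move=> z Uz; rewrite eigenproj_sum mulmxA AB mul1mx.
Qed.
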